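(* Let $m\ge1$ be an integer and for any integer $k\in\{0,\dots,m-1\}$ let $$\rho_\infty^{(m,k)}(z):=\left(\frac{\pi}{m}\right)^{\frac1{2m}-\frac zm}\phi_{m,k}(z).$$ Each $\rho_\infty^{(m,k)}$ is a quasi-inner function relative to $\mathbb{C}_-=\{z\in\mathbb{C}\mid\Re(z)\le\frac12\}$, and their product over $k=0,\dots,m-1$ is equal to $\rho_\infty(z)$.
   Context: $\rho_\infty(z):=\dfrac{\pi^{-z/2}\Gamma(z/2)}{\pi^{-(1-z)/2}\Gamma((1-z)/2)}$; $\gamma_{m,k}(z):=\Gamma\left(\frac{z}{2m}+\frac km\right)$ and $\phi_{m,k}(z):=\gamma_{m,k}(z)/\gamma_{m,k}(1-z)$. $L^2(\partial\mathbb{C}_-)$ is the $L^2$-space of the critical line $\Re(z)=\frac12$ for Lebesgue measure; $H^2(\mathbb{C}_-)\subset L^2(\partial\mathbb{C}_-)$ is the closed subspace of boundary values of holomorphic functions $f$ on $\{\Re(z)<\frac12\}$ with $\sup_{x<1/2}\int_{\mathbb{R}}|f(x+iy)|^2dy<\infty$; $\mathcal{P}$ is the orthogonal projection of $L^2(\partial\mathbb{C}_-)$ onto $H^2(\mathbb{C}_-)$. A function $u\in L^\infty(\partial\mathbb{C}_-)$ of modulus $1$ is quasi-inner relative to $\mathbb{C}_-$ if $(1-\mathcal{P})u\mathcal{P}$ is compact, $u$ acting by multiplication. *)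

(* Defs.v *)
From HB Require Import structures.
From mathcomp Require Import all_boot all_order all_algebra.
From mathcomp Require Import complex.
From mathcomp Require Import all_classical all_reals all_analysis.

Set Implicit Arguments.
Unset Strict Implicit.
Unset Printing Implicit Defensive.

Import Order.TTheory GRing.Theory Num.Theory.
Import numFieldNormedType.Exports.

Local Open Scope classical_set_scope.
Local Open Scope complex_scope.
Local Open Scope ring_scope.

Section SpecialFunctions.
Variable R : realType.
Implicit Types (z s : R[i]) (a : R) (m k : nat).

Definition cexp z : R[i] :=
  (expR (complex.Re z))%:C *
  (cos (complex.Im z) +i* sin (complex.Im z)).

(* [a] is meant to be positive *)
Definition cpow a s : R[i] := cexp ((ln a)%:C * s).

(* Euler's limit [n! n^z / (z (z + 1) ... (z + n))], valid on the whole plane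
   minus the poles [0, -1, -2, ...].  At a pole the product is eventually 0
   and 0^-1 = 0, so that [Gamma] takes there the value 0; in particular the
   quotients below have their true value 0 at the poles of the denominator. *)
Definition Gamma z : R[i] :=
  lim ((fun n : nat =>
    (n`!)%:R * cpow n%:R z / \prod_(j < n.+1) (z + j%:R) : R[i]^o) @ \oo).

Definition rho_infty z : R[i] :=
  (cpow pi (- z / 2%:R) * Gamma (z / 2%:R)) /
  (cpow pi (- (1 - z) / 2%:R) * Gamma ((1 - z) / 2%:R)).

Definition gamma_mk m k z : R[i] :=
  Gamma (z / (2%:R * m%:R) + k%:R / m%:R).

Definition phi_mk m k z : R[i] := gamma_mk m k z / gamma_mk m k (1 - z).

Definition rho_mk m k z : R[i] :=
  cpow (pi / m%:R) (1 / (2%:R * m%:R) - z / m%:R) * phi_mk m k z.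

End SpecialFunctions.

(* A function on the critical line is represented by a function of the
   ordinate [y] of the point [1/2 + i y], and an element of L^2 by any
   representative of its class modulo almost everywhere equality. *)
Section QuasiInner.
Variable R : realType.
Implicit Types (f g h u : R -> R[i]) (F : R[i] -> R[i]).

Local Notation mu := (@lebesgue_measure R).

Definition critical_point (y : R) : R[i] := 2%:R^-1 +i* y.

Definition cmeasurable f :=
  measurable_fun setT (fun y => complex.Re (f y)) /\
  measurable_fun setT (fun y => complex.Im (f y)).

Definition cintegral f : R[i] :=
  Rintegral mu setT (fun y => complex.Re (f y)) +i*
  Rintegral mu setT (fun y => complex.Im (f y)).

Definition sqL2norm f : \bar R :=
  (\int[mu]_y ((complex.Re `|f y|) ^+ 2)%:E)%E.

Definition L2 : set (R -> R[i]) :=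
  [set f | cmeasurable f /\ (sqL2norm f < +oo)%E].

Definition L2dot f g : R[i] := cintegral (fun y => f y * (g y)^*).

Definition holomorphic_left F :=
  forall z : R[i], complex.Re z < 2%:R^-1 ->
    derivable (F : R[i]^o -> R[i]^o) z 1.

Definition hardy_function F :=
  holomorphic_left F /\
  exists M : R, forall x : R, x < 2%:R^-1 ->
    (sqL2norm (fun y => F (x +i* y)) <= M%:E)%E.

(* [h] is the boundary value of [F] in the sense of L^2 *)
Definition boundary_value F h :=
  sqL2norm (fun y => F (x +i* y) - h y) @[x --> 2%:R^-1^'-] --> 0%E.

Definition H2 : set (R -> R[i]) :=
  [set h | L2 h /\ exists2 F, hardy_function F & boundary_value F h].

(* Orthogonal projection onto [H2]: the (class of the) element of [H2] at
   which [f] minus this element is orthogonal to [H2]. *)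
Definition projH2 f : R -> R[i] :=
  xget (fun=> 0)
    [set h | H2 h /\ forall g, H2 g -> L2dot (fun y => f y - h y) g = 0].

Definition L2cvg (s : nat -> R -> R[i]) g :=
  sqL2norm (fun y => s n y - g y) @[n --> \oo] --> 0%E.

Definition compact_on_L2 (T : (R -> R[i]) -> (R -> R[i])) :=
  (forall f, L2 f -> L2 (T f)) /\
  forall s : nat -> R -> R[i],
    (forall n, L2 (s n)) ->
    (exists M : R, forall n, (sqL2norm (s n) <= M%:E)%E) ->
    exists e : nat -> nat, {homo e : i j / (i < j)%N} /\
      exists2 g, L2 g & L2cvg (fun n => T (s (e n))) g.

Definition hankel u f : R -> R[i] :=
  let v := fun y => u y * projH2 f y in fun y => v y - projH2 v y.

Definition quasi_inner u :=
  [/\ cmeasurable u, {ae mu, forall y, `|u y| = 1}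
    & compact_on_L2 (hankel u)].

End QuasiInner.

(* Main.v *)
Require Import Defs.
From mathcomp Require Import all_boot all_order all_algebra complex.
From mathcomp Require Import all_classical all_reals all_analysis.
From mathcomp Require Import measurable_realfun ring lra.
Import Order.TTheory GRing.Theory Num.Theory numFieldNormedType.Exports.

(** Up to an exponential, [rho_mk m k] is a quotient of two values of the Gamma
    function, and Euler's product exhibits it on the critical line as the limit
    of the functions
      [u_n (s) = exp (L_n (s - 1/2)) * prod_(j <= n) (1 - p_j - s) / (s - p_j)],
    where [p_j = - 2 k - 2 m j] and [L_n = ln (n m / pi) / m].  As [1 - s] is the
    conjugate of [s] on the line, every factor has modulus 1 there.

    Let [h] be in H^2.  For [n] large, [L_n] is nonnegative, and the exponential
    is bounded by 1 in the left half plane: it preserves H^2 ([H2_exp]).  Expand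
    the product into partial fractions.  Since the difference quotient of [h] at
    [p_j] belongs to H^2 ([H2_quotient]), [u_n h] differs from an element of H^2
    by the sum of the [c_(n, j) h(p_j) / (s - p_j)], where [c_(n, j)] is the
    residue of [u_n] at [p_j] ([approx_H2]).  The decisive point is that
    [|c_(n, j)|] is at most [C a^j / j!], uniformly in [n] ([coef_le]): the
    product of the differences between the poles brings in a factorial.  So [n]
    may tend to infinity, H^2 being closed ([H2_closed], [kernel_sum_limit]): if
    [c_j] is the limit of [c_(n, j)] and [u] is the symbol, then [u h] differs
    from an element of H^2 by [K h], the sum of the [c_j h(p_j) / (s - p_j)].

    On the line the conjugate of [1 / (s - p_j)] is [- 1 / (s - (1 - p_j))], the
    pole of which is on the right, so that [K h] is orthogonal to H^2.  Hence
    the operator in the definition of quasi-inner functions maps [f] to [K h],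
    where [h] is the projection of [f].  It only depends on the sequence of the
    [h(p_j)], which is bounded uniformly in [j] when [f] is bounded in L^2; as
    the [c_j] are summable, a diagonal extraction gives compactness
    ([compact_hankel]).

    What this takes from the theory of Hardy spaces (the holomorphic extension
    is the Cauchy integral of the boundary value, H^2 is closed) follows from
    two formulas on vertical lines, [line_orth] and [line_poisson].  They come
    from Goursat's theorem on rectangles, by letting first the height of the
    rectangle ([strip]) and then its width ([line_integral0]) tend to infinity.

    The product formula is Gauss's multiplication formula.  It is needed for
    quotients of two Gamma values only, and in this form it is a regrouping of
    the factors of Euler's products ([Gamma_multiplication]), once these are
    known to converge to nonzero limits away from the poles ([Gamma_cvg]). *)

Set Implicit Arguments.
Unset Strict Implicit.
Unset Printing Implicit Defensive.
Local Open Scope classical_set_scope.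
Local Open Scope complex_scope.
Local Open Scope ring_scope.

(** * Goursat's theorem on rectangles *)

Section Rectangles.
Variable R : realType.
Local Notation mu := (@lebesgue_measure R).
Implicit Types (P Q : R -> R -> R) (a b c d x y e : R).

Definition diff2 P x y p1 p2 := forall e, 0 < e ->
  exists2 d, 0 < d & forall x' y', `|x' - x| < d -> `|y' - y| < d ->
    `|P x' y' - P x y - p1 * (x' - x) - p2 * (y' - y)|
      <= e * (`|x' - x| + `|y' - y|).

(** Closedness of [P dx + Q dy] at a point.  The partial derivatives are not
    supposed to be continuous, which is what makes the theorem one of Goursat
    rather than of Green. *)
Definition closed_form P Q x y :=
  exists p1 r q2, diff2 P x y p1 r /\ diff2 Q x y r q2.

(** The integral of [P dx + Q dy] along the boundary, opposite sides being
    grouped. *)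
Definition circulation P Q a b c d : R :=
  \int[mu]_(x in `[a, b]) (P x c - P x d) +
  \int[mu]_(y in `[c, d]) (Q b y - Q a y).

Lemma near_dist (p : R) (A : R -> Prop) d : 0 < d ->
  (forall t, `|t - p| < d -> A t) -> \forall t \near p, A t.
Proof.
move=> d0 H; apply/nbhs_ballP; exists d => //= t /=; rewrite /ball /= => ptd.
by apply: H; rewrite distrC.
Qed.

Lemma diff2_cont P x y p1 p2 e : diff2 P x y p1 p2 -> 0 < e ->
  exists2 d, 0 < d & forall x' y', `|x' - x| < d -> `|y' - y| < d ->
    `|P x' y' - P x y| <= e.
Proof.
move=> dP e0; have [d d0 H] := dP 1 ltr01.
pose K := 2 + `|p1| + `|p2|.
have K0 : 0 < K by rewrite /K; have := normr_ge0 p1; have := normr_ge0 p2; lra.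
exists (Num.min d (e / (K * 2))); first by rewrite lt_min d0 !(divr_gt0,mulr_gt0).
move=> x' y'; rewrite !lt_min => /andP[x1 x2] /andP[y1 y2].
have := H _ _ x1 y1; rewrite mul1r => H1.
have -> : P x' y' - P x y = (P x' y' - P x y - p1 * (x' - x) - p2 * (y' - y))
   + (p1 * (x' - x) + p2 * (y' - y)) by ring.
apply: (le_trans (ler_normD _ _)).
have K1 : `|p1 * (x' - x) + p2 * (y' - y)| <= `|p1| * `|x' - x| + `|p2| * `|y' - y|.
  by rewrite (le_trans (ler_normD _ _))// !normrM.
apply: (le_trans (lerD H1 K1)).
have eE : e = K * (e / (K * 2)) + K * (e / (K * 2)) by field; exact: lt0r_neq0.
rewrite [leRHS]eE.
have Z1 : `|p1| * `|x' - x| + `|x' - x| <= K * `|x' - x|.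
  by rewrite /K !mulrDl; have := mulr_ge0 (normr_ge0 p2) (normr_ge0 (x' - x)); have := normr_ge0 (x' - x); lra.
have Z2 : `|p2| * `|y' - y| + `|y' - y| <= K * `|y' - y|.
  by rewrite /K !mulrDl; have := mulr_ge0 (normr_ge0 p1) (normr_ge0 (y' - y)); have := normr_ge0 (y' - y); lra.
have Z3 : K * `|x' - x| <= K * (e / (K * 2)) by rewrite ler_pM2l// ltW.
have Z4 : K * `|y' - y| <= K * (e / (K * 2)) by rewrite ler_pM2l// ltW.
lra.
Qed.

Lemma diff2_cont1 P x y p1 p2 : diff2 P x y p1 p2 -> {for x, continuous (P^~ y)}.
Proof.
move=> dP; apply/cvgrPdist_le => /= e e0.
have [d d0 H] := diff2_cont dP e0.
apply: (near_dist d0) => t td; rewrite distrC; apply: H => //.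
by rewrite subrr normr0.
Qed.

Lemma diff2_cont2 P x y p1 p2 : diff2 P x y p1 p2 -> {for y, continuous (P x)}.
Proof.
move=> dP; apply/cvgrPdist_le => /= e e0.
have [d d0 H] := diff2_cont dP e0.
apply: (near_dist d0) => t td; rewrite distrC; apply: H => //.
by rewrite subrr normr0.
Qed.

Lemma integrable_itv_cont (f : R -> R) a b :
  (forall x, a <= x <= b -> {for x, continuous f}) ->
  mu.-integrable `[a, b] (EFin \o f).
Proof.
move=> cf; apply: continuous_compact_integrable; first exact: segment_compact.
apply: continuous_in_subspaceT => x; rewrite inE /= in_itv /= => /cf; exact.
Qed.

Lemma Rintegral_itv_split (f : R -> R) a m b : a <= m <= b ->
  mu.-integrable `[a, b] (EFin \o f) ->
  \int[mu]_(x in `[a, b]) f x =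
  \int[mu]_(x in `[a, m]) f x + \int[mu]_(x in `[m, b]) f x.
Proof.
move=> /andP[am mb] intf.
have := @Rintegral_itvB _ f (BLeft a) (BRight b) m intf.
rewrite !bnd_simp => /(_ am mb) /eqP; rewrite subr_eq => /eqP ->.
rewrite Rintegral_itv_obnd_cbnd; first by rewrite addrC.
apply: integrableS intf => //; apply: subset_itvr; rewrite bnd_simp//.
Qed.

Lemma Rintegral_itv_near_cst (f : R -> R) a b k e : a <= b ->
  mu.-integrable `[a, b] (EFin \o f) ->
  (forall x, a <= x <= b -> `|f x - k| <= e) ->
  `|\int[mu]_(x in `[a, b]) f x - k * (b - a)| <= e * (b - a).
Proof.
move=> ab intf H.
have cstI r : mu.-integrable `[a, b] (EFin \o (fun _ : R => r)).
  by apply: integrable_itv_cont => x _; apply: cvg_cst.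
have E r : \int[mu]_(x in `[a, b]) r = r * (b - a).
  rewrite Rintegral_cst//= lebesgue_measure_itv/= lte_fin.
  by case: ltgtP ab => //= -> _; rewrite subrr.
rewrite -(E k) -RintegralB//.
apply: le_trans; first apply: le_normr_Rintegral => //.
  exact: (integrableB _ intf (cstI k)).
rewrite -(E e); apply: le_Rintegral => //.
  apply: integrable_norm; exact: (integrableB _ intf (cstI k)).
Qed.

Definition closed_on P Q a b c d := forall x y,
  a <= x <= b -> c <= y <= d -> closed_form P Q x y.

Lemma closed_onS P Q a b c d a' b' c' d' : closed_on P Q a b c d ->
  a <= a' -> b' <= b -> c <= c' -> d' <= d -> closed_on P Q a' b' c' d'.
Proof.
move=> H aa bb cc dd x y /andP[x1 x2] /andP[y1 y2]; apply: H; lra.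
Qed.

Lemma closed_on_int1 P Q a b c d y : closed_on P Q a b c d -> c <= y <= d ->
  mu.-integrable `[a, b] (EFin \o P^~ y).
Proof.
move=> H yc; apply: integrable_itv_cont => x xab.
by have [p1 [r [q2 [dP _]]]] := H _ _ xab yc; exact: diff2_cont1 dP.
Qed.

Lemma closed_on_int2 P Q a b c d x : closed_on P Q a b c d -> a <= x <= b ->
  mu.-integrable `[c, d] (EFin \o Q x).
Proof.
move=> H xab; apply: integrable_itv_cont => y yc.
by have [p1 [r [q2 [_ dQ]]]] := H _ _ xab yc; exact: diff2_cont2 dQ.
Qed.

(** Differentiability is asked on the sides and on the cut only, so that the
    rectangle may contain a puncture away from them. *)
Lemma circulation_split1 P Q a m b c d :
  (forall x y, a <= x <= b -> c <= y <= d ->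
     [\/ x = a, x = m, x = b | y = c \/ y = d] -> closed_form P Q x y) ->
  a <= m <= b -> c <= d ->
  circulation P Q a b c d = circulation P Q a m c d + circulation P Q m b c d.
Proof.
move=> H /andP[am mb] cd; rewrite /circulation.
have ab := le_trans am mb.
have i1 y : c <= y <= d -> y = c \/ y = d -> mu.-integrable `[a, b] (EFin \o P^~ y).
  move=> yc E; apply: integrable_itv_cont => x xab.
  by have [p1 [r [q2 [dP _]]]] := H _ _ xab yc ltac:(constructor 4; exact: E); exact: diff2_cont1 dP.
have i2 x : a <= x <= b -> [\/ x = a, x = m | x = b] ->
    mu.-integrable `[c, d] (EFin \o Q x).
  move=> xab E; apply: integrable_itv_cont => y yc.
  have [|p1 [r [q2 [_ dQ]]]] := H _ _ xab yc; last exact: diff2_cont2 dQ.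
  by case: E => ?; [constructor 1|constructor 2|constructor 3].
have iS y a' b' : c <= y <= d -> y = c \/ y = d -> a <= a' -> b' <= b ->
    mu.-integrable `[a', b'] (EFin \o P^~ y).
  by move=> yc E aa bb; apply: integrableS (i1 _ yc E) => //; apply: subset_itvScc.
have lcd : c <= c <= d by rewrite lexx.
have rcd : c <= d <= d by rewrite cd lexx.
have ia := i2 a ltac:(by rewrite lexx) ltac:(by constructor 1).
have im := i2 m ltac:(by rewrite am) ltac:(by constructor 2).
have ib := i2 b ltac:(by rewrite ab lexx) ltac:(by constructor 3).
have ic a' b' := iS c a' b' lcd (or_introl erefl).
have id a' b' := iS d a' b' rcd (or_intror erefl).
rewrite (@Rintegral_itv_split _ a m b) ?am//; last first.
  exact: (integrableB _ (ic a b (lexx _) (lexx _)) (id a b (lexx _) (lexx _))).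
rewrite !RintegralB//; try (first [exact: (ic _ _ (lexx _) (lexx _))|exact: (ic _ _ (lexx _) mb)|exact: (ic _ _ am (lexx _))
  |exact: (id _ _ (lexx _) (lexx _))|exact: (id _ _ (lexx _) mb)|exact: (id _ _ am (lexx _))]).
lra.
Qed.

Lemma circulation_split2 P Q a b c m d :
  (forall x y, a <= x <= b -> c <= y <= d ->
     [\/ y = c, y = m, y = d | x = a \/ x = b] -> closed_form P Q x y) ->
  c <= m <= d -> a <= b ->
  circulation P Q a b c d = circulation P Q a b c m + circulation P Q a b m d.
Proof.
move=> H /andP[cm md] ab; rewrite /circulation.
have cd := le_trans cm md.
have i2 x : a <= x <= b -> x = a \/ x = b -> mu.-integrable `[c, d] (EFin \o Q x).
  move=> xab E; apply: integrable_itv_cont => y yc.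
  by have [p1 [r [q2 [_ dQ]]]] := H _ _ xab yc ltac:(constructor 4; exact: E); exact: diff2_cont2 dQ.
have i1 y : c <= y <= d -> [\/ y = c, y = m | y = d] ->
    mu.-integrable `[a, b] (EFin \o P^~ y).
  move=> yc E; apply: integrable_itv_cont => x xab.
  have [|p1 [r [q2 [dP _]]]] := H _ _ xab yc; last exact: diff2_cont1 dP.
  by case: E => ?; [constructor 1|constructor 2|constructor 3].
have iS x c' d' : a <= x <= b -> x = a \/ x = b -> c <= c' -> d' <= d ->
    mu.-integrable `[c', d'] (EFin \o Q x).
  by move=> yc E aa bb; apply: integrableS (i2 _ yc E) => //; apply: subset_itvScc.
have lab : a <= a <= b by rewrite lexx.
have rab : a <= b <= b by rewrite ab lexx.
have ic := i1 c ltac:(by rewrite lexx cd) ltac:(by constructor 1).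
have im := i1 m ltac:(by rewrite cm) ltac:(by constructor 2).
have id := i1 d ltac:(by rewrite cd lexx) ltac:(by constructor 3).
have ia c' d' := iS a c' d' lab (or_introl erefl).
have ib c' d' := iS b c' d' rab (or_intror erefl).
rewrite (@Rintegral_itv_split (fun y => Q b y - Q a y) c m d) ?cm//; last first.
  exact: (integrableB _ (ib c d (lexx _) (lexx _)) (ia c d (lexx _) (lexx _))).
rewrite !RintegralB//; try (first [exact: (ia _ _ (lexx _) (lexx _))|exact: (ia _ _ (lexx _) md)|exact: (ia _ _ cm (lexx _))
  |exact: (ib _ _ (lexx _) (lexx _))|exact: (ib _ _ (lexx _) md)|exact: (ib _ _ cm (lexx _))]).
lra.
Qed.

(** The affine part of the form contributes nothing: its mixed coefficient [r]
    enters the horizontal and the vertical sides with opposite signs. *)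
Lemma circulation_near P Q a b c d x y p1 r q2 e :
  a <= b -> c <= d -> 0 <= e -> closed_on P Q a b c d ->
  (forall x' y', a <= x' <= b -> c <= y' <= d ->
    `|P x' y' - P x y - p1 * (x' - x) - r * (y' - y)|
      <= e * ((b - a) + (d - c)) /\
    `|Q x' y' - Q x y - r * (x' - x) - q2 * (y' - y)|
      <= e * ((b - a) + (d - c))) ->
  `|circulation P Q a b c d| <= 2 * e * ((b - a) + (d - c)) ^+ 2.
Proof.
move=> ab cd e0 H L; set s := _ + _ in L *.
have i1 y' : c <= y' <= d -> mu.-integrable `[a, b] (EFin \o P^~ y').
  exact: closed_on_int1 H.
have i2 x' : a <= x' <= b -> mu.-integrable `[c, d] (EFin \o Q x').
  exact: closed_on_int2 H.
have cc : c <= c <= d by rewrite lexx.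
have dd : c <= d <= d by rewrite lexx andbT.
have aa : a <= a <= b by rewrite lexx.
have bb : a <= b <= b by rewrite lexx andbT.
have J1 := @Rintegral_itv_near_cst (fun x' => P x' c - P x' d) a b (r * (c - d)) (2 * (e * s)) ab.
have J2 := @Rintegral_itv_near_cst (fun y' => Q b y' - Q a y') c d (r * (b - a)) (2 * (e * s)) cd.
have F1 : mu.-integrable `[a, b] (EFin \o (fun x' => P x' c - P x' d)).
  by apply: (integrableB _ (i1 c cc) (i1 d dd)).
have {}J1 := J1 F1.
have F2 : mu.-integrable `[c, d] (EFin \o (fun y' => Q b y' - Q a y')).
  by apply: (integrableB _ (i2 b bb) (i2 a aa)).
have {}J2 := J2 F2.
rewrite /circulation.
set I1 := Rintegral _ _ _ in J1 *; set I2 := Rintegral _ _ _ in J2 *.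
have -> : I1 + I2 = (I1 - r * (c - d) * (b - a)) + (I2 - r * (b - a) * (d - c)) by ring.
apply: (le_trans (ler_normD _ _)).
have -> : 2 * e * s ^+ 2 = 2 * (e * s) * (b - a) + 2 * (e * s) * (d - c) by rewrite /s; ring.
apply: lerD; [apply: J1 => x' xab | apply: J2 => y' ycd].
  have [A1 _] := L x' c xab cc; have [A2 _] := L x' d xab dd.
  have -> : P x' c - P x' d - r * (c - d) = (P x' c - P x y - p1 * (x' - x) - r * (c - y))
    - (P x' d - P x y - p1 * (x' - x) - r * (d - y)) by ring.
  apply: (le_trans (ler_normB _ _)); lra.
have [_ A1] := L b y' bb ycd; have [_ A2] := L a y' aa ycd.
have -> : Q b y' - Q a y' - r * (b - a) = (Q b y' - Q x y - r * (b - x) - q2 * (y' - y))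
    - (Q a y' - Q x y - r * (a - x) - q2 * (y' - y)) by ring.
apply: (le_trans (ler_normB _ _)); lra.
Qed.

Lemma halves (w : R) n : w / 2 ^+ n = w / 2 ^+ n.+1 + w / 2 ^+ n.+1.
Proof. by rewrite exprS; field; rewrite expf_neq0. Qed.

(** Choosing a bad quarter again and again gives monotone sequences of corners;
    their limit belongs to all the chosen rectangles. *)
Lemma nested_quarters (bad : nat -> R -> R -> Prop) a b c d : a <= b -> c <= d ->
  bad 0%N a c ->
  (forall n x y, bad n x y -> let w := (b - a) / 2 ^+ n.+1 in
     let h := (d - c) / 2 ^+ n.+1 in
     [\/ bad n.+1 x y, bad n.+1 (x + w) y, bad n.+1 x (y + h) |
         bad n.+1 (x + w) (y + h)]) ->
  exists x y, forall n, exists x' y', [/\ bad n x' y',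
    x' <= x <= x' + (b - a) / 2 ^+ n, y' <= y <= y' + (d - c) / 2 ^+ n,
    (a <= x') && (x' + (b - a) / 2 ^+ n <= b) &
    (c <= y') && (y' + (d - c) / 2 ^+ n <= d)].
Proof.
move=> ab cd bad0 badS.
have wn0 n : 0 <= (b - a) / 2 ^+ n by rewrite divr_ge0// ?subr_ge0// exprn_ge0.
have hn0 n : 0 <= (d - c) / 2 ^+ n by rewrite divr_ge0// ?subr_ge0// exprn_ge0.
have [f Hf] : exists f : nat * (R * R) -> R * R, forall s, bad s.1 s.2.1 s.2.2 ->
    [/\ bad s.1.+1 (f s).1 (f s).2,
     s.2.1 <= (f s).1 <= s.2.1 + (b - a) / 2 ^+ s.1.+1 &
     s.2.2 <= (f s).2 <= s.2.2 + (d - c) / 2 ^+ s.1.+1].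
  pose A (s : nat * (R * R)) (t : R * R) := bad s.1 s.2.1 s.2.2 ->
    [/\ bad s.1.+1 t.1 t.2, s.2.1 <= t.1 <= s.2.1 + (b - a) / 2 ^+ s.1.+1 &
     s.2.2 <= t.2 <= s.2.2 + (d - c) / 2 ^+ s.1.+1].
  have [|f Hf] := @choice _ _ A; last by exists f.
  rewrite {}/A => -[n [x y]] /=.
  have [B|nB] := pselect (bad n x y); last by exists (0, 0).
  have := wn0 n.+1; have := hn0 n.+1 => h0 w0.
  case: (badS n x y B) => B'.
  - by exists (x, y) => _; split => //=; rewrite lexx lerDl.
  - by exists (x + (b - a) / 2 ^+ n.+1, y) => _; split => //=; rewrite ?lexx ?lerDl ?w0 ?h0.
  - by exists (x, y + (d - c) / 2 ^+ n.+1) => _; split => //=; rewrite ?lexx ?lerDl ?w0 ?h0.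
  - by exists (x + (b - a) / 2 ^+ n.+1, y + (d - c) / 2 ^+ n.+1) => _; split => //=;
      rewrite ?lexx ?lerDl ?w0 ?h0.
pose s := fix s n := if n is m.+1 then f (m, s m) else (a, c).
have Bs n : bad n (s n).1 (s n).2.
  by elim: n => [//|n IH]; have [] := Hf (n, s n) IH.
have s1 n : (s n).1 <= (s n.+1).1 <= (s n).1 + (b - a) / 2 ^+ n.+1.
  by have [] := Hf (n, s n) (Bs n).
have s2 n : (s n).2 <= (s n.+1).2 <= (s n).2 + (d - c) / 2 ^+ n.+1.
  by have [] := Hf (n, s n) (Bs n).
have lim1 (u : nat -> R) (w : R) : 0 <= w ->
    (forall n, u n <= u n.+1 <= u n + w / 2 ^+ n.+1) ->
    exists l, forall n, u n <= l <= u n + w / 2 ^+ n /\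
       (u 0%N <= u n) && (u n + w / 2 ^+ n <= u 0%N + w).
  move=> w0 Hu.
  have Iu : {homo u : n m / (n <= m)%N >-> n <= m}.
    by apply/nondecreasing_seqP => n; have /andP[] := Hu n.
  have Du : {homo (fun n => u n + w / 2 ^+ n) : n m / (n <= m)%N >-> m <= n}.
    apply/nonincreasing_seqP => n; have /andP[_ H] := Hu n.
    by rewrite (halves w n) addrA lerD2r.
  have ub m n : u m <= u n + w / 2 ^+ n.
    have /orP[mn|nm] := leq_total m n.
      by rewrite (le_trans (Iu _ _ mn))// lerDl divr_ge0// exprn_ge0.
    by apply: le_trans (Du _ _ nm); rewrite lerDl divr_ge0// exprn_ge0.
  have cu : cvgn u.
    apply: nondecreasing_is_cvgn => //; exists (u 0%N + w / 2 ^+ 0) => _ [m _ <-]; exact: ub.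
  exists (limn u) => n; split; last first.
    by rewrite Iu//=; have := Du 0%N n isT; rewrite expr0 divr1.
  apply/andP; split; first exact: nondecreasing_cvgn_le.
  by apply: limr_le => //; near=> m; exact: ub.
have ba0 : 0 <= b - a by rewrite subr_ge0.
have dc0 : 0 <= d - c by rewrite subr_ge0.
have [x Hx] := lim1 (fun n => (s n).1) _ ba0 s1.
have [y Hy] := lim1 (fun n => (s n).2) _ dc0 s2.
exists x, y => n; exists (s n).1, (s n).2.
have [x1 /=] := Hx n; have [y1 /=] := Hy n; rewrite !subrKC => y2 x2.
by split => //; exact: Bs.
Unshelve. all: by end_near. Qed.

(** Bisection.  If the circulation is not 0, some quarter in each generation
    keeps a fourth of it; at the point to which these quarters shrink,
    differentiability makes it negligible with respect to the square of the
    side. *)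
Lemma goursat P Q a b c d : a <= b -> c <= d -> closed_on P Q a b c d ->
  circulation P Q a b c d = 0.
Proof.
move=> ab cd H; apply/eqP; apply: contraT => Cn0.
pose eps := `|circulation P Q a b c d| / 2.
have eps0 : 0 < eps by rewrite divr_gt0 // normr_gt0.
pose w n := (b - a) / 2 ^+ n; pose h n := (d - c) / 2 ^+ n.
have w0 n : 0 <= w n by rewrite divr_ge0// ?subr_ge0// exprn_ge0.
have h0 n : 0 <= h n by rewrite divr_ge0// ?subr_ge0// exprn_ge0.
pose bad n x y := [/\ eps / 4 ^+ n < `|circulation P Q x (x + w n) y (y + h n)|,
  (a <= x) && (x + w n <= b) & (c <= y) && (y + h n <= d)].
have bad0 : bad 0%N a c.
  rewrite /bad /w /h !expr0 !divr1 !subrKC; split; rewrite ?lexx//.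
  by rewrite ltr_pdivrMr ?mulr_natr ?mulr2n ?ltrDl ?normr_gt0.
have badS n x y : bad n x y -> [\/ bad n.+1 x y, bad n.+1 (x + w n.+1) y,
    bad n.+1 x (y + h n.+1) | bad n.+1 (x + w n.+1) (y + h n.+1)].
  move=> [B /andP[ax xb] /andP[cy yd]].
  have wE : w n = w n.+1 + w n.+1 by exact: halves.
  have hE : h n = h n.+1 + h n.+1 by exact: halves.
  have := w0 n.+1; have := h0 n.+1 => h00 w00.
  have S1 := @circulation_split1 P Q x (x + w n.+1) (x + w n) y (y + h n).
  have S2 := @circulation_split2 P Q x (x + w n.+1) y (y + h n.+1) (y + h n).
  have S3 := @circulation_split2 P Q (x + w n.+1) (x + w n) y (y + h n.+1) (y + h n).
  rewrite {}S1 in B; [|move=> x1 y1 X Y _; apply: H; clear -X Y ax xb cy yd; lra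
    |clear -w00 wE; lra|clear -h00 hE; lra].
  rewrite {}S2 in B; [|move=> x1 y1 X Y _; apply: H; clear -X Y ax xb cy yd wE w00; lra
    |clear -h00 hE; lra|clear -w00; lra].
  rewrite {}S3 in B; [|move=> x1 y1 X Y _; apply: H; clear -X Y ax xb cy yd wE w00; lra
    |clear -h00 hE; lra|clear -w00 wE; lra].
  rewrite wE hE !(addrA x) !(addrA y) in B xb yd.
  apply: contrapT => N.
  have K x' y' : ~ bad n.+1 x' y' -> (a <= x') && (x' + w n.+1 <= b) ->
     (c <= y') && (y' + h n.+1 <= d) ->
     `|circulation P Q x' (x' + w n.+1) y' (y' + h n.+1)| <= eps / 4 ^+ n.+1.
    by move=> nb i1 i2; rewrite leNgt; apply/negP => i3; apply: nb; split.
  have q1 := K x y (fun B1 => N ltac:(constructor 1; exact B1)).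
  have q2 := K (x + w n.+1) y (fun B1 => N ltac:(constructor 2; exact B1)).
  have q3 := K x (y + h n.+1) (fun B1 => N ltac:(constructor 3; exact B1)).
  have q4 := K (x + w n.+1) (y + h n.+1) (fun B1 => N ltac:(constructor 4; exact B1)).
  have {}q1 := q1 ltac:(clear -xb yd ax cy w00 h00; lra) ltac:(clear -xb yd ax cy w00 h00; lra).
  have {}q2 := q2 ltac:(clear -xb yd ax cy w00 h00; lra) ltac:(clear -xb yd ax cy w00 h00; lra).
  have {}q3 := q3 ltac:(clear -xb yd ax cy w00 h00; lra) ltac:(clear -xb yd ax cy w00 h00; lra).
  have {}q4 := q4 ltac:(clear -xb yd ax cy w00 h00; lra) ltac:(clear -xb yd ax cy w00 h00; lra).
  move: B; rewrite ltNge => /negP; apply.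
  have -> : eps / 4 ^+ n = (eps / 4 ^+ n.+1 + eps / 4 ^+ n.+1) + (eps / 4 ^+ n.+1 + eps / 4 ^+ n.+1).
    by rewrite exprS; field; rewrite expf_neq0.
  apply: (le_trans (ler_normD _ _)); apply: lerD; apply: (le_trans (ler_normD _ _)); exact: lerD.
have [x [y Hxy]] := nested_quarters ab cd bad0 badS.
have xab : a <= x <= b.
  by have [x' [y' [_ /andP[i1 i2] _ /andP[i3 i4] _]]] := Hxy 0%N; rewrite (le_trans i3)//= (le_trans i2).
have ycd : c <= y <= d.
  by have [x' [y' [_ _ /andP[i1 i2] _ /andP[i3 i4]]]] := Hxy 0%N; rewrite (le_trans i3)//= (le_trans i2).
have [p1 [r [q2 [dP dQ]]]] := H _ _ xab ycd.
pose S := (b - a) + (d - c) + 1.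
have S1 : 0 < S by rewrite /S; lra.
(* With this [e] the bound of [circulation_near] is [eps / 4 ^+ n] when half the
   perimeter is [S / 2 ^+ n]. *)
pose e := eps / (2 * S ^+ 2).
have e0 : 0 < e by rewrite divr_gt0// mulr_gt0// exprn_gt0.
have [d1 d10 D1] := dP _ e0; have [d2 d20 D2] := dQ _ e0.
pose dd := Num.min d1 d2; have dd0 : 0 < dd by rewrite lt_min d10.
have [n Hn] : exists n, S / 2 ^+ n < dd.
  exists (Num.bound (S / dd)); rewrite ltr_pdivrMr ?exprn_gt0// mulrC -ltr_pdivrMr//.
  exact: upper_nthrootP.
have [x' [y' [[B _ _] /andP[x1 x2] /andP[y1 y2] /andP[x3 x4] /andP[y3 y4]]]] := Hxy n.
have p2 : 0 < (2 : R) ^+ n by rewrite exprn_gt0.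
have wS : w n + h n <= S / 2 ^+ n.
  by rewrite /w /h -mulrDl ler_pM2r ?invr_gt0// /S lerDl.
have := w0 n; have := h0 n => h00 w00.
have wd : w n < dd by clear -wS Hn h00 w00; lra.
have hd : h n < dd by clear -wS Hn h00 w00; lra.
have := @circulation_near P Q x' (x' + w n) y' (y' + h n) x y p1 r q2 e.
have W1 : x' + w n - x' = w n by ring.
have H1 : y' + h n - y' = h n by ring.
rewrite W1 H1 !lerDl => /(_ w00 h00 (ltW e0)).
move=> /(_ (closed_onS H x3 x4 y3 y4)) N.
have {}N : `|circulation P Q x' (x' + w n) y' (y' + h n)| <= 2 * e * (w n + h n) ^+ 2.
  apply: N => x'' y'' X Y.
  have XX : `|x'' - x| <= w n by rewrite ler_norml; apply/andP; split; clear -X x1 x2; rewrite /w in X *; lra.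
  have YY : `|y'' - y| <= h n by rewrite ler_norml; apply/andP; split; clear -Y y1 y2; rewrite /h in Y *; lra.
  have dd1 : dd <= d1 by rewrite /dd ge_min lexx.
  have dd2 : dd <= d2 by rewrite /dd ge_min lexx orbT.
  have X1 := le_lt_trans XX wd; have Y1 := le_lt_trans YY hd.
  have E1 : e * (`|x'' - x| + `|y'' - y|) <= e * (w n + h n) by rewrite ler_pM2l// lerD.
  split.
    by apply: le_trans E1; apply: D1; exact: lt_le_trans dd1.
  by apply: le_trans E1; apply: D2; exact: lt_le_trans dd2.
move: B; rewrite ltNge => /negP; case.
apply: (le_trans N).
have -> : eps / 4 ^+ n = 2 * e * (S / 2 ^+ n) ^+ 2.
  have -> : (4 : R) ^+ n = 2 ^+ n * 2 ^+ n by rewrite -exprMn; congr (_ ^+ _); ring.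
  by rewrite /e; field; rewrite ?expf_neq0 ?lt0r_neq0.
have e20 : 0 < 2 * e by rewrite mulr_gt0.
have s0 : 0 <= w n + h n by exact: addr_ge0.
by rewrite (ler_pM2l e20); apply: lerXn2r => //; rewrite nnegrE ?(le_trans s0).
Qed.

(** An isolated point where the form is merely bounded does no harm: cutting
    four strips away leaves a square around it whose perimeter is as small
    as one likes. *)
Lemma goursat_puncture P Q a b c d x y C r :
  a < x < b -> c < y < d -> 0 < r ->
  (forall x' y', a <= x' <= b -> c <= y' <= d -> (x', y') <> (x, y) ->
     closed_form P Q x' y') ->
  (forall x' y', `|x' - x| <= r -> `|y' - y| <= r -> (x', y') <> (x, y) ->
     `|P x' y'| <= C /\ `|Q x' y'| <= C) ->
  circulation P Q a b c d = 0.
Proof.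
move=> /andP[ax xb] /andP[cy yd] r0 H B.
apply/eqP; apply: contraT => Cn0; rewrite -normr_gt0 in Cn0.
set I := circulation _ _ _ _ _ _ in Cn0 *.
pose C' := `|C| + 1; have C0 : 0 < C' by rewrite ltr_pwDr.
pose s := Num.min (Num.min (Num.min r ((x - a) / 2)) (Num.min ((b - x) / 2) ((y - c) / 2)))
   (Num.min ((d - y) / 2) (`|I| / (16 * C'))).
have s0 : 0 < s by rewrite !lt_min r0 !divr_gt0 ?subr_gt0// mulr_gt0.
have [sr sx sx' sy [sy' sI]] : [/\ s <= r, s <= (x - a) / 2, s <= (b - x) / 2,
   s <= (y - c) / 2 & s <= (d - y) / 2 /\ s <= `|I| / (16 * C')].
  by rewrite /s; do !split; rewrite !ge_min lexx ?orbT.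
clearbody s.
have HS x' y' : a <= x' <= b -> c <= y' <= d -> x' != x \/ y' != y -> closed_form P Q x' y'.
  by move=> X Y N; apply: H => // -[? ?]; subst; case: N; rewrite eqxx.
have zero a' b' c' d' : a <= a' -> a' <= b' -> b' <= b -> c <= c' -> c' <= d' -> d' <= d ->
   (b' < x \/ x < a') \/ (d' < y \/ y < c') -> circulation P Q a' b' c' d' = 0.
  move=> h1 h2 h3 h4 h5 h6 h7; apply: goursat => // x' y' /andP[X1 X2] /andP[Y1 Y2].
  apply: HS; [by rewrite (le_trans h1)//= (le_trans X2)|by rewrite (le_trans h4)//= (le_trans Y2)|].
  case: h7 => -[h7|h7].
  - by left; rewrite lt_eqF// (le_lt_trans X2).
  - by left; rewrite gt_eqF// (lt_le_trans h7).
  - by right; rewrite lt_eqF// (le_lt_trans Y2).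
  - by right; rewrite gt_eqF// (lt_le_trans h7).
have Icenter : I = circulation P Q (x - s) (x + s) (y - s) (y + s).
  rewrite /I (@circulation_split1 P Q a (x - s)); first last.
  - by clear -cy yd; lra.
  - by clear -ax xb sx s0; lra.
  - move=> x' y' X Y E0; apply: HS; [by clear -X ax xb sx sx' s0; lra|by clear -Y cy yd sy sy' s0; lra|]; case: E0 => [->|->|->|E].
    + by left; rewrite lt_eqF.
    + by left; rewrite lt_eqF// ltrBlDr ltrDl.
    + by left; rewrite gt_eqF.
    + by right; case: E => ->; rewrite ?(lt_eqF cy)// (gt_eqF yd).
  rewrite (_ : circulation _ _ a _ _ _ = 0) ?add0r; last first.
    by apply: zero; first [by clear -ax xb cy yd s0 sx; lra|left; left; rewrite ltrBlDr ltrDl].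
  rewrite (@circulation_split1 P Q (x - s) (x + s)); first last.
  - by clear -cy yd; lra.
  - by clear -ax xb sx' s0; lra.
  - move=> x' y' X Y E0; apply: HS; [by clear -X ax xb sx sx' s0; lra|by clear -Y cy yd sy sy' s0; lra|]; case: E0 => [->|->|->|E].
    + by left; rewrite lt_eqF// ltrBlDr ltrDl.
    + by left; rewrite gt_eqF// ltrDl.
    + by left; rewrite gt_eqF.
    + by right; case: E => ->; rewrite ?(lt_eqF cy)// (gt_eqF yd).
  rewrite (_ : circulation _ _ (x + s) _ _ _ = 0) ?addr0; last first.
    by apply: zero; first [by clear -ax xb cy yd s0 sx sx'; lra|left; right; rewrite ltrDl].
  rewrite (@circulation_split2 P Q _ _ c (y - s)); first last.
  - by clear -s0; lra.
  - by clear -cy yd sy s0; lra.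
  - move=> x' y' X Y E0; apply: HS; [by clear -X ax xb sx sx' s0; lra|by clear -Y cy yd sy sy' s0; lra|]; case: E0 => [->|->|->|E].
    + by right; rewrite lt_eqF.
    + by right; rewrite lt_eqF// ltrBlDr ltrDl.
    + by right; rewrite gt_eqF.
    + by left; case: E => ->; [rewrite lt_eqF// ltrBlDr ltrDl|rewrite gt_eqF// ltrDl].
  rewrite (_ : circulation _ _ _ _ c _ = 0) ?add0r; last first.
    by apply: zero; first [by clear -ax xb cy yd s0 sx sx' sy; lra|right; left; rewrite ltrBlDr ltrDl].
  rewrite (@circulation_split2 P Q _ _ (y - s) (y + s)); first last.
  - by clear -s0; lra.
  - by clear -cy yd sy' s0; lra.
  - move=> x' y' X Y E0; apply: HS; [by clear -X ax xb sx sx' s0; lra|by clear -Y cy yd sy sy' s0; lra|]; case: E0 => [->|->|->|E].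
    + by right; rewrite lt_eqF// ltrBlDr ltrDl.
    + by right; rewrite gt_eqF// ltrDl.
    + by right; rewrite gt_eqF.
    + by left; case: E => ->; [rewrite lt_eqF// ltrBlDr ltrDl|rewrite gt_eqF// ltrDl].
  rewrite (_ : circulation _ _ _ _ _ d = 0) ?addr0//.
  by apply: zero; first [by clear -ax xb cy yd s0 sx sx' sy sy'; lra|right; right; rewrite ltrDl].
clearbody I; rewrite Icenter in Cn0 sI.
exfalso.
have ss : x - s <= x + s by clear -s0; lra.
have ts : y - s <= y + s by clear -s0; lra.
have Hc x' y' : x - s <= x' <= x + s -> y - s <= y' <= y + s -> x' != x \/ y' != y ->
    closed_form P Q x' y'.
  move=> X Y; apply: HS; first by clear -X ax xb sx sx'; lra.
  by clear -Y cy yd sy sy'; lra.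
have Hb x' y' : x - s <= x' <= x + s -> y - s <= y' <= y + s -> x' != x \/ y' != y ->
    `|P x' y'| <= C' /\ `|Q x' y'| <= C'.
  move=> X Y N; have [||E|b1 b2] := B x' y'.
  - by apply: le_trans sr; rewrite ler_distl; clear -X; lra.
  - by apply: le_trans sr; rewrite ler_distl; clear -Y; lra.
  - by case: E N => -> -> []; rewrite eqxx.
  - have CC : C <= C' by rewrite (le_trans (ler_norm C))// lerDl.
    by split; [exact: le_trans CC|exact: le_trans CC].
have e1 : y - s != y by rewrite lt_eqF// ltrBlDr ltrDl.
have e2 : y + s != y by rewrite gt_eqF// ltrDl.
have e3 : x - s != x by rewrite lt_eqF// ltrBlDr ltrDl.
have e4 : x + s != x by rewrite gt_eqF// ltrDl.
have l1 : y - s <= y - s <= y + s by rewrite lexx.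
have l2 : y - s <= y + s <= y + s by rewrite lexx andbT.
have l3 : x - s <= x - s <= x + s by rewrite lexx.
have l4 : x - s <= x + s <= x + s by rewrite lexx andbT.
have iP y' : y - s <= y' <= y + s -> y' != y -> mu.-integrable `[x - s, x + s] (EFin \o P^~ y').
  move=> Y N; apply: integrable_itv_cont => x' X.
  by have [p1 [q [q2 [dP _]]]] := Hc x' y' X Y (or_intror N); exact: diff2_cont1 dP.
have iQ x' : x - s <= x' <= x + s -> x' != x -> mu.-integrable `[y - s, y + s] (EFin \o Q x').
  move=> X N; apply: integrable_itv_cont => y' Y.
  by have [p1 [q [q2 [_ dQ]]]] := Hc x' y' X Y (or_introl N); exact: diff2_cont2 dQ.
have I1 : mu.-integrable `[x - s, x + s] (EFin \o (fun x' => P x' (y - s) - P x' (y + s))).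
  exact: (integrableB _ (iP _ l1 e1) (iP _ l2 e2)).
have I2 : mu.-integrable `[y - s, y + s] (EFin \o (fun y' => Q (x + s) y' - Q (x - s) y')).
  exact: (integrableB _ (iQ _ l4 e4) (iQ _ l3 e3)).
have J1 := @Rintegral_itv_near_cst (fun x' => P x' (y - s) - P x' (y + s)) (x - s) (x + s)
   0 (2 * C') ss I1.
have J2 := @Rintegral_itv_near_cst (fun y' => Q (x + s) y' - Q (x - s) y') (y - s) (y + s)
   0 (2 * C') ts I2.
have W1 : x + s - (x - s) = 2 * s by ring.
have W2 : y + s - (y - s) = 2 * s by ring.
rewrite W1 mul0r subr0 in J1; rewrite W2 mul0r subr0 in J2.
have K1 : `|circulation P Q (x - s) (x + s) (y - s) (y + s)| <= 8 * C' * s.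
  have -> : 8 * C' * s = 2 * C' * (2 * s) + 2 * C' * (2 * s) by ring.
  apply: (le_trans (ler_normD _ _)); apply: lerD.
    apply: J1 => x' X; rewrite subr0; apply: (le_trans (ler_normB _ _)).
    have [A1 _] := Hb _ _ X l1 (or_intror e1); have [A2 _] := Hb _ _ X l2 (or_intror e2).
    by clear -A1 A2; lra.
  apply: J2 => y' Y; rewrite subr0; apply: (le_trans (ler_normB _ _)).
  have [_ A1] := Hb _ _ l4 Y (or_introl e4); have [_ A2] := Hb _ _ l3 Y (or_introl e3).
  by clear -A1 A2; lra.
move: sI; rewrite ler_pdivlMr ?mulr_gt0// => sI.
by clear -sI K1 Cn0; lra.
Qed.

End Rectangles.

(** * Complex numbers and complex differentiability *)

Section ComplexModulus.
Variable R : realType.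
Implicit Types (z w : R[i]) (x y : R).

(** The modulus as an element of [R], the norm of [R[i]] being [R[i]]-valued.
    *)
Definition cabs z : R := complex.Re `|z|.

Lemma cabsE z : `|z| = (cabs z)%:C.
Proof. by rewrite /cabs normc_def. Qed.

Lemma sqr_cabs z : cabs z ^+ 2 = complex.Re z ^+ 2 + complex.Im z ^+ 2.
Proof. by apply: complexI; rewrite rmorphXn /= -cabsE -add_Re2_Im2. Qed.

Lemma cabs_ge0 z : 0 <= cabs z.
Proof. by rewrite -ler0c -cabsE. Qed.

Lemma cabsD z w : cabs (z + w) <= cabs z + cabs w.
Proof. by rewrite -lecR rmorphD /= -!cabsE ler_normD. Qed.

Lemma cabsN z : cabs (- z) = cabs z.
Proof. by rewrite /cabs normrN. Qed.

Lemma cabsB z w : cabs (z - w) <= cabs z + cabs w.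
Proof. by rewrite (le_trans (cabsD _ _))// cabsN. Qed.

Lemma cabs_dist z w : cabs (z - w) = cabs (w - z).
Proof. by rewrite -opprB cabsN. Qed.

Lemma cabsM z w : cabs (z * w) = cabs z * cabs w.
Proof. by apply: complexI; rewrite rmorphM /= -!cabsE normrM. Qed.

Lemma cabs0 : cabs 0 = 0. Proof. by rewrite /cabs normr0. Qed.

Lemma cabs1 : cabs 1 = 1. Proof. by rewrite /cabs normr1. Qed.

Lemma cabs_eq0 z : (cabs z == 0) = (z == 0).
Proof. by rewrite -(normr_eq0 z) cabsE (inj_eq (@complexI R) (cabs z) 0). Qed.

Lemma cabs_gt0 z : (0 < cabs z) = (z != 0).
Proof. by rewrite lt_def cabs_ge0 andbT cabs_eq0. Qed.

Lemma cabsV z : cabs z^-1 = (cabs z)^-1.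
Proof. by apply: complexI; rewrite fmorphV /= -!cabsE normfV. Qed.

Lemma cabsX z n : cabs (z ^+ n) = cabs z ^+ n.
Proof. by apply: complexI; rewrite rmorphXn /= -!cabsE normrX. Qed.

Lemma cabs_prod (I : Type) (r : seq I) (P : pred I) (f : I -> R[i]) :
  cabs (\prod_(i <- r | P i) f i) = \prod_(i <- r | P i) cabs (f i).
Proof. by rewrite (big_morph cabs cabsM cabs1). Qed.

Lemma cabs_sum (I : Type) (r : seq I) (P : pred I) (f : I -> R[i]) :
  cabs (\sum_(i <- r | P i) f i) <= \sum_(i <- r | P i) cabs (f i).
Proof.
elim/big_ind2 : _ => //; first by rewrite cabs0.
by move=> z x w y zx wy; rewrite (le_trans (cabsD _ _))// lerD.
Qed.

Lemma cabs_real x : cabs x%:C = `|x|.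
Proof. by rewrite /cabs normc_def /= expr0n addr0 sqrtr_sqr. Qed.

Lemma cabs_nat n : cabs n%:R = n%:R.
Proof. by rewrite -(rmorph_nat (real_complex R)) cabs_real normr_nat. Qed.

Lemma cabsJ z : cabs z^* = cabs z.
Proof. by rewrite /cabs normcJ. Qed.

Lemma Re_le_cabs z : `|complex.Re z| <= cabs z.
Proof. by rewrite -lecR -cabsE normc_ge_Re. Qed.

Lemma Im_le_cabs z : `|complex.Im z| <= cabs z.
Proof.
rewrite -(ler_pXn2r (n := 2)) ?nnegrE ?cabs_ge0// sqr_cabs real_normK ?num_real//.
by rewrite lerDr sqr_ge0.
Qed.

Lemma cabs_le z : cabs z <= `|complex.Re z| + `|complex.Im z|.
Proof.
rewrite -(ler_pXn2r (n := 2)) ?nnegrE ?cabs_ge0 ?addr_ge0// sqr_cabs sqrrD.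
rewrite !real_normK ?num_real// addrAC lerDl mulrn_wge0 ?mulr_ge0//.
Qed.

Lemma complexP z w : complex.Re z = complex.Re w -> complex.Im z = complex.Im w -> z = w.
Proof. by case: z w => [a b] [c d] /= -> ->. Qed.

Lemma ReD z w : complex.Re (z + w) = complex.Re z + complex.Re w.
Proof. by case: z w => [a b] [c d]. Qed.
Lemma ImD z w : complex.Im (z + w) = complex.Im z + complex.Im w.
Proof. by case: z w => [a b] [c d]. Qed.
Lemma ReN z : complex.Re (- z) = - complex.Re z.
Proof. by case: z. Qed.
Lemma ImN z : complex.Im (- z) = - complex.Im z.
Proof. by case: z. Qed.
Lemma ReM z w : complex.Re (z * w) =
  complex.Re z * complex.Re w - complex.Im z * complex.Im w.
Proof. by case: z w => [a b] [c d]. Qed.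
Lemma ImM z w : complex.Im (z * w) =
  complex.Re z * complex.Im w + complex.Im z * complex.Re w.
Proof. by case: z w => [a b] [c d] /=; rewrite ?(mulrC b). Qed.
Lemma ReJ z : complex.Re z^* = complex.Re z.
Proof. by case: z. Qed.
Lemma ImJ z : complex.Im z^* = - complex.Im z.
Proof. by case: z. Qed.

End ComplexModulus.

Section ComplexDerivative.
Variable R : realType.
Implicit Types (z w : R[i]) (F G : R[i] -> R[i]) (x y e : R).

(** Complex differentiability with real error bounds, the form in which it
    feeds the real differential forms above. *)
Definition cdiff F z := exists L, forall e : R, 0 < e ->
  exists2 d : R, 0 < d & forall w, cabs w < d ->
    cabs (F (z + w) - F z - L * w) <= e * cabs w.

Lemma cdiffP F z : derivable (F : R[i]^o -> R[i]^o) z 1 <-> cdiff F z.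
Proof.
split.
  move=> /cvg_ex[/= L] /cvgrPdist_le /= H; exists L => e e0.
  have eC : 0 < e%:C :> R[i] by rewrite ltcR.
  have /nbhs_ballP[/= d d0 D] := H _ eC.
  have [dI dR] : complex.Im d = 0 /\ 0 < complex.Re d.
    by move: d0; rewrite ltcE /= => /andP[/eqP].
  exists (complex.Re d) => // w wd.
  have [->|w0] := eqVneq w 0; first by rewrite addr0 subrr mulr0 subr0 cabs0 mulr0.
  have /= := D w; rewrite /ball /= sub0r normrN cabsE ltcE /= dI eqxx => /(_ wd w0).
  rewrite /GRing.scale /= mulr1 cabsE lecR => K.
  have -> : F (z + w) - F z - L * w = - (L - w^-1 * (F (w + z) - F z)) * w.
    by rewrite (addrC w); field.
  by rewrite cabsM cabsN ler_wpM2r// cabs_ge0.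
move=> [L H]; apply/cvg_ex; exists L; apply/cvgrPdist_le => /= e e0.
have [eI eR] : complex.Im e = 0 /\ 0 < complex.Re e.
  by move: e0; rewrite ltcE /= => /andP[/eqP].
have [d d0 D] := H _ eR.
apply/nbhs_ballP; exists d%:C => /=; first by rewrite ltcR.
move=> w; rewrite /ball /= sub0r normrN cabsE ltcR => wd w0.
rewrite /GRing.scale /= mulr1 cabsE lecE /= eI eqxx /=.
have K := D w wd.
have -> : L - w^-1 * (F (w + z) - F z) = - (F (z + w) - F z - L * w) * w^-1.
  by rewrite (addrC w); field.
by rewrite cabsM cabsN cabsV ler_pdivrMr// cabs_gt0.
Qed.

Lemma cdiff_cst c z : cdiff (fun=> c) z.
Proof. by apply/cdiffP; exact: derivable_cst. Qed.

Lemma cdiff_id z : cdiff (fun w => w) z.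
Proof. by apply/cdiffP; exact: derivable_id. Qed.

Lemma cdiffB F G z : cdiff F z -> cdiff G z -> cdiff (fun w => F w - G w) z.
Proof. by move=> /cdiffP dF /cdiffP dG; apply/cdiffP; exact: derivableB. Qed.

Lemma cdiffM F G z : cdiff F z -> cdiff G z -> cdiff (fun w => F w * G w) z.
Proof.
move=> /cdiffP dF /cdiffP dG; apply/cdiffP.
by have := @derivableM R[i] R[i]^o F G z 1 dF dG; exact.
Qed.

Lemma cdiffV F z : F z != 0 -> cdiff F z -> cdiff (fun w => (F w)^-1) z.
Proof.
move=> F0 /cdiffP dF; apply/cdiffP.
by have := @derivableV R[i] R[i]^o F z 1 F0 dF; exact.
Qed.

(** A second-order estimate is all one needs to know of a function given by
    a formula. *)
Lemma cdiff_quad F z L (C d : R) : 0 < d ->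
  (forall w, cabs w < d -> cabs (F (z + w) - F z - L * w) <= C * cabs w ^+ 2) ->
  cdiff F z.
Proof.
move=> d0 H; exists L => e e0.
have C0 : 0 < `|C| + 1 by rewrite ltr_pwDr.
exists (Num.min d (e / (`|C| + 1))); first by rewrite lt_min d0 divr_gt0.
move=> w; rewrite lt_min => /andP[wd we]; apply: (le_trans (H w wd)).
rewrite expr2 mulrA ler_wpM2r ?cabs_ge0//.
move: we; rewrite ltr_pdivlMr// => /ltW; apply: le_trans.
rewrite mulrC ler_wpM2l ?cabs_ge0// (le_trans (ler_norm C))// lerDl//.
Qed.

Lemma cdiff_cont F z (e : R) : cdiff F z -> 0 < e ->
  exists2 d : R, 0 < d & forall w, cabs (w - z) < d -> cabs (F w - F z) <= e.
Proof.
move=> [L H] e0; have [d d0 D] := H 1 ltr01.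
have K0 : 0 < 1 + cabs L by rewrite ltr_pwDl// cabs_ge0.
exists (Num.min d (e / (1 + cabs L))); first by rewrite lt_min d0 divr_gt0.
move=> w; rewrite lt_min => /andP[wd we].
have -> : F w - F z = (F (z + (w - z)) - F z - L * (w - z)) + L * (w - z).
  by rewrite subrKC subrK.
apply: (le_trans (cabsD _ _)); apply: (le_trans (lerD (D _ wd) (lexx _))).
by rewrite cabsM -mulrDl mulrC -ler_pdivlMr// ltW.
Qed.

Lemma cdiff_slope F z : cdiff F z -> exists C d : R, 0 < d /\
  forall w, cabs (w - z) < d -> cabs (F w - F z) <= C * cabs (w - z).
Proof.
move=> [L H]; have [d d0 D] := H 1 ltr01.
exists (1 + cabs L), d; split => // w wd.
have -> : F w - F z = (F (z + (w - z)) - F z - L * (w - z)) + L * (w - z).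
  by rewrite subrKC subrK.
apply: (le_trans (cabsD _ _)); apply: (le_trans (lerD (D _ wd) (lexx _))).
by rewrite cabsM -mulrDl.
Qed.

Lemma cabs_Complex x y : cabs (x +i* y) <= `|x| + `|y|.
Proof. exact: cabs_le. Qed.

(** This form is the real part of [F dz], closed by the Cauchy-Riemann
    equations. *)
Lemma cdiff_closed_Re F x y : cdiff F (x +i* y) ->
  closed_form (fun a b => complex.Re (F (a +i* b)))
              (fun a b => - complex.Im (F (a +i* b))) x y.
Proof.
move=> [L H].
exists (complex.Re L), (- complex.Im L), (- complex.Re L).
have aux e : 0 < e -> exists2 d : R, 0 < d & forall x' y',
    `|x' - x| < d -> `|y' - y| < d ->
    cabs (F (x' +i* y') - F (x +i* y) - L * ((x' - x) +i* (y' - y)))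
      <= e * (`|x' - x| + `|y' - y|).
  move=> e0; have [d d0 D] := H e e0; exists (d / 2); first by rewrite divr_gt0.
  move=> x' y' xd yd.
  have cd : cabs ((x' - x) +i* (y' - y)) < d.
    by apply: le_lt_trans (cabs_Complex _ _) _; clear -xd yd; lra.
  have := D _ cd; have -> : x +i* y + ((x' - x) +i* (y' - y)) = x' +i* y'.
    by apply: complexP; rewrite /= subrKC.
  move=> K; apply: (le_trans K); rewrite ler_pM2l//; exact: cabs_Complex.
split=> e e0; have [d d0 D] := aux e e0; exists d => // x' y' xd yd; apply: le_trans (D x' y' xd yd).
  apply: le_trans (Re_le_cabs _); rewrite le_eqVlt; apply/orP; left; apply/eqP; congr `| _ |.
  by rewrite !(ReD, ReN, ReM) /=; ring.
apply: le_trans (Im_le_cabs _); rewrite le_eqVlt; apply/orP; left; apply/eqP.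
by rewrite -normrN; congr `| _ |; rewrite !(ImD, ImN, ImM) /=; ring.
Qed.

(** The imaginary part of [F dz] is the real part of [- 'i F dz]. *)
Lemma cdiff_closed_Im F x y : cdiff F (x +i* y) ->
  closed_form (fun a b => complex.Im (F (a +i* b)))
              (fun a b => complex.Re (F (a +i* b))) x y.
Proof.
move=> dF; have := @cdiff_closed_Re (fun z => - 'i * F z) x y.
have -> : (fun a b => complex.Re (- 'i * F (a +i* b))) = (fun a b => complex.Im (F (a +i* b))).
  by apply/funext => a; apply/funext => b; rewrite ReM /=; ring.
have -> : (fun a b => - complex.Im (- 'i * F (a +i* b))) = (fun a b => complex.Re (F (a +i* b))).
  by apply/funext => a; apply/funext => b; rewrite ImM /=; ring.
apply; exact: cdiffM (cdiff_cst _ _) dF.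
Qed.

End ComplexDerivative.

(** * Moving the line of integration *)

Section Strip.
Variable R : realType.
Local Notation mu := (@lebesgue_measure R).
Implicit Types (P Q : R -> R -> R) (x y : R).

(** Rounding the first variable down to a grid of mesh [1 / (n + 1)] leaves
    countably many measurable pieces; by continuity the mesh may tend to 0. *)
Lemma measurable_fun_joint (G : R -> R -> R) :
  (forall y, continuous (G^~ y)) -> (forall x, measurable_fun setT (G x)) ->
  measurable_fun setT (fun p : R * R => G p.1 p.2).
Proof.
move=> cG mG.
pose fl n (x : R) : R := (Num.floor (x * n.+1%:R))%:~R / n.+1%:R.
have flE n x : fl n x <= x < fl n x + n.+1%:R^-1.
  rewrite /fl ler_pdivrMr// -[X in _ + X]mul1r -mulrDl ltr_pdivlMr// -[1]/(1%:~R) -intrD.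
  by rewrite floor_le_tmp floorD1_gt.
apply: (@measurable_fun_cvg _ _ _ setT (fun n (p : R * R) => G (fl n p.1) p.2)); last first.
  move=> [x y] _ /=; apply: (cvg_comp (fl^~ x) (G^~ y)); last exact: cG.
  apply/cvgrPdist_lt => e e0; near=> n.
  have /andP[h1 h2] := flE n x.
  rewrite ger0_norm ?subr_ge0// ltrBlDl; apply: (lt_trans h2); rewrite ltrD2l.
  by near: n; exact: (near_infty_natSinv_lt (PosNum e0)).
move=> n _ Y mY; rewrite setTI.
rewrite (_ : _ @^-1` _ = \bigcup_(k : int)
   ((fst @^-1` [set x | (k%:~R <= x * n.+1%:R) && (x * n.+1%:R < (k + 1)%:~R)]) `&`
    (snd @^-1` (G (k%:~R / n.+1%:R) @^-1` Y)))); last first.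
  apply/seteqP; split => [[x y] /= H|[x y] [k _ /= [H1 H2]]].
    by exists (Num.floor (x * n.+1%:R)) => //=; rewrite floor_le_tmp floorD1_gt.
  by rewrite /fl (floor_def H1).
apply: countable_bigcupT_measurable => // k; apply: measurableI.
  rewrite -[X in measurable X]setTI; apply: measurable_fst => //.
  rewrite (_ : mkset _ = `[(k%:~R / n.+1%:R), ((k + 1)%:~R / n.+1%:R)[%classic)//.
  by apply/seteqP; split => x /=; rewrite in_itv /= ler_pdivrMr// ltr_pdivlMr.
rewrite -[X in measurable X]setTI; apply: measurable_snd => //.
by rewrite -[X in measurable X]setTI; exact: mG.
Unshelve. all: by end_near. Qed.

Lemma cvg_Rintegral_itv (q : R -> R) (c d : nat -> R) p :
  mu.-integrable setT (EFin \o q) ->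
  (forall n, c n <= p - n%:R) -> (forall n, p + n%:R <= d n) ->
  \int[mu]_(y in `[c n, d n]) q y @[n --> \oo] --> \int[mu]_y q y.
Proof.
move=> intq cn dn.
have mq : measurable_fun setT q by apply/measurable_EFinP; exact: measurable_int intq.
pose f n y := (EFin \o (q \_ `[c n, d n])) y.
have mf n : measurable_fun setT (f n).
  apply/measurable_EFinP; apply/(measurable_restrictT _ _).1 => //.
  exact: measurable_funTS.
have ff y : setT y -> f^~ y @ \oo --> (q y)%:E.
  move=> _; apply: cvg_near_cst; near=> n; rewrite /f /= patchE mem_set//=.
  have ny : `|y - p| <= n%:R.
    near: n; exists (Num.bound `|y - p|) => // n /= bn.
    by rewrite ltW// (lt_le_trans (archi_boundP _))// ler_nat.
  rewrite in_itv /=; have := cn n; have := dn n; move: ny; rewrite ler_distl.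
  by move=> /andP[]; clear; lra.
have fg n y : setT y -> (`|f n y| <= `|(q y)%:E|)%E.
  by move=> _; rewrite /f /= patchE; case: ifP => // _; rewrite normr0 lee_fin.
have fing y : setT y -> `|(q y)%:E|%E \is a fin_num by [].
have := @dominated_cvg _ _ _ mu setT measurableT f (EFin \o q) (fun y => `|(q y)%:E|)%E
  mf ff fing (integrable_abse intq) fg.
rewrite -[X in _ --> X]fineK ?integrable_fin_num// => /fine_cvg.
apply: cvg_trans; apply: near_eq_cvg; near=> n.
by rewrite Rintegral_mkcond.
Unshelve. all: by end_near. Qed.

(** Otherwise the integral over [c, d] alone would exceed [M]. *)
Lemma small_value (H : R -> \bar R) (c d M e : R) : (forall y, 0 <= H y)%E ->
  measurable_fun setT H -> (\int[mu]_y H y <= M%:E)%E -> 0 <= e -> c < d ->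
  M < e * (d - c) -> exists y, [/\ c <= y, y <= d & (H y < e%:E)%E].
Proof.
move=> H0 mH HM e0 cd; rewrite ltNge => /negP Me; apply: contrapT => N; apply: Me.
rewrite -lee_fin; apply: le_trans HM.
apply: (@le_trans _ _ (\int[mu]_(y in `[c, d]) e%:E)%E).
  by rewrite integral_cst//= lebesgue_measure_itv/= lte_fin cd -EFinB -EFinM.
apply: (@le_trans _ _ (\int[mu]_(y in `[c, d]) H y)%E); last exact: ge0_subset_integral.
apply: ge0_le_integral => //; first exact: measurable_funTS.
move=> y /=; rewrite in_itv /= => /andP[cy yd].
by rewrite leNgt; apply/negP => He; apply: N; exists y.
Qed.

(** The circulation around a long rectangle vanishes, and its horizontal sides
    are harmless at well-chosen heights: by Tonelli the integral of [|P|] over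
    the side at height [y] is an integrable function of [y], hence small for
    some large positive and some large negative [y].  Bounds in mean thus
    replace decay at infinity. *)
Lemma strip P Q (x0 x1 xq yq C r M : R) :
  x0 < xq -> xq < x1 -> 0 < r ->
  (forall x y, x0 <= x <= x1 -> (x, y) <> (xq, yq) -> closed_form P Q x y) ->
  (forall x y, `|x - xq| <= r -> `|y - yq| <= r -> (x, y) <> (xq, yq) ->
     `|P x y| <= C /\ `|Q x y| <= C) ->
  (forall x, x0 <= x <= x1 -> exists g : R -> R,
     [/\ measurable_fun setT g, forall y, 0 <= g y,
         forall y, 1 <= `|y - yq| -> `|P x y| <= g y &
         (\int[mu]_y (g y)%:E <= M%:E)%E]) ->
  mu.-integrable setT (EFin \o Q x0) -> mu.-integrable setT (EFin \o Q x1) ->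
  \int[mu]_y Q x0 y = \int[mu]_y Q x1 y.
Proof.
move=> x0q xq1 r0 cf bd tail i0 i1.
have x01 : x0 < x1 by exact: lt_trans xq1.
pose D := [set y : R | 1 <= `|y - yq|].
have mD : measurable D.
  rewrite (_ : D = `]-oo, yq - 1] `|` `[yq + 1, +oo[); first exact: measurableU.
  apply/seteqP; split => y; rewrite /D /= !in_itv /= andbT ler_normr.
    by move=> /orP[]; [right|left]; lra.
  by case => h; apply/orP; [right|left]; lra.
(* Freezing the abscissa outside [x0, x1] makes the integrand continuous in it on
   the whole real line, as joint measurability requires. *)
pose cl x := Num.min (Num.max x x0) x1.
have clb x : x0 <= cl x <= x1.
  by rewrite /cl le_min le_max lexx orbT /= ltW// ge_min lexx orbT.
have ccl : continuous cl.
  move=> x; apply: (@continuous_min R R (id \max (fun=> x0)) (fun=> x1) x).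
    by apply: (@continuous_max R R id (fun=> x0) x); [exact: cvg_id|exact: cvg_cst].
  exact: cvg_cst.
pose aP x : R -> R := fun y => `|P (cl x) y|.
pose G x y : R := (aP x \_ D) y.
have G0 x y : 0 <= G x y.
  by rewrite /G patchE; case: ifP => _; [exact: normr_ge0|exact: lexx].
have Dq x y : D y -> (x, y) <> (xq, yq) :> R * R.
  by rewrite /D /= => H [_ E]; move: H; rewrite E subrr normr0 ler10.
have cG y : continuous (G^~ y).
  have [yD|yD] := boolP (y \in D); last first.
    have -> : G^~ y = fun=> 0 by apply/funext => t; rewrite /G patchE (negbTE yD).
    by move=> x; exact: cvg_cst.
  have -> : G^~ y = fun t => `|P (cl t) y| by apply/funext => t; rewrite /G patchE yD.
  move=> x.
  apply: cvg_norm; apply: (cvg_comp cl (P^~ y)); first exact: ccl.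
  have [p1 [q [q2 [dP _]]]] := cf (cl x) y (clb x) (Dq (cl x) _ (set_mem yD)).
  exact: diff2_cont1 dP.
have mP x : x0 <= x <= x1 -> measurable_fun D (P x).
  move=> xb; apply: subspace_continuous_measurable_fun => //.
  apply: continuous_in_subspaceT => y yD.
  have [p1 [q [q2 [dP _]]]] := cf x y xb (Dq x _ (set_mem yD)).
  exact: diff2_cont2 dP.
have {}tail x : x0 <= x <= x1 -> (\int[mu]_(y in D) `|P x y|%:E <= M%:E)%E.
  move=> xb; have [g [mg g0 Pg gM]] := tail x xb; apply: le_trans gM.
  apply: (@le_trans _ _ (\int[mu]_(y in D) (g y)%:E)%E).
    apply: ge0_le_integral => //.
    - by apply/measurable_EFinP; apply: measurableT_comp => //; exact: mP.
    - by apply/measurable_EFinP; exact: measurable_funTS.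
  apply: ge0_subset_integral => //; first exact/measurable_EFinP.
  by move=> y _; rewrite lee_fin.
have mG x : measurable_fun setT (G x).
  apply/(measurable_restrictT _ _).1 => //; apply: measurableT_comp => //; exact: mP.
pose I01 : set R := `[x0, x1]%classic.
have mI : measurable I01 by exact: measurable_itv.
pose g (p : R * R) : \bar R := (G p.1 p.2 * \1_I01 p.1)%:E.
have mg : measurable_fun setT g.
  apply/measurable_EFinP; apply: measurable_funM.
    exact: (@measurable_fun_joint G).
  have m1 : measurable_fun setT (\1_I01 : R -> R) by apply: measurable_indic; exact: measurable_itv.
  exact: (measurableT_comp m1).
have g0 p : (0 <= g p)%E by rewrite lee_fin mulr_ge0.
pose H y := (\int[mu]_x g (x, y))%E.
have H0 y : (0 <= H y)%E by exact: integral_ge0.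
have mH : measurable_fun setT H by exact: (@measurable_fun_fubini_tonelli_G _ _ _ _ R mu g mg g0).
have HE y : D y -> H y = (\int[mu]_(x in I01) `|P x y|%:E)%E.
  move=> yD; rewrite [RHS]integral_mkcond; apply: eq_integral => x _.
  rewrite /g /= patchE /G patchE mem_set// indicE.
  case: ifP => xI; last by rewrite mulr0.
  rewrite mulr1 /aP; congr (`|P _ y|%:E); move: xI; rewrite inE /I01 /= in_itv /= => /andP[h1 h2].
  by rewrite /cl max_l// min_l.
have HM : (\int[mu]_y H y <= (M * (x1 - x0))%:E)%E.
  rewrite -(@fubini_tonelli _ _ _ _ R mu mu g mg g0).
  have ME : (\int[mu]_(x in I01) M%:E)%E = (M * (x1 - x0))%:E.
    rewrite integral_cst/=; last exact: measurable_itv.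
    by rewrite (_ : mu I01 = (x1 - x0)%:E)// /I01 lebesgue_measure_itv/= lte_fin x01.
  rewrite -ME [leRHS]integral_mkcond; apply: ge0_le_integral => //.
  - by move=> x _; exact: integral_ge0.
  - exact: (@measurable_fun_fubini_tonelli_F _ _ _ _ R mu g mg g0).
  - by apply/(measurable_restrictT _ _).1; [exact: measurable_itv|exact: measurable_cst].
  move=> x _; rewrite patchE; case: ifPn => xI; last first.
    by rewrite integral0_eq// => y _; rewrite /g /= indicE (negbTE xI) mulr0.
  have xb : x0 <= x <= x1 by move: xI; rewrite inE /I01 /= in_itv.
  apply: le_trans (tail x xb); rewrite [leRHS]integral_mkcond le_eqVlt; apply/orP; left.
  apply/eqP; apply: eq_integral => y _; rewrite /g /= indicE xI mulr1 /G !patchE.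
  case: ifP => // _; rewrite /aP (_ : cl x = x)// /cl.
  by move: xb => /andP[h1 h2]; rewrite max_l// min_l.
have i01 : mu.-integrable setT (EFin \o (fun y => Q x1 y - Q x0 y)).
  exact: (integrableB _ i1 i0).
apply/eqP; rewrite eq_sym -subr_eq0 -RintegralB//; apply/eqP.
have cd n : exists c d, [/\ c <= yq - n.+1%:R, yq + n.+1%:R <= d &
   `|\int[mu]_(y in `[c, d]) (Q x1 y - Q x0 y)| <= 2 / n.+1%:R].
  have e0 : 0 < n.+1%:R^-1 :> R by rewrite invr_gt0.
  pose L : R := (`|M * (x1 - x0)| + 1) * n.+1%:R.
  have L0 : 0 < L by rewrite mulr_gt0// ltr_pwDr.
  have ML : M * (x1 - x0) < n.+1%:R^-1 * L.
    by rewrite /L mulrCA mulVf// mulr1 (le_lt_trans (ler_norm _))// ltrDl.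
  have small0 u v : v - u = L -> exists y, [/\ u <= y, y <= v & (H y < (n.+1%:R^-1)%:E)%E].
    move=> uv; apply: (small_value H0 mH HM (ltW e0)); last by rewrite uv.
    by rewrite -subr_gt0 uv.
  have [|d [dn _ Hd]] := small0 (yq + n.+1%:R) (yq + n.+1%:R + L); first by ring.
  have [|c [_ cn Hc]] := small0 (yq - n.+1%:R - L) (yq - n.+1%:R); first by ring.
  exists c, d; split => //.
  have n1 : 1 <= n.+1%:R :> R by rewrite ler1n.
  have cq : c < yq by rewrite (le_lt_trans cn)// ltrBlDr ltrDl.
  have dq : yq < d by rewrite (lt_le_trans _ dn)// ltrDl.
  have cD : D c by rewrite /D /= ler_normr; apply/orP; right; clear -cn n1; lra.
  have dD : D d by rewrite /D /= ler_normr; apply/orP; left; clear -dn n1; lra.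
  have := @goursat_puncture R P Q x0 x1 c d xq yq C r.
  rewrite x0q xq1 cq dq => /(_ isT isT r0).
  have cf' x y : x0 <= x <= x1 -> c <= y <= d -> (x, y) <> (xq, yq) -> closed_form P Q x y.
    by move=> xb _; exact: cf.
  move=> /(_ cf' bd); rewrite /circulation addrC => /eqP; rewrite addr_eq0 => /eqP ->.
  have iP y : D y -> mu.-integrable I01 (EFin \o P^~ y).
    move=> yD; apply: integrable_itv_cont => x xb.
    by have [p1 [q [q2 [dP _]]]] := cf x y xb (Dq x _ yD); exact: diff2_cont1 dP.
  rewrite normrN RintegralB//; [|exact: iP..].
  apply: (le_trans (ler_normB _ _)).
  have small y : D y -> (H y < (n.+1%:R^-1)%:E)%E -> `|\int[mu]_(x in I01) P x y| <= n.+1%:R^-1.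
    move=> yD Hy; rewrite -lee_fin; apply/ltW; apply: le_lt_trans Hy.
    rewrite EFin_normr_Rintegral//; last exact: iP.
    rewrite HE//; apply: le_abse_integral => //.
    exact: measurable_int (iP y yD).
  by apply: (le_trans (lerD (small _ cD Hc) (small _ dD Hd))); rewrite mulr2n mulrDl mul1r.
have [c Hc] := choice cd; have [d Hcd] := choice Hc.
have nn n : n%:R <= n.+1%:R :> R by rewrite ler_nat.
have cv := @cvg_Rintegral_itv _ c d yq i01.
have {}cv : \int[mu]_(y in `[c n, d n]) (Q x1 y - Q x0 y) @[n --> \oo] -->
    \int[mu]_y (Q x1 y - Q x0 y).
  apply: cv => n; have [h1 h2 _] := Hcd n.
    by apply: (le_trans h1); rewrite lerD2l lerN2.
  by apply: le_trans h2; rewrite lerD2l.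
apply: (cvg_unique _ cv); first exact: norm_hausdorff.
apply/cvgrPdist_lt => e e0; near=> n; rewrite sub0r normrN.
have [_ _ h] := Hcd n; apply: (le_lt_trans h).
rewrite -ltr_pdivlMl//; near: n.
have e20 : 0 < 2^-1 * e by rewrite mulr_gt0.
exact: (near_infty_natSinv_lt (PosNum e20)).
Unshelve. all: by end_near. Qed.

End Strip.

(** * Square-integrable functions on the line *)

Section Cauchy_weight.
Variable R : realType.
Local Notation mu := (@lebesgue_measure R).
Implicit Types (a b y : R).

Lemma integral_oneDsqrV : (\int[mu]_y ((oneDsqr y)^-1)%:E)%E = (pi : R)%:E.
Proof.
rewrite (@ge0_symfun_integralT _ (fun y => (oneDsqr y)^-1))//=.
- rewrite (_ : [set x | _] = `[0, +oo[%classic); last first.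
    by apply/seteqP; split => x/=; rewrite in_itv/= andbT.
  by rewrite integral0y_oneDsqr -EFinM mulrC divfK.
- exact: continuous_oneDsqrV.
- by move=> y /=; rewrite /oneDsqr sqrrN.
Qed.

Lemma sqrD_gt0 a y : 0 < a -> 0 < a ^+ 2 + y ^+ 2.
Proof. by move=> a0; rewrite ltr_pwDl ?sqr_ge0// exprn_gt0. Qed.

Lemma continuous_cauchyV a b : 0 < a ->
  continuous (fun y => (a ^+ 2 + (y - b) ^+ 2)^-1).
Proof.
move=> a0 y; apply: cvgV; first by rewrite gt_eqF// sqrD_gt0.
apply: cvgD; first exact: cvg_cst.
by apply: cvgM; apply: cvgB; (try exact: cvg_id); exact: cvg_cst.
Qed.

Lemma cauchyV_scale a b y : 0 < a ->
  (a ^+ 2 + (y - b) ^+ 2)^-1 = a^-1 * ((1 + ((y - b) / a) ^+ 2)^-1 * a^-1).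
Proof.
move=> a0; have a1 : a != 0 by rewrite gt_eqF.
have d0 : a ^+ 2 + (y - b) ^+ 2 != 0 by rewrite gt_eqF// sqrD_gt0.
have d1 : 1 + ((y - b) / a) ^+ 2 = (a ^+ 2 + (y - b) ^+ 2) / a ^+ 2 by field.
by rewrite d1 invf_div; field; rewrite a1.
Qed.

Lemma integral_cauchyV a b : 0 < a ->
  (\int[mu]_y ((a ^+ 2 + (y - b) ^+ 2)^-1)%:E)%E = (pi / a)%:E.
Proof.
move=> a0; pose F (x : R^o) := (x - b) / a.
have F'E : F^`()%classic = cst a^-1.
  apply/funext => x; rewrite /F derive1E deriveM// deriveD// derive_cst scaler0.
  by rewrite add0r derive_id derive_cst addr0 scaler1.
transitivity (\int[mu]_y (a^-1%:E * ((((fun x => (oneDsqr x)^-1) \o F) * F^`()%classic) y)%:E))%E.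
  apply: eq_integral => y _; rewrite F'E -EFinM; congr EFin.
  exact: cauchyV_scale.
rewrite ge0_integralZl//=; first last.
- by rewrite lee_fin invr_ge0 ltW.
- move=> y _; rewrite F'E lee_fin /GRing.mul_fun /= mulr_ge0 ?invr_ge0 ?ltW//.
- rewrite F'E; apply/measurable_EFinP; apply: measurable_funM => //.
  apply: continuous_measurable_fun => y; apply: continuous_comp; last exact: continuous_oneDsqrV.
  by apply: cvgM; [apply: cvgB; [exact: cvg_id|exact: cvg_cst]|exact: cvg_cst].
rewrite -increasing_ge0_integration_by_substitutionT//.
- by rewrite integral_oneDsqrV -EFinM mulrC.
- by move=> x y xy; rewrite /F ltr_pM2r ?invr_gt0// ltrD2r.
- by rewrite F'E => ?; exact: cvg_cst.
- by rewrite F'E; exact: is_cvg_cst.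
- by rewrite F'E; exact: is_cvg_cst.
- apply/gt0_cvgMlNy; last exact: cvg_addrr_Ny.
  by rewrite invr_gt0.
- apply/gt0_cvgMly; last exact: cvg_addrr.
  by rewrite invr_gt0.
- exact: continuous_oneDsqrV.
Qed.

End Cauchy_weight.

Section L2tools.
Variable R : realType.
Local Notation mu := (@lebesgue_measure R).
Implicit Types (f g h : R -> R[i]) (x y t : R).

Lemma cmeas_cont f : (forall y e, 0 < e -> exists2 d, 0 < d &
    forall y', `|y' - y| < d -> cabs (f y' - f y) <= e) -> cmeasurable f.
Proof.
move=> H; split; apply: continuous_measurable_fun => y; apply/cvgrPdist_le => e e0;
  have [d d0 D] := H y e e0; apply: (near_dist d0) => t td; rewrite distrC.
- by apply: le_trans (D t td); rewrite -ReN -ReD Re_le_cabs.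
- by apply: le_trans (D t td); rewrite -ImN -ImD Im_le_cabs.
Qed.

Lemma cmeas_cst c : cmeasurable (fun _ : R => c).
Proof. by split; exact: measurable_cst. Qed.

Lemma cmeasD f g : cmeasurable f -> cmeasurable g -> cmeasurable (fun y => f y + g y).
Proof.
move=> [f1 f2] [g1 g2]; split.
- by under eq_fun do rewrite ReD; exact: measurable_funD.
- by under eq_fun do rewrite ImD; exact: measurable_funD.
Qed.

Lemma cmeasM f g : cmeasurable f -> cmeasurable g -> cmeasurable (fun y => f y * g y).
Proof.
move=> [f1 f2] [g1 g2]; split.
- by under eq_fun do rewrite ReM; apply: measurable_funB; exact: measurable_funM.
- by under eq_fun do rewrite ImM; apply: measurable_funD; exact: measurable_funM.
Qed.

Lemma cmeasN f : cmeasurable f -> cmeasurable (fun y => - f y).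
Proof.
move=> [f1 f2]; split.
- by under eq_fun do rewrite ReN; exact: measurableT_comp.
- by under eq_fun do rewrite ImN; exact: measurableT_comp.
Qed.

Lemma cmeasB f g : cmeasurable f -> cmeasurable g -> cmeasurable (fun y => f y - g y).
Proof. by move=> mf mg; apply: cmeasD => //; exact: cmeasN. Qed.

Lemma cmeasJ f : cmeasurable f -> cmeasurable (fun y => (f y)^*).
Proof.
move=> [f1 f2]; split.
- by under eq_fun do rewrite ReJ.
- by under eq_fun do rewrite ImJ; exact: measurableT_comp.
Qed.

Lemma cmeas_sum (I : Type) (r : seq I) (f : I -> R -> R[i]) :
  (forall i, cmeasurable (f i)) -> cmeasurable (fun y => \sum_(i <- r) f i y).
Proof.
move=> mf; elim: r => [|i r IH].
  by under eq_fun do rewrite big_nil; exact: cmeas_cst.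
by under eq_fun do rewrite big_cons; exact: cmeasD.
Qed.

Lemma measurable_cabs2 f : cmeasurable f -> measurable_fun setT (fun y => cabs (f y) ^+ 2).
Proof.
move=> [f1 f2]; under eq_fun do rewrite sqr_cabs.
by apply: measurable_funD; exact: measurable_funX.
Qed.

Lemma measurable_cabs f : cmeasurable f -> measurable_fun setT (fun y => cabs (f y)).
Proof.
move=> mf; rewrite (_ : (fun _ => _) = fun y => Num.sqrt (cabs (f y) ^+ 2)); last first.
  by apply/funext => y; rewrite sqrtr_sqr ger0_norm// cabs_ge0.
apply: (measurableT_comp (f := @Num.sqrt R)); last exact: measurable_cabs2.
by apply: continuous_measurable_fun; exact: sqrt_continuous.
Qed.

Lemma cmeas_cvg (u : nat -> R -> R[i]) f : (forall n, cmeasurable (u n)) ->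
  (forall y, cabs (u n y - f y) @[n --> \oo] --> 0) -> cmeasurable f.
Proof.
move=> mu_ H; split.
- apply: (@measurable_fun_cvg _ _ _ setT (fun n y => complex.Re (u n y))).
    by move=> n; have [] := mu_ n.
  move=> y _; apply/cvgrPdist_le => e e0.
  have /cvgrPdist_le /(_ _ e0) := H y; apply: filterS => n.
  rewrite sub0r normrN ger0_norm ?cabs_ge0//; apply: le_trans.
  by rewrite distrC -ReN -ReD Re_le_cabs.
- apply: (@measurable_fun_cvg _ _ _ setT (fun n y => complex.Im (u n y))).
    by move=> n; have [] := mu_ n.
  move=> y _; apply/cvgrPdist_le => e e0.
  have /cvgrPdist_le /(_ _ e0) := H y; apply: filterS => n.
  rewrite sub0r normrN ger0_norm ?cabs_ge0//; apply: le_trans.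
  by rewrite distrC -ImN -ImD Im_le_cabs.
Qed.

Lemma sqL2norm_ge0 f : (0 <= sqL2norm f)%E.
Proof. by apply: integral_ge0 => y _; rewrite lee_fin sqr_ge0. Qed.

Lemma integral_scale_cabs2 f (A : R) : 0 <= A -> cmeasurable f ->
  (\int[mu]_y (A * cabs (f y) ^+ 2)%:E = A%:E * sqL2norm f)%E.
Proof.
move=> A0 mf; under eq_integral do rewrite EFinM.
rewrite ge0_integralZl//.
- by apply/measurable_EFinP; exact: measurable_cabs2.
- by move=> y _; rewrite lee_fin sqr_ge0.
Qed.

(** The triangle inequality of L^2 is replaced throughout by estimates of this
    shape, with constants, which need no square root of an integral. *)
Lemma sqL2norm_le f g h (A B : R) : 0 <= A -> 0 <= B ->
  cmeasurable f -> cmeasurable g -> cmeasurable h ->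
  (forall y, cabs (f y) ^+ 2 <= A * cabs (g y) ^+ 2 + B * cabs (h y) ^+ 2) ->
  (sqL2norm f <= A%:E * sqL2norm g + B%:E * sqL2norm h)%E.
Proof.
move=> A0 B0 mf mg mh H.
have m1 : measurable_fun setT (fun y => A * cabs (g y) ^+ 2).
  by apply: measurable_funM => //; exact: measurable_cabs2.
have m2 : measurable_fun setT (fun y => B * cabs (h y) ^+ 2).
  by apply: measurable_funM => //; exact: measurable_cabs2.
rewrite -!integral_scale_cabs2// -ge0_integralD//=; last 4 first.
- by move=> y _; rewrite lee_fin mulr_ge0 ?sqr_ge0.
- exact/measurable_EFinP.
- by move=> y _; rewrite lee_fin mulr_ge0 ?sqr_ge0.
- exact/measurable_EFinP.
apply: ge0_le_integral => //=.
- by move=> y _; rewrite lee_fin sqr_ge0.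
- by apply/measurable_EFinP; exact: measurable_cabs2.
- apply/measurable_EFinP; exact: measurable_funD.
- by move=> y _; rewrite lee_fin; exact: H.
Qed.

Lemma sqL2norm_le1 f g (A : R) : 0 <= A -> cmeasurable f -> cmeasurable g ->
  (forall y, cabs (f y) <= A * cabs (g y)) ->
  (sqL2norm f <= (A ^+ 2)%:E * sqL2norm g)%E.
Proof.
move=> A0 mf mg H.
have := @sqL2norm_le f g g (A ^+ 2) 0 (sqr_ge0 _) (lexx _) mf mg mg.
rewrite mul0e adde0; apply => y; rewrite mul0r addr0 -exprMn.
by apply: lerXn2r; rewrite ?nnegrE ?mulr_ge0 ?cabs_ge0.
Qed.

Lemma sqr_cabsD (z w : R[i]) : cabs (z + w) ^+ 2 <= 2 * cabs z ^+ 2 + 2 * cabs w ^+ 2.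
Proof.
apply: (@le_trans _ _ ((cabs z + cabs w) ^+ 2)).
  by apply: lerXn2r; rewrite ?nnegrE ?addr_ge0 ?cabs_ge0// cabsD.
rewrite -subr_ge0 (_ : _ - _ = (cabs z - cabs w) ^+ 2) ?sqr_ge0//; ring.
Qed.

Lemma sqL2normD f g : cmeasurable f -> cmeasurable g ->
  (sqL2norm (fun y => f y + g y)%R <= 2%:E * sqL2norm f + 2%:E * sqL2norm g)%E.
Proof.
move=> mf mg; apply: sqL2norm_le => //; first exact: cmeasD.
by move=> y; exact: sqr_cabsD.
Qed.

Lemma sqL2normN f : sqL2norm (fun y => - f y) = sqL2norm f.
Proof. by apply: eq_integral => y _; rewrite -/(cabs _) cabsN. Qed.

Lemma sqL2norm_swap f g : sqL2norm (fun y => f y - g y) = sqL2norm (fun y => g y - f y).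
Proof. by rewrite -sqL2normN; apply: eq_integral => y _; rewrite opprB. Qed.

Lemma L2_of_le f (A : R) : cmeasurable f -> (sqL2norm f <= A%:E)%E -> L2 f.
Proof. by move=> mf H; split => //; rewrite (le_lt_trans H) ?ltry. Qed.

Lemma L2_bound f : L2 f -> exists2 A : R, 0 <= A & (sqL2norm f <= A%:E)%E.
Proof.
move=> [mf H]; exists (fine (sqL2norm f)); first by rewrite fine_ge0 ?sqL2norm_ge0.
by rewrite fineK// ge0_fin_numE ?sqL2norm_ge0.
Qed.

Lemma L2D f g : L2 f -> L2 g -> L2 (fun y => f y + g y).
Proof.
move=> [mf Hf] [mg Hg]; split; first exact: cmeasD.
by apply: le_lt_trans (sqL2normD mf mg) _; rewrite lte_add_pinfty ?lte_mul_pinfty// ?lee_fin//.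
Qed.

Lemma L2_mul_bounded f g (A : R) : cmeasurable g -> (forall y, cabs (g y) <= A) -> L2 f ->
  L2 (fun y => g y * f y).
Proof.
move=> mg gA [mf Hf]; split; first exact: cmeasM.
have A0 : 0 <= A by rewrite (le_trans _ (gA 0))// cabs_ge0.
apply: (@le_lt_trans _ _ ((A ^+ 2)%:E * sqL2norm f)%E).
  apply: sqL2norm_le1 => //; first exact: cmeasM.
  by move=> y; rewrite cabsM ler_wpM2r ?cabs_ge0.
by rewrite lte_mul_pinfty ?lee_fin ?sqr_ge0.
Qed.

Lemma L2Z c f : L2 f -> L2 (fun y => c * f y).
Proof. by apply: (@L2_mul_bounded f (fun=> c) (cabs c)) => //; exact: cmeas_cst. Qed.

Lemma L2N f : L2 f -> L2 (fun y => - f y).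
Proof. by move=> [mf Hf]; split; [exact: cmeasN|rewrite sqL2normN]. Qed.

Lemma L2B f g : L2 f -> L2 g -> L2 (fun y => f y - g y).
Proof. by move=> Lf Lg; apply: L2D => //; exact: L2N. Qed.

Lemma L2J f : L2 f -> L2 (fun y => (f y)^*).
Proof.
move=> [mf Hf]; split; first exact: cmeasJ.
by rewrite (_ : sqL2norm _ = sqL2norm f)//; apply: eq_integral => y _; rewrite -/(cabs _) cabsJ.
Qed.

Lemma sqL2norm0 : sqL2norm (fun=> 0 : R[i]) = 0%E.
Proof. by rewrite /sqL2norm integral0_eq// => y _; rewrite -/(cabs _) cabs0 expr0n. Qed.

Lemma L2_0 : L2 (fun=> 0 : R[i]).
Proof. by apply: (@L2_of_le _ 0); [exact: cmeas_cst|rewrite sqL2norm0]. Qed.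

End L2tools.

(** * Complex-valued integrals *)

Section ComplexIntegral.
Variable R : realType.
Local Notation mu := (@lebesgue_measure R).
Implicit Types (f g h : R -> R[i]) (x y t : R).

Definition cintegrable f := cmeasurable f /\ (\int[mu]_y (cabs (f y))%:E < +oo)%E.

Lemma cintegrable_Re f : cintegrable f ->
  mu.-integrable setT (EFin \o (fun y => complex.Re (f y))).
Proof.
move=> [mf Hf]; apply/integrableP; split; first by apply/measurable_EFinP; case: mf.
apply: le_lt_trans Hf; apply: ge0_le_integral => //.
- by apply/measurable_EFinP; apply: measurableT_comp => //; case: mf.
- by apply/measurable_EFinP; exact: measurable_cabs.
- by move=> y _; rewrite lee_fin Re_le_cabs.
Qed.

Lemma cintegrable_Im f : cintegrable f ->
  mu.-integrable setT (EFin \o (fun y => complex.Im (f y))).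
Proof.
move=> [mf Hf]; apply/integrableP; split; first by apply/measurable_EFinP; case: mf.
apply: le_lt_trans Hf; apply: ge0_le_integral => //.
- by apply/measurable_EFinP; apply: measurableT_comp => //; case: mf.
- by apply/measurable_EFinP; exact: measurable_cabs.
- by move=> y _; rewrite lee_fin Im_le_cabs.
Qed.

Lemma cintegrableD f g : cintegrable f -> cintegrable g -> cintegrable (fun y => f y + g y).
Proof.
move=> [mf Hf] [mg Hg]; split; first exact: cmeasD.
apply: (@le_lt_trans _ _ (\int[mu]_y ((cabs (f y))%:E + (cabs (g y))%:E))%E).
  apply: ge0_le_integral => //.
  - by move=> y _; rewrite lee_fin cabs_ge0.
  - by apply/measurable_EFinP; apply: measurable_cabs; exact: cmeasD.
  - by apply: emeasurable_funD; apply/measurable_EFinP; exact: measurable_cabs.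
  - by move=> y _; rewrite -EFinD lee_fin cabsD.
rewrite ge0_integralD//; last 4 first.
- by move=> y _; rewrite lee_fin cabs_ge0.
- by apply/measurable_EFinP; exact: measurable_cabs.
- by move=> y _; rewrite lee_fin cabs_ge0.
- by apply/measurable_EFinP; exact: measurable_cabs.
by rewrite lte_add_pinfty.
Qed.

Lemma cintegrableZ c f : cintegrable f -> cintegrable (fun y => c * f y).
Proof.
move=> [mf Hf]; split; first by apply: cmeasM => //; exact: cmeas_cst.
under eq_integral do rewrite cabsM EFinM.
rewrite ge0_integralZl//.
- by rewrite lte_mul_pinfty ?lee_fin ?cabs_ge0.
- by apply/measurable_EFinP; exact: measurable_cabs.
- by move=> y _; rewrite lee_fin cabs_ge0.
- by rewrite lee_fin cabs_ge0.
Qed.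

Lemma cintegrableB f g : cintegrable f -> cintegrable g -> cintegrable (fun y => f y - g y).
Proof.
move=> If Ig; apply: cintegrableD => //.
by have := cintegrableZ (-1) Ig; under eq_fun do rewrite mulN1r.
Qed.

Lemma cintegral_Re f : complex.Re (cintegral f) = \int[mu]_y complex.Re (f y).
Proof. by []. Qed.

Lemma cintegral_Im f : complex.Im (cintegral f) = \int[mu]_y complex.Im (f y).
Proof. by []. Qed.

Lemma cintegralD f g : cintegrable f -> cintegrable g ->
  cintegral (fun y => f y + g y) = cintegral f + cintegral g.
Proof.
move=> If Ig; apply: complexP; rewrite ?ReD ?ImD !(cintegral_Re, cintegral_Im).
  under eq_Rintegral do rewrite ReD.
  by rewrite RintegralD//; exact: cintegrable_Re.
under eq_Rintegral do rewrite ImD.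
by rewrite RintegralD//; exact: cintegrable_Im.
Qed.

Lemma integrable_scale (u : R -> R) (r : R) : mu.-integrable setT (EFin \o u) ->
  mu.-integrable setT (EFin \o (fun y => r * u y)).
Proof.
move=> iu; apply: eq_integrable (integrableZl measurableT r iu) => //.
Qed.

Lemma cintegralZ c f : cintegrable f ->
  cintegral (fun y => c * f y) = c * cintegral f.
Proof.
move=> If; have [IR II] := (cintegrable_Re If, cintegrable_Im If).
apply: complexP; rewrite ?ReM ?ImM !(cintegral_Re, cintegral_Im).
  under eq_Rintegral do rewrite ReM.
  rewrite RintegralB ?RintegralZl//; exact: integrable_scale.
under eq_Rintegral do rewrite ImM.
rewrite RintegralD ?RintegralZl//; exact: integrable_scale.
Qed.

Lemma cintegralB f g : cintegrable f -> cintegrable g ->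
  cintegral (fun y => f y - g y) = cintegral f - cintegral g.
Proof.
move=> If Ig; rewrite -mulN1r -cintegralZ// -cintegralD//; last exact: cintegrableZ.
by congr cintegral; apply/funext => y; rewrite mulN1r.
Qed.

Lemma cintegralJ f : cintegrable f -> cintegral (fun y => (f y)^*) = (cintegral f)^*.
Proof.
move=> If; apply: complexP; rewrite ?ReJ ?ImJ !(cintegral_Re, cintegral_Im).
  by apply: eq_Rintegral => y _; rewrite ReJ.
rewrite -mulN1r -RintegralZl//; last exact: cintegrable_Im.
by apply: eq_Rintegral => y _; rewrite ImJ mulN1r.
Qed.

(** The factor 2 comes from estimating the real and the imaginary part
    separately. *)
Lemma cabs_cintegral f (K : R) : cmeasurable f ->
  (\int[mu]_y (cabs (f y))%:E <= K%:E)%E -> cabs (cintegral f) <= 2 * K.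
Proof.
move=> mf HK.
have If : cintegrable f by split => //; rewrite (le_lt_trans HK) ?ltry.
have aux (u : R -> R) : mu.-integrable setT (EFin \o u) ->
    (forall y, `|u y| <= cabs (f y)) -> `|\int[mu]_y u y| <= K.
  move=> iu uf; rewrite -lee_fin EFin_normr_Rintegral//; apply: le_trans HK.
  apply: (le_trans (le_abse_integral _ _ _)) => //; first exact: measurable_int iu.
  apply: ge0_le_integral => //.
  - by apply: measurableT_comp => //; exact: measurable_int iu.
  - by apply/measurable_EFinP; exact: measurable_cabs.
  - by move=> y _; rewrite lee_fin uf.
apply: (le_trans (cabs_le _)); rewrite mulr2n mulrDl mul1r; apply: lerD; apply: aux.
- exact: cintegrable_Re.
- by move=> y; exact: Re_le_cabs.
- exact: cintegrable_Im.
- by move=> y; exact: Im_le_cabs.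
Qed.

(** The inequality between means with a free weight [t] stands in for the
    Cauchy-Schwarz inequality: the weight can be chosen to make either term
    small. *)
Lemma integral_cabs_mul f g (A B t : R) : cmeasurable f -> cmeasurable g -> 0 < t ->
  (sqL2norm f <= A%:E)%E -> (sqL2norm g <= B%:E)%E ->
  (\int[mu]_y (cabs (f y * g y))%:E <= (t * A + t^-1 * B)%:E)%E.
Proof.
move=> mf mg t0 HA HB; have ti0 : 0 < t^-1 by rewrite invr_gt0.
apply: (@le_trans _ _ (t%:E * sqL2norm f + t^-1%:E * sqL2norm g)%E); last first.
  by rewrite EFinD !EFinM leeD// lee_pmul2l// lte_fin.
have t1 : 0 <= t by exact: ltW.
have ti1 : 0 <= t^-1 by exact: ltW.
rewrite -!integral_scale_cabs2// -ge0_integralD//=; last 4 first.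
- by move=> y _; rewrite lee_fin mulr_ge0 ?sqr_ge0.
- by apply/measurable_EFinP; apply: measurable_funM => //; exact: measurable_cabs2.
- by move=> y _; rewrite lee_fin mulr_ge0 ?sqr_ge0.
- by apply/measurable_EFinP; apply: measurable_funM => //; exact: measurable_cabs2.
apply: ge0_le_integral => //=.
- by move=> y _; rewrite lee_fin cabs_ge0.
- by apply/measurable_EFinP; apply: measurable_cabs; exact: cmeasM.
- by apply/measurable_EFinP; apply: measurable_funD; apply: measurable_funM => //;
    exact: measurable_cabs2.
- move=> y _; rewrite lee_fin cabsM.
  set a := cabs _; set b := cabs _.
  have a0 : 0 <= a by exact: cabs_ge0. have b0 : 0 <= b by exact: cabs_ge0.
  have H : 0 <= t^-1 * (t * a - b) ^+ 2 by rewrite mulr_ge0 ?sqr_ge0.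
  have E : t^-1 * (t * a - b) ^+ 2 = t * a ^+ 2 + t^-1 * b ^+ 2 - 2 * (a * b).
    by field; rewrite gt_eqF.
  have ab : 0 <= a * b by rewrite mulr_ge0.
  rewrite E in H; clear -H ab; lra.
Qed.

Lemma cintegrable_mul f g : L2 f -> L2 g -> cintegrable (fun y => f y * g y).
Proof.
move=> Lf Lg; have [A _ HA] := L2_bound Lf; have [B _ HB] := L2_bound Lg.
case: Lf Lg => mf _ [mg _]; split; first exact: cmeasM.
by apply: le_lt_trans (integral_cabs_mul mf mg ltr01 HA HB) _; rewrite ltry.
Qed.

Lemma cabs_cintegral_mul f g (A B t : R) : cmeasurable f -> cmeasurable g -> 0 < t ->
  (sqL2norm f <= A%:E)%E -> (sqL2norm g <= B%:E)%E ->
  cabs (cintegral (fun y => f y * g y)) <= 2 * (t * A + t^-1 * B).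
Proof.
move=> mf mg t0 HA HB; apply: cabs_cintegral; first exact: cmeasM.
exact: integral_cabs_mul.
Qed.

(** Integration against a fixed square-integrable function is continuous. *)
Lemma cintegral_mul_closed f k c : L2 f -> L2 k ->
  (forall e : R, 0 < e -> exists f' c', [/\ L2 f', (sqL2norm (fun y => f y - f' y)%R <= e%:E)%E,
     cintegral (fun y => f' y * k y) = c' & cabs (c' - c) <= e]) ->
  cintegral (fun y => f y * k y) = c.
Proof.
move=> Lf Lk H; apply/eqP; rewrite -subr_eq0 -cabs_eq0.
set I := cintegral _; apply/eqP/le_anti; rewrite cabs_ge0 andbT.
apply/ler_addgt0Pr => e e0; rewrite add0r.
have [B B0 HB] := L2_bound Lk.
(* With this weight [t^-1 * B] is at most [e / 8]; [e'] makes [t * e'] as small. *)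
pose t := 8 * (B + 1) / e; have t0 : 0 < t by rewrite divr_gt0// mulr_gt0// ltr_wpDl.
pose e' := Num.min (e / (8 * t)) (e / 2).
have e'0 : 0 < e' by rewrite lt_min !divr_gt0// mulr_gt0.
have [f' [c' [Lf' Hf' I' cc]]] := H e' e'0.
have -> : I - c = cintegral (fun y => (f y - f' y) * k y) + (c' - c).
  rewrite (_ : (fun y => _) = fun y => f y * k y - f' y * k y); last first.
    by apply/funext => y; rewrite mulrBl.
  by rewrite cintegralB ?I'; [rewrite -/I; ring|exact: cintegrable_mul..].
apply: (le_trans (cabsD _ _)).
have Lff : L2 (fun y => f y - f' y) by exact: L2B.
have := cabs_cintegral_mul Lff.1 Lk.1 t0 Hf' HB => K.
have h1 : t * e' <= e / 8.
  apply: (@le_trans _ _ (t * (e / (8 * t)))); first by rewrite ler_pM2l// ge_min lexx.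
  by rewrite le_eqVlt; apply/orP; left; apply/eqP; field; rewrite gt_eqF.
have h2 : t^-1 * B <= e / 8.
  rewrite /t invf_div mulrAC -mulrA ler_pM2l// ler_pdivrMr ?mulr_gt0 ?ltr_wpDl//.
  by rewrite mulrA mulVf// mul1r lerDl.
have h3 : e' <= e / 2 by rewrite ge_min lexx orbT.
by clear -K h1 h2 h3 cc e0; lra.
Qed.

End ComplexIntegral.

(** * Integral representations in the Hardy space *)

Section Line.
Variable R : realType.
Local Notation mu := (@lebesgue_measure R).
Implicit Types (F f : R[i] -> R[i]) (z q : R[i]) (x y a b t M C : R).

Definition left_cdiff F := forall z, complex.Re z < 2^-1 -> cdiff F z.

Definition left_bounded F M :=
  forall x, x < 2^-1 -> (sqL2norm (fun y => F (x +i* y)) <= M%:E)%E.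

Lemma cmeas_line F x : (forall y, cdiff F (x +i* y)) -> cmeasurable (fun y => F (x +i* y)).
Proof.
move=> dF; apply: cmeas_cont => y e e0; have [d d0 D] := cdiff_cont (dF y) e0.
exists d => // y' yd; apply: D; apply: le_lt_trans yd.
by rewrite (_ : _ - _ = 0 +i* (y' - y)) ?(le_trans (cabs_Complex _ _)) ?normr0 ?add0r//;
  apply: complexP; rewrite /= ?subrr.
Qed.

Lemma cabs_line x y q : cabs (x +i* y - q) ^+ 2 = (x - complex.Re q) ^+ 2 + (y - complex.Im q) ^+ 2.
Proof. by case: q => a b; rewrite sqr_cabs. Qed.

Lemma line_neq x y q : x != complex.Re q -> x +i* y - q != 0.
Proof.
case: q => a b /= xa; apply: contraNneq xa => /(congr1 (@complex.Re R)) /= /eqP.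
by rewrite subr_eq0.
Qed.

(** By the inequality between means this dominates [|F| / |z - q'| + 1 / |z -
    q'|^2] on the line of abscissa [x], where [d] and [b] are the coordinates
    of [q'] relative to that line.  Its integral involves the square norm of
    [F] and a Poisson integral only. *)
Definition majorant F (x t d b : R) y :=
  t * cabs (F (x +i* y)) ^+ 2 + (t^-1 + 1) * (d ^+ 2 + (y - b) ^+ 2)^-1.

Lemma integral_majorant F x t d b M : (forall y, cdiff F (x +i* y)) ->
  (sqL2norm (fun y => F (x +i* y)) <= M%:E)%E -> 0 < t -> 0 < d ->
  [/\ measurable_fun setT (majorant F x t d b), forall y, 0 <= majorant F x t d b y &
  (\int[mu]_y (majorant F x t d b y)%:E <= (t * M + (t^-1 + 1) * (pi / d))%:E)%E].
Proof.
move=> dF HM t0 d0; have t1 : 0 <= t by exact: ltW.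
have ti0 : 0 <= t^-1 + 1 by rewrite addr_ge0// invr_ge0.
have mF := cmeas_line dF.
have w0 y : 0 <= (d ^+ 2 + (y - b) ^+ 2)^-1 by rewrite invr_ge0 addr_ge0 ?sqr_ge0.
have m1 : measurable_fun setT (fun y => t * cabs (F (x +i* y)) ^+ 2).
  by apply: measurable_funM => //; exact: (measurable_cabs2 mF).
have mw : measurable_fun setT (fun y => (d ^+ 2 + (y - b) ^+ 2)^-1).
  by apply: continuous_measurable_fun; exact: continuous_cauchyV.
have m2 : measurable_fun setT (fun y => (t^-1 + 1) * (d ^+ 2 + (y - b) ^+ 2)^-1).
  exact: measurable_funM.
split; first exact: measurable_funD.
  by move=> y; rewrite addr_ge0// mulr_ge0// sqr_ge0.
rewrite /majorant; under eq_integral do rewrite EFinD.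
rewrite ge0_integralD//=; last 4 first.
- by move=> y _; rewrite lee_fin mulr_ge0 ?sqr_ge0.
- exact/measurable_EFinP.
- by move=> y _; rewrite lee_fin mulr_ge0.
- exact/measurable_EFinP.
rewrite EFinD; apply: leeD.
  by rewrite (integral_scale_cabs2 t1 mF) EFinM lee_pmul2l// lte_fin.
under eq_integral do rewrite EFinM.
rewrite ge0_integralZl//=; last 2 first.
- exact/measurable_EFinP.
- by move=> y _; rewrite lee_fin.
by rewrite integral_cauchyV// EFinM.
Qed.

(** By [strip] the integral of [f] is the same on the lines of abscissa [x1]
    and [x0], for [x0] far to the left.  There it is at most a multiple of [t M
    + (1 / t + 1) pi / (Re q' - x0)], which is small when first [t] and then
    [x0] are well chosen.  The point [q] may be a singularity as long as [f] is
    bounded near it. *)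
Lemma line_integral0 F f M q q' x1 r C C0 :
  left_cdiff F -> left_bounded F M -> x1 < 2^-1 ->
  complex.Re q < x1 -> x1 < complex.Re q' -> 0 < r -> 0 <= C ->
  (forall z, complex.Re z <= x1 -> z != q -> cdiff f z) ->
  (forall z, `|complex.Re z - complex.Re q| <= r -> `|complex.Im z - complex.Im q| <= r ->
     z != q -> cabs (f z) <= C0) ->
  (forall z, complex.Re z <= x1 ->
     x1 - complex.Re q <= `|complex.Re z - complex.Re q| \/ 1 <= `|complex.Im z - complex.Im q| ->
     cabs (f z) <= C * (cabs (F z) / cabs (z - q') + (cabs (z - q') ^+ 2)^-1)) ->
  cintegral (fun y => f (x1 +i* y)) = 0.
Proof.
case: q q' => xq yq [xq' yq'] /= dF bF x12 xq1 xq'1 r0 C0' df bf Hf.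
have M0 : 0 <= M.
  by rewrite -lee_fin; apply: le_trans (bF x1 x12); exact: sqL2norm_ge0.
have bnd x y t : 0 < t -> x <= x1 -> x1 - xq <= `|x - xq| \/ 1 <= `|y - yq| ->
    cabs (f (x +i* y)) <= C * majorant F x t (xq' - x) yq' y.
  move=> t0 xx1 H; apply: (le_trans (Hf (x +i* y) xx1 H)); rewrite ler_wpM2l//.
  rewrite /majorant cabs_line /= -[x - xq']opprB sqrrN mulrDl mul1r addrA lerD2r.
  set D := (_ ^+ 2 + _ ^+ 2); set k := cabs (F _); set c := cabs _.
  have cD : c ^+ 2 = D by rewrite /c cabs_line /= -[x - xq']opprB sqrrN.
  have c0 : 0 < c by rewrite cabs_gt0 line_neq//= lt_eqF// (le_lt_trans xx1).
  rewrite -cD.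
  have H1 : 0 <= t^-1 * (t * k - c^-1) ^+ 2 by rewrite mulr_ge0 ?sqr_ge0// invr_ge0 ltW.
  have E : t^-1 * (t * k - c^-1) ^+ 2 = t * k ^+ 2 + t^-1 / c ^+ 2 - 2 * (k / c).
    by field; rewrite !gt_eqF.
  have kc : 0 <= k / c by rewrite divr_ge0// ?cabs_ge0.
  by rewrite E in H1; clear -H1 kc; lra.
have dFx x y : x <= x1 -> cdiff F (x +i* y).
  by move=> xx; apply: dF => /=; exact: le_lt_trans x12.
have dfx x y : x <= x1 -> (x, y) <> (xq, yq) -> cdiff f (x +i* y).
  move=> xx N; apply: df => //; apply/eqP => -[? ?]; subst; exact: N.
have maj x t : 0 < t -> x <= x1 ->
   [/\ measurable_fun setT (majorant F x t (xq' - x) yq'),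
     forall y, 0 <= majorant F x t (xq' - x) yq' y &
  (\int[mu]_y (majorant F x t (xq' - x) yq' y)%:E
     <= (t * M + (t^-1 + 1) * (pi / (xq' - x)))%:E)%E].
  move=> t0 xx; apply: integral_majorant => //.
  - by move=> y; exact: dFx.
  - by apply: bF; exact: le_lt_trans x12.
  - by rewrite subr_gt0 (le_lt_trans xx).
have mfx x : x <= x1 -> x != xq -> cmeasurable (fun y => f (x +i* y)).
  move=> xx xN; apply: cmeas_line => y; apply: dfx => // -[E _].
  by rewrite E eqxx in xN.
have ibd x t : 0 < t -> x <= x1 -> x1 - xq <= `|x - xq| ->
   (\int[mu]_y (cabs (f (x +i* y)))%:E <= (C * (t * M + (t^-1 + 1) * (pi / (xq' - x))))%:E)%E.
  move=> t0 xx xd; have [mm m0 mi] := maj x t t0 xx.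
  apply: (@le_trans _ _ (\int[mu]_y (C%:E * (majorant F x t (xq' - x) yq' y)%:E))%E).
    apply: ge0_le_integral => //.
    - by move=> y _; rewrite lee_fin cabs_ge0.
    - apply/measurable_EFinP; apply: measurable_cabs; apply: mfx => //.
      apply/eqP => E; move: xd; rewrite E subrr normr0 => xd; clear -xd xq1; lra.
    - by apply/measurable_EFinP; exact: measurable_funM.
    - by move=> y _; rewrite -EFinM lee_fin; apply: bnd => //; left.
  rewrite ge0_integralZl//=; last 2 first.
  - exact/measurable_EFinP.
  - by move=> y _; rewrite lee_fin.
  by rewrite EFinM lee_wpmul2l// lee_fin.
have int x : x <= x1 -> x1 - xq <= `|x - xq| -> cintegrable (fun y => f (x +i* y)).
  move=> xx xd; split; last by apply: le_lt_trans (ibd x 1 ltr01 xx xd) _; rewrite ltry.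
  apply: mfx => //; apply/eqP => E; move: xd; rewrite E subrr normr0 => xd; clear -xd xq1; lra.
have x1d : x1 - xq <= `|x1 - xq| by exact: ler_norm.
have shift x0 : x0 <= xq - (x1 - xq) ->
    cintegral (fun y => f (x1 +i* y)) = cintegral (fun y => f (x0 +i* y)).
  move=> x00; have x0q : x0 < xq by clear -x00 xq1; lra.
  have x01 : x0 <= x1 by clear -x0q xq1; lra.
  have x0d : x1 - xq <= `|x0 - xq| by rewrite ler_normr; apply/orP; right; clear -x00; lra.
  have bfx x y : `|x - xq| <= r -> `|y - yq| <= r -> (x, y) <> (xq, yq) -> cabs (f (x +i* y)) <= C0.
    move=> h1 h2 N; apply: bf => //; apply/eqP => -[? ?]; subst; exact: N.
  have tail x (u : R[i] -> R) : (forall z, `|u z| <= cabs z) -> x0 <= x <= x1 -> exists g : R -> R,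
     [/\ measurable_fun setT g, forall y, 0 <= g y,
         forall y, 1 <= `|y - yq| -> `|u (f (x +i* y))| <= g y &
         (\int[mu]_y (g y)%:E <= (C * (1 * M + (1^-1 + 1) * (pi / (xq' - x1))))%:E)%E].
    move=> uc /andP[_ xx]; have [mm m0 mi] := maj x 1 ltr01 xx.
    exists (fun y => C * majorant F x 1 (xq' - x) yq' y); split.
    - exact: measurable_funM.
    - by move=> y; rewrite mulr_ge0.
    - by move=> y yd; apply: le_trans (uc _) _; apply: bnd => //; right.
    under eq_integral do rewrite EFinM.
    rewrite ge0_integralZl//=; last 2 first.
    - exact/measurable_EFinP.
    - by move=> y _; rewrite lee_fin.
    rewrite EFinM lee_wpmul2l ?lee_fin//; apply: (le_trans mi); rewrite lee_fin lerD2l.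
    rewrite ler_wpM2l ?addr_ge0 ?invr_ge0// ler_pM2l ?pi_gt0// lef_pV2 ?posrE ?subr_gt0//.
      by rewrite lerD2l lerN2.
    by rewrite (le_lt_trans xx).
  have [I0 I1] := (int x0 x01 x0d, int x1 (lexx _) x1d).
  apply: complexP; rewrite !(cintegral_Re, cintegral_Im); apply/esym.
    apply: (@strip _ (fun x y => complex.Im (f (x +i* y))) (fun x y => complex.Re (f (x +i* y)))
      x0 x1 xq yq C0 r _ x0q xq1 r0) => //.
    - move=> x y /andP[_ xx] N; apply: cdiff_closed_Im; exact: dfx.
    - move=> x y h1 h2 N; have := bfx x y h1 h2 N => B.
      by split; [exact: le_trans (Im_le_cabs _) B|exact: le_trans (Re_le_cabs _) B].
    - by move=> x xx; apply: (@tail x (@complex.Im R)) => // z; exact: Im_le_cabs.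
    - exact: cintegrable_Re.
    - exact: cintegrable_Re.
  apply: oppr_inj; rewrite -mulN1r -[RHS]mulN1r -!RintegralZl//; try exact: cintegrable_Im.
  under eq_Rintegral do rewrite mulN1r.
  under [RHS]eq_Rintegral do rewrite mulN1r.
  apply: (@strip _ (fun x y => complex.Re (f (x +i* y))) (fun x y => - complex.Im (f (x +i* y)))
      x0 x1 xq yq C0 r _ x0q xq1 r0) => //.
  - move=> x y /andP[_ xx] N; apply: cdiff_closed_Re; exact: dfx.
  - move=> x y h1 h2 N; have := bfx x y h1 h2 N => B; rewrite normrN.
    by split; [exact: le_trans (Re_le_cabs _) B|exact: le_trans (Im_le_cabs _) B].
  - by move=> x xx; apply: (@tail x (@complex.Re R)) => // z; exact: Re_le_cabs.
  - by apply: eq_integrable (integrableN (cintegrable_Im I0)) => //.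
  - by apply: eq_integrable (integrableN (cintegrable_Im I1)) => //.
apply/eqP; rewrite -cabs_eq0; apply/eqP/le_anti; rewrite cabs_ge0 andbT.
apply/ler_addgt0Pr => e e0; rewrite add0r.
pose K := C + 1; have K0 : 0 < K by rewrite ltr_pwDr.
pose t := e / (8 * K * (M + 1)); have t0 : 0 < t.
  by rewrite divr_gt0// mulr_gt0 ?ltr_wpDl// mulr_gt0.
pose w := (t^-1 + 1) * pi; have w0 : 0 < w.
  by apply: mulr_gt0; [apply: addr_gt0 => //; rewrite invr_gt0|exact: pi_gt0].
pose d := 8 * K * w / e; have d0 : 0 < d.
  by rewrite divr_gt0// mulr_gt0// mulr_gt0.
pose x0 := Num.min (xq - (x1 - xq)) (xq' - d).
have h1 : x0 <= xq - (x1 - xq) by rewrite ge_min lexx.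
have h2 : d <= xq' - x0 by rewrite lerBrDl -lerBrDr ge_min lexx orbT.
have x01 : x0 <= x1 by clear -h1 xq1; lra.
have x0d : x1 - xq <= `|x0 - xq| by rewrite ler_normr; apply/orP; right; clear -h1; lra.
have x0N : x0 != xq by rewrite lt_eqF//; clear -h1 xq1; lra.
rewrite (shift x0 h1); apply: (le_trans (cabs_cintegral (mfx _ x01 x0N) (ibd x0 t t0 x01 x0d))).
have tM : C * (t * M) <= e / 8.
  apply: (@le_trans _ _ (K * (t * (M + 1)))).
    apply: ler_pM => //; [by rewrite mulr_ge0// ltW| |by rewrite ler_pM2l// lerDl].
    by rewrite lerDl.
  rewrite le_eqVlt; apply/orP; left; apply/eqP; rewrite /t; field.
  by rewrite !gt_eqF// ltr_wpDl.
have wd : C * ((t^-1 + 1) * (pi / (xq' - x0))) <= e / 8.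
  apply: (@le_trans _ _ (K * (w / d))).
    rewrite [X in C * X]mulrA -/w; apply: ler_pM => //.
    - by apply: divr_ge0; [exact: ltW|exact: le_trans (ltW d0) h2].
    - by rewrite lerDl.
    - by rewrite ler_pM2l// lef_pV2 ?posrE// (lt_le_trans d0).
  rewrite le_eqVlt; apply/orP; left; apply/eqP; rewrite /d; field.
  by rewrite !gt_eqF.
by rewrite mulrDr; clear -tM wd e0; lra.
Qed.

End Line.

Section Kernels.
Variable R : realType.
Local Notation mu := (@lebesgue_measure R).
Implicit Types (F f : R[i] -> R[i]) (z q p : R[i]) (g h : R -> R[i]) (x y a b t M C e : R).

(** The Cauchy kernel with pole [q], on the critical line. *)
Definition ck q y : R[i] := (critical_point y - q)^-1.

Lemma ck_neq0 q y : complex.Re q != 2^-1 -> critical_point y - q != 0.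
Proof. by move=> q2; apply: line_neq; rewrite eq_sym. Qed.

Lemma sqr_cabs_ck q y :
  cabs (ck q y) ^+ 2 = ((2^-1 - complex.Re q) ^+ 2 + (y - complex.Im q) ^+ 2)^-1.
Proof. by rewrite cabsV exprVn cabs_line. Qed.

Lemma cabs_line_ge x y q : `|x - complex.Re q| <= cabs (x +i* y - q).
Proof. by case: q => a b; exact: (Re_le_cabs ((x +i* y) - (a +i* b))). Qed.

Lemma cabs_ck_le q y d : 0 < d -> d <= `|2^-1 - complex.Re q| -> cabs (ck q y) <= d^-1.
Proof.
move=> d0 dq; rewrite cabsV lef_pV2 ?posrE ?(lt_le_trans d0)//.
  by apply: (le_trans dq); exact: cabs_line_ge.
by apply: (le_trans dq); exact: cabs_line_ge.
Qed.

Lemma cdiff_pole q z : z != q -> cdiff (fun w => (w - q)^-1) z.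
Proof.
move=> zq; apply: cdiffV; first by rewrite subr_eq0.
by apply: cdiffB; [exact: cdiff_id|exact: cdiff_cst].
Qed.

Lemma cdiff_line_pole q x y : x != complex.Re q -> cdiff (fun w => (w - q)^-1) (x +i* y).
Proof.
by move=> xq; apply: cdiff_pole; apply: contraNneq xq => <-.
Qed.

Lemma cmeas_ck q : complex.Re q != 2^-1 -> cmeasurable (ck q).
Proof.
move=> q2; apply: (@cmeas_line _ (fun w => (w - q)^-1)) => y.
by apply: cdiff_line_pole; rewrite eq_sym.
Qed.

Lemma sqL2norm_line_pole q x : x != complex.Re q ->
  sqL2norm (fun y => (x +i* y - q)^-1) = (pi / `|x - complex.Re q|)%:E.
Proof.
move=> xq; rewrite -(@integral_cauchyV _ `|x - complex.Re q| (complex.Im q)); last first.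
  by rewrite normr_gt0 subr_eq0.
apply: eq_integral => y _; congr EFin; rewrite -/(cabs _) cabsV exprVn cabs_line.
by rewrite real_normK ?num_real.
Qed.

Lemma L2_ck q : complex.Re q != 2^-1 -> L2 (ck q).
Proof.
move=> q2; apply: (L2_of_le (cmeas_ck q2)).
by rewrite (@sqL2norm_line_pole q 2^-1)// eq_sym.
Qed.

Lemma ck_mul p q y : complex.Re p != 2^-1 -> complex.Re q != 2^-1 -> p != q ->
  ck p y * ck q y = (p - q)^-1 * (ck p y - ck q y).
Proof.
move=> p2 q2 pq; have pq0 : p - q != 0 by rewrite subr_eq0.
rewrite /ck; have := ck_neq0 y p2; have := ck_neq0 y q2.
move: (critical_point y) => s sq sp.
by field; rewrite pq0 sq sp.
Qed.

(** [1 - q^*] is the mirror image of [q] in the critical line. *)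
Lemma ckJ q y : (ck q y)^* = - ck (1 - q^*) y.
Proof.
rewrite /ck fmorphV -invrN; congr (_ ^-1).
by case: q => a b; apply: complexP; rewrite /= ?opprK; field.
Qed.

(** The Poisson kernel of the half plane for the point at distance [a] from the
    critical line and of ordinate [b], up to the factor [pi / a]. *)
Definition wC a b y : R[i] := ((a ^+ 2 + (y - b) ^+ 2)^-1)%:C.

Lemma line_wC x a b y :
  (x +i* y - (x - a) +i* b)^-1 * (x +i* y - (x + a) +i* b)^-1 = - wC a b y.
Proof.
have -> : wC a b y = ((a ^+ 2 + (y - b) ^+ 2)%:C)^-1 by rewrite /wC fmorphV.
rewrite -invfM -invrN; congr (_ ^-1).
by apply: complexP => /=; ring.
Qed.

Lemma ck_wC a b y : ck ((2^-1 - a) +i* b) y * ck ((2^-1 + a) +i* b) y = - wC a b y.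
Proof. exact: line_wC. Qed.

Lemma ckB_wC a b y : a != 0 ->
  ck ((2^-1 - a) +i* b) y - ck ((2^-1 + a) +i* b) y = (2 * a)%:C * wC a b y.
Proof.
move=> a0; have := @ck_mul ((2^-1 - a) +i* b) ((2^-1 + a) +i* b) y.
rewrite ck_wC => H; rewrite -[wC a b y]opprK H.
- rewrite (_ : (2^-1 - a) +i* b - (2^-1 + a) +i* b = - (2 * a)%:C); last first.
    by apply: complexP => /=; ring.
  rewrite invrN mulNr opprK mulrA mulfV ?mul1r// fmorph_eq0 mulf_neq0//.
- by rewrite /= -subr_eq0 addrAC subrr add0r oppr_eq0.
- by rewrite /= -subr_eq0 addrAC subrr add0r.
- apply/eqP => /(congr1 (@complex.Re R)) /= E; move: a0; rewrite (_ : a = 0) ?eqxx//.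
  by clear -E; lra.
Qed.

Lemma wC_integral a b : 0 < a ->
  cintegrable (wC a b) /\ cintegral (wC a b) = (pi / a)%:C.
Proof.
move=> a0; have E y : cabs (wC a b y) = (a ^+ 2 + (y - b) ^+ 2)^-1.
  by rewrite cabs_real ger0_norm// invr_ge0 addr_ge0 ?sqr_ge0.
split.
  split; last by under eq_integral do rewrite E; rewrite integral_cauchyV// ltry.
  split; last exact: measurable_cst.
  by apply: continuous_measurable_fun; exact: continuous_cauchyV.
apply: complexP; rewrite ?cintegral_Re ?cintegral_Im /=.
  by rewrite /Rintegral integral_cauchyV.
by rewrite Rintegral_cst// mul0r.
Qed.

Lemma L2_wC a b : 0 < a -> L2 (wC a b).
Proof.
move=> a0; have e1 : complex.Re ((2^-1 - a) +i* b) != 2^-1.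
  by rewrite /= lt_eqF// ltrBlDr ltrDl.
have e2 : complex.Re ((2^-1 + a) +i* b) != 2^-1 by rewrite /= gt_eqF// ltrDl.
rewrite (_ : wC a b = fun y => - (ck ((2^-1 - a) +i* b) y * ck ((2^-1 + a) +i* b) y)); last first.
  by apply/funext => y; rewrite ck_wC opprK.
apply: L2N; apply: (@L2_mul_bounded _ (ck _) (ck _) a^-1).
- exact: cmeas_ck.
- by move=> y; apply: cabs_ck_le => //=; rewrite opprB addrCA subrr addr0 ler_norm.
- exact: L2_ck.
Qed.

End Kernels.

Section Representation.
Variable R : realType.
Local Notation mu := (@lebesgue_measure R).
Implicit Types (F f : R[i] -> R[i]) (z q p : R[i]) (g h : R -> R[i]) (x y a b t M C e : R).

Lemma local_bound f q : cdiff f q -> exists r C0, 0 < r /\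
  forall z, `|complex.Re z - complex.Re q| <= r -> `|complex.Im z - complex.Im q| <= r ->
    cabs (f z) <= C0.
Proof.
move=> df; have [d d0 D] := cdiff_cont df ltr01.
exists (d / 3), (cabs (f q) + 1); split; first by rewrite divr_gt0.
move=> z h1 h2; have zq : cabs (z - q) < d.
  apply: le_lt_trans (cabs_le _) _; rewrite ReD ReN ImD ImN; clear -h1 h2 d0; lra.
have -> : f z = f q + (f z - f q) by rewrite subrKC.
by apply: le_trans (cabsD _ _) _; rewrite lerD2l D.
Qed.

(** The integrand is holomorphic to the left of the line; the point [q] is an
    arbitrary regular point in the role of the possible singularity. *)
Lemma line_orth F M x1 q' : left_cdiff F -> left_bounded F M -> x1 < 2^-1 ->
  x1 < complex.Re q' ->
  cintegral (fun y => F (x1 +i* y) * (x1 +i* y - q')^-1) = 0.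
Proof.
move=> dF bF x12 xq'; pose q : R[i] := (x1 - 1) +i* 0.
have q1 : complex.Re q < x1 by rewrite /= ltrBlDr ltrDl.
have df z : complex.Re z <= x1 -> cdiff (fun w => F w * (w - q')^-1) z.
  move=> zx; apply: cdiffM; first by apply: dF; exact: le_lt_trans x12.
  by apply: cdiff_pole; apply: contraTneq xq' => <-; rewrite -leNgt.
have [r [C0 [r0 B]]] := local_bound (df q (ltW q1)).
apply: (@line_integral0 _ F (fun w => F w * (w - q')^-1) M q q' x1 r 1 C0) => //.
- by move=> z zx _; exact: df.
- by move=> z h1 h2 _; exact: B.
- move=> z zx _; rewrite mul1r cabsM cabsV lerDl invr_ge0 sqr_ge0//.
Qed.

(** Subtracting [F q] makes [q] a removable singularity of [(F - F q) / ((z -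
    q) (z - q'))]; on the line the denominator is the Poisson kernel, since
    [q'] is the mirror image of [q]. *)
Lemma line_poisson F M x1 a b : left_cdiff F -> left_bounded F M -> x1 < 2^-1 -> 0 < a ->
  cintegral (fun y => F (x1 +i* y) * wC a b y)
    = (pi / a)%:C * F ((x1 - a) +i* b).
Proof.
move=> dF bF x12 a0; pose q : R[i] := (x1 - a) +i* b; pose q' : R[i] := (x1 + a) +i* b.
have q1 : complex.Re q < x1 by rewrite /= ltrBlDr ltrDl.
have q'1 : x1 < complex.Re q' by rewrite /= ltrDl.
pose f z := (F z - F q) * ((z - q)^-1 * (z - q')^-1).
have dFq z : complex.Re z <= x1 -> cdiff F z by move=> zx; apply: dF; exact: le_lt_trans x12.
have zq' z : complex.Re z <= x1 -> z != q'.
  by move=> zx; apply: contraTneq q'1 => <-; rewrite -leNgt.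
have I0 : cintegral (fun y => f (x1 +i* y)) = 0.
  have [C [d [d0 D]]] := cdiff_slope (dFq q (ltW q1)).
  have [r [C0 [r0 B]]] := local_bound (cdiff_pole (zq' q (ltW q1))).
  pose m := Num.min a 1; have m0 : 0 < m by rewrite lt_min a0 ltr01.
  pose k := 1 + 2 * a / m.
  have k0 : 0 < k by apply: addr_gt0 => //; apply: divr_gt0 => //; exact: mulr_gt0.
  apply: (@line_integral0 _ F f M q q' x1 (Num.min r (d / 3)) (k * (a^-1 + cabs (F q)))
     (`|C| * `|C0|)) => //.
  - by rewrite lt_min r0 divr_gt0.
  - by apply: mulr_ge0; [exact: ltW|apply: addr_ge0; [rewrite invr_ge0 ltW|exact: cabs_ge0]].
  - move=> z zx zq; apply: cdiffM; first by apply: cdiffB; [exact: dFq|exact: cdiff_cst].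
    by apply: cdiffM; apply: cdiff_pole => //; exact: zq'.
  - move=> z; rewrite !le_min => /andP[h1 h1'] /andP[h2 h2'] zq.
    have zd : cabs (z - q) < d.
      apply: le_lt_trans (cabs_le _) _; rewrite ReD ReN ImD ImN; clear -h1' h2' d0; lra.
    have zq0 : 0 < cabs (z - q) by rewrite cabs_gt0 subr_eq0.
    rewrite /f !cabsM mulrA cabsV; apply: ler_pM; rewrite ?mulr_ge0 ?invr_ge0 ?cabs_ge0//.
      rewrite ler_pdivrMr//; apply: (le_trans (D z zd)).
      by rewrite ler_wpM2r ?cabs_ge0// ler_norm.
    by apply: le_trans (B z h1 h2) _; exact: ler_norm.
  - move=> z zx H.
    have mz : m <= cabs (z - q).
      case: H => H.
        apply: le_trans (Re_le_cabs _); rewrite ReD ReN; apply: le_trans H.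
        by rewrite /m ge_min /= opprB addrCA subrr addr0 lexx.
      by apply: le_trans (Im_le_cabs _); rewrite ImD ImN; apply: le_trans H; rewrite /m ge_min lexx orbT.
    have z0 : 0 < cabs (z - q) by exact: lt_le_trans mz.
    have az : a <= cabs (z - q').
      apply: le_trans (Re_le_cabs _); rewrite ReD ReN /= ler_normr; apply/orP; right.
      clear -zx; lra.
    have z'0 : 0 < cabs (z - q') by exact: lt_le_trans az.
    have kz : cabs (z - q') <= k * cabs (z - q).
      have -> : z - q' = (z - q) - (2 * a)%:C.
        by apply: complexP; case: (z) => zr zi /=; ring.
      apply: le_trans (cabsB _ _) _; rewrite cabs_real gtr0_norm ?mulr_gt0//.
      have -> : k * cabs (z - q) = cabs (z - q) + 2 * a * (cabs (z - q) / m).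
        by rewrite /k; field; rewrite gt_eqF.
      by rewrite lerD2l ler_pMr ?mulr_gt0// ler_pdivlMr// mul1r.
    rewrite /f !cabsM !cabsV.
    set u := cabs (z - q) in z0 kz *; set v := cabs (z - q') in az z'0 kz *.
    have uv : u^-1 <= k / v by rewrite ler_pdivlMr// mulrC ler_pdivrMr.
    have va : v^-1 <= a^-1 by rewrite lef_pV2.
    have vi0 : 0 < v^-1 by rewrite invr_gt0.
    set A := cabs (F z); set B' := cabs (F q).
    have A0 : 0 <= A by exact: cabs_ge0. have B0 : 0 <= B' by exact: cabs_ge0.
    apply: (@le_trans _ _ ((A + B') * (k / v / v))).
      apply: ler_pM; rewrite ?cabs_ge0 ?cabsB//.
        by rewrite mulr_ge0// ?invr_ge0 ltW.
      by rewrite ler_pM2r.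
    have -> : (A + B') * (k / v / v) = k * (A / v) * v^-1 + k * B' * v^-1 ^+ 2.
      by field; rewrite gt_eqF.
    rewrite -exprVn mulrDr; set s := v^-1 in va vi0 *.
    have c1 : 0 <= k * (A * s) by rewrite !mulr_ge0// ltW.
    have c2 : k * (A * s) * s <= k * (A * s) * a^-1 by rewrite ler_wpM2l.
    have c3 : 0 <= k * a^-1 * s ^+ 2 by rewrite !mulr_ge0 ?sqr_ge0 ?invr_ge0// ltW.
    have c4 : 0 <= k * B' * (A * s) by rewrite !mulr_ge0// ltW.
    have -> : k * (a^-1 + B') * (A * s) + k * (a^-1 + B') * s ^+ 2 =
       (k * (A * s) * a^-1 + k * B' * s ^+ 2) + (k * a^-1 * s ^+ 2 + k * B' * (A * s)) by ring.
    by clear -c2 c3 c4; lra.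
have x1L : L2 (fun y => F (x1 +i* y)).
  apply: (@L2_of_le _ _ M); last exact: bF.
  by apply: cmeas_line => y; exact: dFq.
have [wI wE] := wC_integral b a0.
have FI : cintegrable (fun y => F (x1 +i* y) * wC a b y).
  by apply: cintegrable_mul => //; exact: L2_wC.
move: I0; rewrite (_ : (fun y => _) = fun y => F q * wC a b y - F (x1 +i* y) * wC a b y); last first.
  by apply/funext => y; rewrite /f line_wC mulrN -mulNr opprB mulrBl.
rewrite cintegralB//; last exact: cintegrableZ.
by rewrite cintegralZ// wE => /eqP; rewrite subr_eq0 mulrC => /eqP.
Qed.

End Representation.

Section Boundary.
Variable R : realType.
Local Notation mu := (@lebesgue_measure R).
Implicit Types (F f : R[i] -> R[i]) (z q p : R[i]) (g h : R -> R[i]) (x y a b t M C e : R).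

Lemma cvge0P (T : Type) (G : set_system T) (FG : Filter G) (u : T -> \bar R) :
  (forall i, 0 <= u i)%E ->
  u i @[i --> G] --> 0%E <-> forall e, 0 < e -> \forall i \near G, (u i <= e%:E)%E.
Proof.
move=> u0; split.
  move=> /fine_cvgP[fu /cvgrPdist_le cu] e e0; near=> x.
  have fx : u x \is a fin_num by near: x; exact: fu.
  have : `|0 - fine (u x)| <= e by near: x; exact: cu.
  by rewrite sub0r normrN ger0_norm ?fine_ge0// -lee_fin fineK.
move=> H; apply/fine_cvgP; split.
  have := H 1 ltr01; apply: filterS => x ux.
  by rewrite ge0_fin_numE// (le_lt_trans ux)// ltry.
apply/cvgrPdist_le => e e0; have := H e e0; apply: filterS => x ux.
rewrite /= sub0r normrN ger0_norm ?fine_ge0// -lee_fin fineK//.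
by rewrite ge0_fin_numE// (le_lt_trans ux)// ltry.
Unshelve. all: by end_near. Qed.

Lemma near_leftP a (P : R -> Prop) : (\forall x \near a^'-, P x) <->
  exists2 d, 0 < d & forall x, a - d < x -> x < a -> P x.
Proof.
split.
  move=> /nbhs_ballP[/= d d0 D]; exists d => // x ax xa; apply: D => //=.
  by rewrite /ball /= gtr0_norm ?subr_gt0// ltrBlDr -ltrBlDl.
move=> [d d0 D]; apply/nbhs_ballP; exists d => //= x /= + xa.
by rewrite /ball /= gtr0_norm ?subr_gt0// => ax; apply: D => //; rewrite ltrBlDr -ltrBlDl.
Qed.

Lemma boundaryP F h : boundary_value F h <-> forall e, 0 < e ->
  exists2 d, 0 < d & forall x, 2^-1 - d < x -> x < 2^-1 ->
    (sqL2norm (fun y => F (x +i* y) - h y)%R <= e%:E)%E.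
Proof.
rewrite /boundary_value cvge0P; last by move=> x; exact: sqL2norm_ge0.
by split=> H e e0; apply/near_leftP; exact: H.
Qed.

Lemma hardyP F : hardy_function F <-> left_cdiff F /\ exists M, left_bounded F M.
Proof.
split=> -[H1 H2]; split => //.
  by move=> z zz; apply/cdiffP; exact: H1.
by move=> z zz; apply/cdiffP; exact: H1.
Qed.

Lemma L2_line F M x : left_cdiff F -> left_bounded F M -> x < 2^-1 ->
  L2 (fun y => F (x +i* y)).
Proof.
move=> dF bF x2; apply: (@L2_of_le _ _ M); last exact: bF.
by apply: cmeas_line => y; exact: dF.
Qed.

(** Representations on vertical lines pass to the boundary: it is the function
    that is translated, so that the kernel stays fixed. *)
Lemma boundary_limit F h k z c : left_cdiff F -> (exists M, left_bounded F M) -> L2 h ->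
  boundary_value F h -> L2 k -> complex.Re z < 2^-1 ->
  (forall e, 0 < e ->
     cintegral (fun y => F ((2^-1 - e) +i* y) * k y) = c * F (z - e%:C)) ->
  cintegral (fun y => h y * k y) = c * F z.
Proof.
move=> dF [M bF] Lh /boundaryP bv Lk z2 H; apply: cintegral_mul_closed => // e e0.
have [d d0 D] := bv e e0.
have e1 : 0 < e / (cabs c + 1) by rewrite divr_gt0// ltr_wpDl// cabs_ge0.
have [d1 d10 D1] := cdiff_cont (dF z z2) e1.
pose m := Num.min (d / 2) (d1 / 2).
have m0 : 0 < m by rewrite lt_min !divr_gt0.
have md : m < d.
  by apply: (@le_lt_trans _ _ (d / 2)); [rewrite ge_min lexx|rewrite ltr_pdivrMr// ltr_pMr// ltrDl].
have md1 : m < d1.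
  by apply: (@le_lt_trans _ _ (d1 / 2)); [rewrite ge_min lexx orbT|rewrite ltr_pdivrMr// ltr_pMr// ltrDl].
have x2 : 2^-1 - m < 2^-1 by rewrite ltrBlDr ltrDl.
exists (fun y => F ((2^-1 - m) +i* y)), (c * F (z - m%:C)); split.
- exact: L2_line dF bF x2.
- by rewrite sqL2norm_swap; apply: D => //; rewrite ltrD2l ltrN2.
- exact: H.
- rewrite -mulrBr cabsM.
  have : cabs (F (z - m%:C) - F z) <= e / (cabs c + 1).
    by apply: D1; rewrite addrAC subrr add0r cabsN cabs_real gtr0_norm.
  rewrite ler_pdivlMr ?ltr_wpDl ?cabs_ge0//; apply: le_trans.
  by rewrite mulrC ler_wpM2l ?cabs_ge0// lerDl.
Qed.

Lemma boundary_orth F h q : left_cdiff F -> (exists M, left_bounded F M) -> L2 h ->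
  boundary_value F h -> 2^-1 < complex.Re q -> cintegral (fun y => h y * ck q y) = 0.
Proof.
move=> dF bF Lh bv q2; rewrite -(mul0r (F 0)).
apply: (@boundary_limit F h (ck q) 0 0) => //.
- by apply: L2_ck; rewrite gt_eqF.
- by rewrite /= invr_gt0.
- move=> e e0; rewrite mul0r; have [M bM] := bF.
  have x2 : 2^-1 - e < 2^-1 by rewrite ltrBlDr ltrDl.
  have := @line_orth R F M (2^-1 - e) (q - e%:C) dF bM x2.
  rewrite ReD ReN /= ltrD2r => /(_ q2) <-; congr cintegral; apply/funext => y.
  by rewrite /ck; congr (_ * _^-1); case: q {q2} => qa qb; apply: complexP => /=; ring.
Qed.

Lemma boundary_poisson F h a b : left_cdiff F -> (exists M, left_bounded F M) -> L2 h ->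
  boundary_value F h -> 0 < a ->
  cintegral (fun y => h y * wC a b y) = (pi / a)%:C * F ((2^-1 - a) +i* b).
Proof.
move=> dF bF Lh bv a0; apply: boundary_limit => //.
- exact: L2_wC.
- by rewrite /= ltrBlDr ltrDl.
- move=> e e0; have [M bM] := bF.
  have x2 : 2^-1 - e < 2^-1 by rewrite ltrBlDr ltrDl.
  rewrite (line_poisson b dF bM x2 a0); congr (_ * F _).
  by apply: complexP => /=; ring.
Qed.

(** The boundary values annihilated by every Cauchy kernel with pole on the
    right; together with the convergence of the Cauchy integral at the boundary
    this characterizes H^2, see [H2P]. *)
Definition orth_ck h := forall q, 2^-1 < complex.Re q -> cintegral (fun y => h y * ck q y) = 0.

(** The Cauchy kernels of two mirror points differ by a multiple of the Poisson
    kernel, and [h] annihilates the one on the right. *)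
Lemma poisson_cauchy h a b : L2 h -> orth_ck h -> 0 < a ->
  cintegral (fun y => h y * ck ((2^-1 - a) +i* b) y) =
    (2 * a)%:C * cintegral (fun y => h y * wC a b y).
Proof.
move=> Lh vh a0; have q2 : 2^-1 < complex.Re ((2^-1 + a) +i* b) by rewrite /= ltrDl.
have p2 : complex.Re ((2^-1 - a) +i* b) != 2^-1 by rewrite /= lt_eqF// ltrBlDr ltrDl.
have Lp := L2_ck p2; have Lq : L2 (ck ((2^-1 + a) +i* b)) by apply: L2_ck; rewrite gt_eqF.
have Lw := L2_wC b a0.
rewrite -[LHS]subr0 -(vh _ q2) -cintegralB; [|exact: cintegrable_mul..].
rewrite -cintegralZ; last exact: cintegrable_mul.
congr cintegral; apply/funext => y; rewrite -mulrBr ckB_wC ?gt_eqF//.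
by rewrite mulrCA.
Qed.

Definition cauchy h z : R[i] := ((2 * pi)^-1)%:C * cintegral (fun y => h y * ck z y).

Lemma pi_neq0 : (pi : R) != 0. Proof. by rewrite gt_eqF// pi_gt0. Qed.

Lemma left_point z : z = (2^-1 - (2^-1 - complex.Re z)) +i* complex.Im z.
Proof. by apply: complexP => //=; ring. Qed.

Lemma cauchy_poisson h z : L2 h -> orth_ck h -> complex.Re z < 2^-1 ->
  let a := 2^-1 - complex.Re z in
  cauchy h z = (a / pi)%:C * cintegral (fun y => h y * wC a (complex.Im z) y).
Proof.
move=> Lh vh z2 a; have a0 : 0 < a by rewrite subr_gt0.
rewrite /cauchy {1}(left_point z) poisson_cauchy// mulrA -rmorphM /=; congr (_%:C * _).
by rewrite -/a invfM mulrACA mulVf// mul1r mulrC.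
Qed.

(** Both sides are the Poisson integral of [h]; hence the holomorphic extension
    of a boundary value is unique. *)
Lemma boundary_cauchy F h z : left_cdiff F -> (exists M, left_bounded F M) -> L2 h ->
  boundary_value F h -> complex.Re z < 2^-1 -> cauchy h z = F z.
Proof.
move=> dF bF Lh bv z2; have a0 : 0 < 2^-1 - complex.Re z by rewrite subr_gt0.
rewrite cauchy_poisson//; last by move=> q; exact: boundary_orth dF bF Lh bv.
rewrite (boundary_poisson _ dF bF Lh bv a0) -left_point mulrA -rmorphM /=.
by rewrite mulrA divfK ?pi_neq0// divff ?mul1r// gt_eqF.
Qed.

Lemma cauchyB g h z : L2 g -> L2 h -> complex.Re z < 2^-1 ->
  cauchy (fun y => g y - h y) z = cauchy g z - cauchy h z.
Proof.
move=> Lg Lh z2; have Lz : L2 (ck z) by apply: L2_ck; rewrite lt_eqF.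
rewrite /cauchy -mulrBr -cintegralB; [|exact: cintegrable_mul..].
by congr (_ * cintegral _); apply/funext => y; rewrite mulrBl.
Qed.

(** Differentiation under the integral sign: two uses of the resolvent identity
    for the kernels bound the second-order error, the kernels near [z] being
    uniformly bounded on the line. *)
Lemma cdiff_cauchy h z : L2 h -> complex.Re z < 2^-1 -> cdiff (cauchy h) z.
Proof.
move=> Lh z2; apply: cdiffM; first exact: cdiff_cst.
pose d := 2^-1 - complex.Re z; have d0 : 0 < d by rewrite subr_gt0.
have zN : complex.Re z != 2^-1 by rewrite lt_eqF.
have Lz := L2_ck zN.
have [A A0 HA] := L2_bound Lh; have [B B0 HB] := L2_bound Lz.
have bz y : cabs (ck z y) <= d^-1 by apply: cabs_ck_le => //; exact: ler_norm.
apply: (@cdiff_quad _ _ _ (cintegral (fun y => h y * (ck z y * ck z y)))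
   (2 * ((d^-1 * (2 / d)) * (1 * A + 1^-1 * B))) (d / 2)); first by rewrite divr_gt0.
move=> w wd.
have wdR : `|complex.Re w| < d / 2 by exact: le_lt_trans (Re_le_cabs _) wd.
have zwd : d / 2 <= 2^-1 - complex.Re (z + w).
  move: wdR; rewrite ReD ltr_norml /d => /andP[_]; clear; lra.
have zwN : complex.Re (z + w) != 2^-1.
  by rewrite lt_eqF// -subr_gt0 (lt_le_trans _ zwd)// divr_gt0.
have Lzw := L2_ck zwN.
have bzw y : cabs (ck (z + w) y) <= 2 / d.
  rewrite -invf_div; apply: cabs_ck_le; rewrite ?divr_gt0//.
  by apply: (le_trans zwd); exact: ler_norm.
have Lzz : L2 (fun y => ck z y * ck z y) by exact: (L2_mul_bounded Lz.1 bz Lz).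
have Lk : L2 (fun y => ck z y * (ck (z + w) y * ck z y)).
  by apply: (L2_mul_bounded Lz.1 bz); exact: (L2_mul_bounded Lzw.1 bzw Lz).
rewrite (mulrC _ w) -cintegralZ; last exact: cintegrable_mul.
rewrite -!cintegralB; first last; do ?[exact: cintegrable_mul|apply: cintegrableB|apply: cintegrableZ].
rewrite (_ : (fun y => _) = fun y => w ^+ 2 * (h y * (ck z y * (ck (z + w) y * ck z y)))); last first.
  apply/funext => y; rewrite /ck.
  have := ck_neq0 y zN; have := ck_neq0 y zwN.
  move: (critical_point y) (h y) => s u sq sp.
  have sq' : s - z - w != 0 by rewrite -addrA -opprD.
  by field; rewrite ?sp ?sq ?sq'.
rewrite cintegralZ; last exact: cintegrable_mul.
rewrite cabsM cabsX mulrC ler_wpM2r ?sqr_ge0//; apply: cabs_cintegral.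
  by apply: cmeasM; [case: Lh|case: Lk].
have bb : 0 <= d^-1 * (2 / d) by rewrite !mulr_ge0 ?invr_ge0 ?ltW.
apply: (@le_trans _ _ (\int[mu]_y ((d^-1 * (2 / d))%:E * (cabs (h y * ck z y))%:E))%E).
  apply: ge0_le_integral => //.
  - by move=> y _; rewrite lee_fin cabs_ge0.
  - by apply/measurable_EFinP; apply: measurable_cabs; apply: cmeasM; [case: Lh|case: Lk].
  - apply/measurable_EFinP; apply: measurable_funM => //.
    by apply: measurable_cabs; apply: cmeasM; [case: Lh|case: Lz].
  - move=> y _; rewrite -EFinM lee_fin !cabsM.
    rewrite (_ : cabs (h y) * _ = (cabs (ck z y) * cabs (ck (z + w) y)) * (cabs (h y) * cabs (ck z y))); last by ring.
    rewrite ler_wpM2r ?mulr_ge0 ?cabs_ge0//; apply: ler_pM => //; exact: cabs_ge0.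
rewrite ge0_integralZl//=; last 2 first.
- by apply/measurable_EFinP; apply: measurable_cabs; apply: cmeasM; [case: Lh|case: Lz].
- by move=> y _; rewrite lee_fin cabs_ge0.
rewrite [leRHS]EFinM lee_wpmul2l ?lee_fin//.
by apply: integral_cabs_mul => //; [case: Lh|case: Lz].
Qed.

End Boundary.

(** * The Hardy space is a closed subspace *)

Section Contraction.
Variable R : realType.
Local Notation mu := (@lebesgue_measure R).
Implicit Types (F f : R[i] -> R[i]) (z q p : R[i]) (g h : R -> R[i]) (x y a b t M C e : R).

(** Integrate [|g - m|^2 >= 0] against the probability density [k], where [m]
    is the mean of [g]. *)
Lemma jensen_sqr g (k : R -> R) (K : R) : L2 g -> measurable_fun setT k ->
  (forall y, 0 <= k y <= K) -> (\int[mu]_y (k y)%:E = 1)%E ->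
  cintegrable (fun y => g y * (k y)%:C) ->
  ((cabs (cintegral (fun y => g y * (k y)%:C)) ^+ 2)%:E
     <= \int[mu]_y (k y * cabs (g y) ^+ 2)%:E)%E.
Proof.
move=> [mg Hg] mk k0 k1 Ik; set m := cintegral _.
have mkg : measurable_fun setT (fun y => k y * cabs (g y) ^+ 2).
  by apply: measurable_funM => //; exact: measurable_cabs2.
have ik : mu.-integrable setT (EFin \o k).
  apply/integrableP; split; first exact/measurable_EFinP.
  have -> : (\int[mu]_y `|(EFin \o k) y| = \int[mu]_y (k y)%:E)%E.
    by apply: eq_integral => y _ /=; rewrite ger0_norm//; have /andP[] := k0 y.
  by rewrite k1 ltry.
have ikg : mu.-integrable setT (EFin \o (fun y => k y * cabs (g y) ^+ 2)).
  apply/integrableP; split; first exact/measurable_EFinP.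
  have K0 : 0 <= K by have /andP[h1 h2] := k0 0; exact: le_trans h2.
  apply: (@le_lt_trans _ _ (K%:E * sqL2norm g)%E); last by rewrite lte_mul_pinfty ?lee_fin.
  rewrite -integral_scale_cabs2//; apply: ge0_le_integral => //.
  - by apply: measurableT_comp => //; exact/measurable_EFinP.
  - by apply/measurable_EFinP; apply: measurable_funM => //; exact: measurable_cabs2.
  - move=> y _; rewrite lee_fin; have /andP[h1 h2] := k0 y.
    rewrite ger0_norm; last by rewrite mulr_ge0 ?sqr_ge0.
    by apply: ler_wpM2r => //; exact: sqr_ge0.
have iR := cintegrable_Re (cintegrableZ m^* Ik).
have E1 : \int[mu]_y complex.Re (m^* * (g y * (k y)%:C)) = cabs m ^+ 2.
  rewrite -cintegral_Re cintegralZ// -/m sqr_cabs; case: (m) => u v /=; ring.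
have E2 : \int[mu]_y k y = 1 by rewrite /Rintegral k1.
have E3 : \int[mu]_y (2 * complex.Re (m^* * (g y * (k y)%:C)) - cabs m ^+ 2 * k y) = cabs m ^+ 2.
  rewrite RintegralB//; last 2 first.
  - exact: (integrable_scale 2 iR).
  - exact: (integrable_scale _ ik).
  rewrite !RintegralZl// E1 E2; ring.
have : cabs m ^+ 2 <= \int[mu]_y (k y * cabs (g y) ^+ 2).
  rewrite -E3; apply: le_Rintegral => //.
    by apply: (integrableB _ (integrable_scale _ iR) (integrable_scale _ ik)).
  move=> y _; have /andP[h1 _] := k0 y.
  rewrite !sqr_cabs; case: (m) => u v; case: (g y) => c d /=; rewrite -subr_ge0.
  rewrite (_ : _ - _ = k y * ((c - u) ^+ 2 + (d - v) ^+ 2)); last by ring.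
  by rewrite mulr_ge0// addr_ge0// sqr_ge0.
by rewrite -lee_fin /Rintegral fineK// integrable_fin_num.
Qed.

Lemma cauchy_line_cmeas h x : L2 h -> x < 2^-1 -> cmeasurable (fun y => cauchy h (x +i* y)).
Proof. by move=> Lh x2; apply: cmeas_line => y; exact: cdiff_cauchy. Qed.

(** The Poisson integral is an average of translates of [g]: Jensen's
    inequality at each point, then Tonelli. *)
Lemma cauchy_contraction g x : L2 g -> orth_ck g -> x < 2^-1 ->
  (sqL2norm (fun b => cauchy g (x +i* b)) <= sqL2norm g)%E.
Proof.
move=> Lg vg x2; pose a := 2^-1 - x; have a0 : 0 < a by rewrite subr_gt0.
have p0 : 0 < a / pi by rewrite divr_gt0// pi_gt0.
pose k b y := a / pi * (a ^+ 2 + (y - b) ^+ 2)^-1.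
have k0 b y : 0 <= k b y <= a / pi * a^-2.
  apply/andP; split.
    by rewrite /k; apply: mulr_ge0; [exact: ltW|rewrite invr_ge0 addr_ge0 ?sqr_ge0].
  by rewrite /k ler_pM2l// lef_pV2 ?posrE ?sqrD_gt0 ?exprn_gt0// lerDl sqr_ge0.
have mk b : measurable_fun setT (k b).
  by apply: measurable_funM => //; apply: continuous_measurable_fun; exact: continuous_cauchyV.
have k1 b : (\int[mu]_y (k b y)%:E = 1)%E.
  under eq_integral do rewrite EFinM.
  rewrite ge0_integralZl//=.
  - rewrite integral_cauchyV// -EFinM; congr EFin.
    by rewrite mulrA divfK ?pi_neq0// divff// gt_eqF.
  - by apply/measurable_EFinP; apply: continuous_measurable_fun; exact: continuous_cauchyV.
  - by move=> y _; rewrite lee_fin invr_ge0 addr_ge0 ?sqr_ge0.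
  - by rewrite lee_fin ltW.
have kE b y : g y * (k b y)%:C = (a / pi)%:C * (g y * wC a b y).
  by rewrite /k rmorphM /= mulrCA.
have Igw b : cintegrable (fun y => g y * wC a b y).
  by apply: cintegrable_mul => //; exact: L2_wC.
have Ik b : cintegrable (fun y => g y * (k b y)%:C).
  by under eq_fun do rewrite kE; exact: cintegrableZ.
have mE b : cauchy g (x +i* b) = cintegral (fun y => g y * (k b y)%:C).
  rewrite cauchy_poisson//= -/a -cintegralZ//.
  by congr cintegral; apply/funext => y; rewrite kE.
pose f (p : R * R) : \bar R := (k p.1 p.2 * cabs (g p.2) ^+ 2)%:E.
have mf : measurable_fun setT f.
  apply/measurable_EFinP; apply: measurable_funM.
    apply: (@measurable_fun_joint _ k) => // y.
    have -> : k^~ y = fun b => a / pi * (a ^+ 2 + (b - y) ^+ 2)^-1.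
      by apply/funext => b; rewrite /k -[y - b]opprB sqrrN.
    move=> b; apply: cvgM; first exact: cvg_cst.
    exact: (@continuous_cauchyV R a y a0 b).
  exact: (measurableT_comp (measurable_cabs2 Lg.1) measurable_snd).
have f0 (u : R * R) : (0 <= f u)%E.
  by rewrite lee_fin mulr_ge0 ?sqr_ge0//; have /andP[] := k0 u.1 u.2.
apply: (@le_trans _ _ (\int[mu]_b \int[mu]_y f (b, y))%E).
  apply: ge0_le_integral => //.
  - by move=> b _; rewrite lee_fin sqr_ge0.
  - by apply/measurable_EFinP; exact: (measurable_cabs2 (cauchy_line_cmeas Lg x2)).
  - exact: (@measurable_fun_fubini_tonelli_F _ _ _ _ R mu f mf f0).
  - move=> b _; rewrite -/(cabs _) mE; exact: (@jensen_sqr g (k b) _ Lg (mk b) (k0 b) (k1 b) (Ik b)).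
rewrite (@fubini_tonelli _ _ _ _ R mu mu f mf f0) le_eqVlt; apply/orP; left; apply/eqP.
apply: eq_integral => y _; rewrite /f /=.
under eq_integral do rewrite mulrC EFinM.
rewrite ge0_integralZl//=.
- rewrite (_ : (\int[mu]_b _)%E = 1%E) ?mule1// -(k1 y); apply: eq_integral => b _.
  by rewrite /k -[y - b]opprB sqrrN.
- apply/measurable_EFinP; have kS : k^~ y = k y by apply/funext => b; rewrite /k -[y - b]opprB sqrrN.
  by rewrite -[X in measurable_fun _ X]/(k^~ y) kS; exact: mk.
- by move=> b _; rewrite lee_fin; have /andP[] := k0 b y.
- by rewrite lee_fin sqr_ge0.
Qed.

Lemma hardy_cauchy g : L2 g -> orth_ck g -> hardy_function (cauchy g).
Proof.
move=> Lg vg; apply/hardyP; split; first by move=> z z2; exact: cdiff_cauchy.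
have [A _ HA] := L2_bound Lg; exists A => x x2.
by apply: le_trans HA; exact: cauchy_contraction.
Qed.

Lemma H2_L2 h : H2 h -> L2 h. Proof. by case. Qed.

Lemma H2_orth h : H2 h -> orth_ck h.
Proof. by move=> [Lh [F /hardyP[dF bF] bv]] q q2; exact: boundary_orth bv q2. Qed.

Lemma H2_boundary h : H2 h -> boundary_value (cauchy h) h.
Proof.
move=> [Lh [F /hardyP[dF bF] /boundaryP bv]]; apply/boundaryP => e e0.
have [d d0 D] := bv e e0; exists d => // x x1 x2.
have := D x x1 x2; rewrite (_ : (fun y => F (x +i* y) - h y) = fun y => cauchy h (x +i* y) - h y)//.
by apply/funext => y; rewrite (boundary_cauchy dF bF Lh _ _)//; exact/boundaryP.
Qed.

(** H^2 described by the boundary value alone, the holomorphic extension being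
    its Cauchy integral. *)
Lemma H2P h : H2 h <-> [/\ L2 h, orth_ck h & boundary_value (cauchy h) h].
Proof.
split=> [Hh|[Lh vh bv]].
  by split; [exact: H2_L2|exact: H2_orth|exact: H2_boundary].
by split => //; exists (cauchy h) => //; exact: hardy_cauchy.
Qed.

Lemma orth_ckB g h : L2 g -> L2 h -> orth_ck g -> orth_ck h -> orth_ck (fun y => g y - h y).
Proof.
move=> Lg Lh vg vh q q2; have Lq : L2 (ck q) by apply: L2_ck; rewrite gt_eqF.
rewrite (_ : (fun y => _) = fun y => g y * ck q y - h y * ck q y); last first.
  by apply/funext => y; rewrite mulrBl.
by rewrite cintegralB ?vg ?vh ?subrr//; exact: cintegrable_mul.
Qed.

(** If [h] is close to [g], so are their Cauchy integrals on all vertical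
    lines, by [cauchy_contraction]; the boundary behaviour of the former is
    inherited by the latter. *)
Lemma H2_closed g : L2 g ->
  (forall e, 0 < e -> exists2 h, H2 h & (sqL2norm (fun y => g y - h y)%R <= e%:E)%E) ->
  H2 g.
Proof.
move=> Lg H; have vg : orth_ck g.
  move=> q q2; apply: cintegral_mul_closed => //; first by apply: L2_ck; rewrite gt_eqF.
  move=> e e0; have [h Hh he] := H e e0; exists h, 0; split => //; first exact: H2_L2.
    exact: H2_orth.
  by rewrite subrr cabs0 ltW.
apply/H2P; split => //; apply/boundaryP => e e0.
have e160 : 0 < e / 16 by rewrite divr_gt0.
have [h Hh he] := H _ e160; have [Lh vh /boundaryP bh] := (H2P h).1 Hh.
have [d d0 D] := bh _ e160; exists d => // x x1 x2.
have Lgh := L2B Lg Lh; have vgh := orth_ckB Lg Lh vg vh.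
have m1 := cauchy_line_cmeas Lgh x2; have m2 := cauchy_line_cmeas Lh x2.
have m3 : cmeasurable (fun y => cauchy h (x +i* y) - h y) by apply: cmeasB => //; exact: Lh.1.
have m4 : cmeasurable (fun y => h y - g y) by apply: cmeasB; [exact: Lh.1|exact: Lg.1].
rewrite (_ : (fun y => _) = fun y => cauchy (fun y => g y - h y) (x +i* y) +
   ((cauchy h (x +i* y) - h y) + (h y - g y))); last first.
  by apply/funext => y; rewrite cauchyB//; ring.
apply: (le_trans (sqL2normD m1 (cmeasD m3 m4))).
have c1 : (sqL2norm (fun y => cauchy (fun y => g y - h y)%R (x +i* y)%R) <= (e / 16)%:E)%E.
  by apply: le_trans he; exact: cauchy_contraction.
have twice (u : \bar R) c : (u <= c%:E)%E -> (2%:E * u <= (2 * c)%R%:E)%E.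
  by move=> uc; rewrite EFinM lee_pmul2l ?lte_fin.
have c2 : (sqL2norm (fun y => (cauchy h (x +i* y) - h y) + (h y - g y))%R <=
   (2 * (e / 16) + 2 * (e / 16))%R%:E)%E.
  apply: (le_trans (sqL2normD m3 m4)); rewrite [leRHS]EFinD.
  by apply: leeD; apply: twice; [exact: D|rewrite sqL2norm_swap].
apply: (le_trans (leeD (twice _ _ c1) (twice _ _ c2))).
by rewrite lee_fin; clear -e0; lra.
Qed.

End Contraction.

(** * The complex exponential *)

Section Exponential.
Variable R : realType.
Implicit Types (z w : R[i]) (x y a b t : R).

Lemma cexpD z w : cexp (z + w) = cexp z * cexp w.
Proof.
rewrite /cexp ReD ImD expRD rmorphM /= mulrACA; congr (_ * _).
by rewrite cosD sinD; apply: complexP => /=; ring.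
Qed.

Lemma cexp0 : cexp 0 = 1 :> R[i].
Proof. by rewrite /cexp /= expR0 cos0 sin0; apply: complexP => /=; ring. Qed.

Lemma cabs_cexp z : cabs (cexp z) = expR (complex.Re z).
Proof.
rewrite /cexp cabsM cabs_real ger0_norm ?expR_ge0//.
rewrite (_ : cabs _ = 1) ?mulr1//; apply/eqP.
by rewrite -sqrp_eq1 ?cabs_ge0// sqr_cabs /= cos2Dsin2.
Qed.

Lemma cexp_neq0 z : cexp z != 0.
Proof. by rewrite -cabs_gt0 cabs_cexp expR_gt0. Qed.

Lemma cexpN z : cexp (- z) = (cexp z)^-1.
Proof. by apply: (mulIf (cexp_neq0 z)); rewrite -cexpD addNr cexp0 mulVf ?cexp_neq0. Qed.

Lemma cexp_real x : cexp x%:C = (expR x)%:C.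
Proof. by rewrite /cexp /= cos0 sin0 mulr1. Qed.

Lemma cexpMn z n : cexp (n%:R * z) = cexp z ^+ n.
Proof.
elim: n => [|n IH]; first by rewrite mul0r cexp0.
by rewrite -nat1r mulrDl mul1r cexpD IH exprS.
Qed.

Lemma mvt0 (f df : R -> R) (K b : R) : (forall x, is_derive x 1 f (df x)) ->
  (forall x, `|x| <= `|b| -> `|df x| <= K) -> `|f b - f 0| <= K * `|b|.
Proof.
move=> fdf dK.
have cf : continuous f.
  by move=> x; apply/differentiable_continuous/derivable1_diffP; exact: ex_derive.
have [b0|b0] := leP 0 b.
  have [c + ->] := @MVT_segment R f df 0 b b0 (fun x _ => fdf x) (continuous_subspaceT cf).
  rewrite in_itv /= subr0 normrM => /andP[c0 cb].
  by rewrite ler_wpM2r// dK// !ger0_norm// (le_trans c0).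
have [c + E] := @MVT_segment R f df b 0 (ltW b0) (fun x _ => fdf x) (continuous_subspaceT cf).
rewrite in_itv /= => /andP[cb c0].
rewrite distrC E sub0r normrM normrN ler_wpM2r// dK// !ler0_norm ?lerN2//.
exact: ltW.
Qed.

Lemma abs_sin_le b : `|sin b| <= `|b|.
Proof.
have := @mvt0 sin cos 1 b; rewrite sin0 subr0 mul1r; apply.
by move=> x _; exact: cos_max.
Qed.

Lemma abs_cosB1_le b : `|cos b - 1| <= b ^+ 2.
Proof.
have := @mvt0 cos (fun x => - sin x) `|b| b; rewrite cos0 -expr2 real_normK ?num_real//; apply.
by move=> x xb; rewrite normrN (le_trans (abs_sin_le x)).
Qed.

Lemma abs_sinB_le b : `|b| <= 1 -> `|sin b - b| <= b ^+ 2.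
Proof.
move=> b1; have D x : is_derive x 1 (fun x => sin x - x) (cos x - 1) by exact: is_deriveB.
have K x : `|x| <= `|b| -> `|cos x - 1| <= `|b|.
  move=> xb; apply: (le_trans (abs_cosB1_le x)).
  have x1 := le_trans xb b1.
  rewrite (_ : x ^+ 2 = `|x| * `|x|); last by rewrite -normrM -expr2 ger0_norm ?sqr_ge0.
  by rewrite -[leRHS]mulr1; exact: ler_pM.
have := mvt0 D K.
by rewrite sin0 !subr0 -expr2 real_normK ?num_real.
Qed.

Lemma abs_expRB_le a : `|a| <= 2^-1 -> `|expR a - 1 - a| <= 2 * a ^+ 2.
Proof.
move=> a2; have h1 := expR_ge1Dx a; have h2 := expR_ge1Dx (- a).
have a1 : a <= 2^-1 by rewrite (le_trans (ler_norm _)).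
have d0 : 0 < 1 - a by clear -a1; lra.
have e0 := expR_gt0 a.
have h3 : expR a * (1 - a) <= 1.
  by rewrite -[leRHS](expRxMexpNx_1 a) ler_pM2l.
rewrite ger0_norm; last by clear -h1; lra.
have h4 : (expR a - 1 - a) * (1 - a) <= a ^+ 2.
  rewrite (_ : _ * _ = expR a * (1 - a) - (1 - a ^+ 2)); last by ring.
  by clear -h3; lra.
have h5 : (expR a - 1 - a) * 2^-1 <= (expR a - 1 - a) * (1 - a).
  by rewrite ler_wpM2l//; [clear -h1; lra|clear -a1; lra].
by clear -h4 h5; lra.
Qed.

(** Once this second-order bound at 0 is known, differentiability everywhere
    follows from the functional equation. *)
Lemma cexp_quad w : cabs w <= 2^-1 -> cabs (cexp w - 1 - w) <= 8 * cabs w ^+ 2.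
Proof.
move=> w2; rewrite sqr_cabs; move: (le_trans (Re_le_cabs w) w2) (le_trans (Im_le_cabs w) w2).
case: w {w2} => a b /= a2 b2; apply: (le_trans (cabs_le _)); rewrite /cexp /=.
have b1 : `|b| <= 1 by clear -b2; lra.
have ha := abs_expRB_le a2; have hs := abs_sinB_le b1; have hc := abs_cosB1_le b.
have hb := abs_sin_le b.
have A0 := sqr_ge0 a; have B0 := sqr_ge0 b.
have ea : `|expR a - 1| <= 2 * `|a|.
  rewrite (_ : expR a - 1 = (expR a - 1 - a) + a); last by ring.
  apply: (le_trans (ler_normD _ _)).
  have : a ^+ 2 <= `|a| * 2^-1 by rewrite -real_normK ?num_real// expr2 ler_wpM2l.
  by clear -ha; lra.
have e2 : expR a <= 2.
  have := ler_norm (expR a - 1); clear -ea a2; lra.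
have e0 := expR_ge0 a.
have R1 : `|expR a * cos b - 0 * sin b - 1 - a| <= 2 * a ^+ 2 + 2 * b ^+ 2.
  rewrite (_ : _ - _ = (expR a - 1 - a) + expR a * (cos b - 1)); last by ring.
  apply: (le_trans (ler_normD _ _)); apply: lerD => //; rewrite normrM ger0_norm//.
  by apply: ler_pM.
have R2 : `|expR a * sin b + 0 * cos b - 0 - b| <= 2 * (`|a| * `|b|) + b ^+ 2.
  rewrite (_ : _ - _ = (expR a - 1) * sin b + (sin b - b)); last by ring.
  apply: (le_trans (ler_normD _ _)); apply: lerD => //; rewrite normrM mulrA.
  by apply: ler_pM.
have ab : 2 * (`|a| * `|b|) <= a ^+ 2 + b ^+ 2.
  rewrite -[a ^+ 2]real_normK ?num_real// -[b ^+ 2]real_normK ?num_real//.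
  rewrite -subr_ge0 (_ : _ - _ = (`|a| - `|b|) ^+ 2) ?sqr_ge0//; ring.
apply: (@le_trans _ _ ((2 * a ^+ 2 + 2 * b ^+ 2) + (2 * (`|a| * `|b|) + b ^+ 2))).
  by apply: lerD.
by clear -ab A0 B0; lra.
Qed.

Lemma cdiff_cexp z : cdiff (@cexp R) z.
Proof.
have d0 : 0 < (2^-1 : R) by rewrite invr_gt0.
apply: (@cdiff_quad _ _ _ (cexp z) (cabs (cexp z) * 8) 2^-1) => // w wd.
rewrite cexpD (_ : _ - _ = cexp z * (cexp w - 1 - w)); last by ring.
by rewrite cabsM -mulrA ler_wpM2l ?cabs_ge0// cexp_quad// ltW.
Qed.

Lemma cdiff_cexp_affine (l c z : R[i]) : cdiff (fun w => cexp (l * (w - c))) z.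
Proof.
have [->|l0] := eqVneq l 0.
  by under eq_fun do rewrite mul0r; exact: cdiff_cst.
have [L H] := cdiff_cexp (l * (z - c)); exists (L * l) => e e0.
have l1 : 0 < cabs l by rewrite cabs_gt0.
have [d d0 D] := H (e / cabs l) (divr_gt0 e0 l1).
exists (d / cabs l); first by rewrite divr_gt0.
move=> w; rewrite ltr_pdivlMr// => wd.
have lw : cabs (l * w) < d by rewrite cabsM mulrC.
rewrite (_ : l * (z + w - c) = l * (z - c) + l * w); last by ring.
rewrite -mulrA; apply: (le_trans (D _ lw)).
by rewrite cabsM mulrA divfK ?gt_eqF.
Qed.

End Exponential.

(** * Operations that preserve the Hardy space *)

Section Algebra.
Variable R : realType.
Local Notation mu := (@lebesgue_measure R).
Implicit Types (F f : R[i] -> R[i]) (z q p : R[i]) (g h : R -> R[i]) (x y a b t M C e : R).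

Lemma H2_lin c g h : H2 g -> H2 h -> H2 (fun y => c * g y + h y).
Proof.
move=> /H2P[Lg vg bg] /H2P[Lh vh bh].
have cint q : complex.Re q != 2^-1 -> cintegral (fun y => (c * g y + h y) * ck q y) =
    c * cintegral (fun y => g y * ck q y) + cintegral (fun y => h y * ck q y).
  move=> q2; have Lq := L2_ck q2.
  rewrite -cintegralZ; last exact: cintegrable_mul.
  rewrite -cintegralD; last exact: cintegrable_mul.
    by congr cintegral; apply/funext => y; rewrite mulrDl mulrA.
  by apply: cintegrableZ; exact: cintegrable_mul.
apply/H2P; split; first by apply: L2D => //; exact: L2Z.
  by move=> q q2; rewrite cint ?gt_eqF// vg// vh// mulr0 addr0.
apply/boundaryP => e e0; pose K := 4 * (cabs c ^+ 2 + 1).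
have K0 : 0 < K by rewrite mulr_gt0// ltr_wpDl// sqr_ge0.
have eK : 0 < e / K by rewrite divr_gt0.
have [d1 d10 D1] := (boundaryP _ _).1 bg _ eK; have [d2 d20 D2] := (boundaryP _ _).1 bh _ eK.
exists (Num.min d1 d2); first by rewrite lt_min d10.
move=> x x1 x2.
have := D1 x _ x2; have := D2 x _ x2.
have h1 : 2^-1 - d1 < x by apply: le_lt_trans x1; rewrite lerD2l lerN2 ge_min lexx.
have h2 : 2^-1 - d2 < x by apply: le_lt_trans x1; rewrite lerD2l lerN2 ge_min lexx orbT.
move=> /(_ h2) E2 /(_ h1) E1.
rewrite (_ : (fun y => _) = fun y => c * (cauchy g (x +i* y) - g y) + (cauchy h (x +i* y) - h y)); last first.
  apply/funext => y; rewrite /cauchy cint; last by rewrite /= lt_eqF.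
  by ring.
have m1 : cmeasurable (fun y => cauchy g (x +i* y) - g y).
  by apply: cmeasB; [exact: cauchy_line_cmeas|case: Lg].
have m2 : cmeasurable (fun y => cauchy h (x +i* y) - h y).
  by apply: cmeasB; [exact: cauchy_line_cmeas|case: Lh].
apply: (@le_trans _ _ ((2 * cabs c ^+ 2)%:E * (e / K)%:E + 2%:E * (e / K)%:E)%E); last first.
  rewrite -!EFinM -EFinD lee_fin /K; apply: (@le_trans _ _ (e / 2)); last by clear -e0; lra.
  rewrite le_eqVlt; apply/orP; left; apply/eqP; field.
  by rewrite gt_eqF// ltr_wpDl// sqr_ge0.
apply: (@le_trans _ _ ((2 * cabs c ^+ 2)%:E * sqL2norm (fun y => cauchy g (x +i* y) - g y)%R
   + 2%:E * sqL2norm (fun y => cauchy h (x +i* y) - h y)%R)%E).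
  apply: sqL2norm_le => //.
  - by rewrite mulr_ge0 ?sqr_ge0.
  - by apply: cmeasD => //; apply: cmeasM => //; exact: cmeas_cst.
  - by move=> y; apply: (le_trans (sqr_cabsD _ _)); rewrite cabsM exprMn mulrA.
by apply: leeD; rewrite lee_wpmul2l// lee_fin mulr_ge0 ?sqr_ge0.
Qed.

Lemma H2_0 : H2 (fun=> 0 : R[i]).
Proof.
split; first exact: L2_0.
exists (fun=> 0).
  apply/hardyP; split; first by move=> z _; exact: cdiff_cst.
  by exists 0 => x _; rewrite sqL2norm0.
apply/boundaryP => e e0; exists 1 => // x _ _.
rewrite (_ : (fun y => _) = fun=> 0) ?sqL2norm0 ?lee_fin ?ltW//.
by apply/funext => y; rewrite subrr.
Qed.

Lemma H2Z c h : H2 h -> H2 (fun y => c * h y).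
Proof.
by move=> Hh; have := H2_lin c Hh H2_0; under eq_fun do rewrite addr0.
Qed.

Lemma H2D g h : H2 g -> H2 h -> H2 (fun y => g y + h y).
Proof.
by move=> Hg Hh; have := H2_lin 1 Hg Hh; under eq_fun do rewrite mul1r.
Qed.

Lemma H2B g h : H2 g -> H2 h -> H2 (fun y => g y - h y).
Proof.
move=> Hg Hh; have := H2_lin (-1) Hh Hg.
by under eq_fun do rewrite mulN1r addrC.
Qed.

Lemma H2_sum (n : nat) (f : nat -> R -> R[i]) : (forall i, (i < n)%N -> H2 (f i)) ->
  H2 (fun y => \sum_(i < n) f i y).
Proof.
elim: n => [|n IH] H; first by under eq_fun do rewrite big_ord0; exact: H2_0.
under eq_fun do rewrite big_ord_recr; apply: H2D; last exact: H.
by apply: IH => i ni; apply: H; exact: ltnW.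
Qed.

Lemma sqr_lt_near e c : 0 < e -> 0 <= c -> exists2 d, 0 < d & forall t, 0 < t -> t < d -> t ^+ 2 * c <= e.
Proof.
move=> e0 c0; have e1 : 0 < e / (c + 1) by rewrite divr_gt0// ltr_wpDl.
exists (Num.min 1 (e / (c + 1))); first by rewrite lt_min ltr01.
move=> t t0; rewrite lt_min => /andP[t1 te].
have tt : t ^+ 2 <= t by rewrite expr2 ger_pMr// ltW.
apply: (@le_trans _ _ (t * (c + 1))).
  by apply: ler_pM => //; rewrite ?sqr_ge0// lerDl.
by rewrite -ler_pdivlMr ?ltW// ltr_wpDl.
Qed.

Lemma pole_hardy q : 2^-1 < complex.Re q ->
  [/\ left_cdiff (fun w => (w - q)^-1), left_bounded (fun w => (w - q)^-1) (pi / (complex.Re q - 2^-1)) &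
   boundary_value (fun w => (w - q)^-1) (ck q)].
Proof.
move=> q2; have Lq : L2 (ck q) by apply: L2_ck; rewrite gt_eqF.
pose d := complex.Re q - 2^-1; have d0 : 0 < d by rewrite subr_gt0.
have xq x : x < 2^-1 -> d <= `|x - complex.Re q|.
  by move=> x2; rewrite /d ler_normr; apply/orP; right; clear -x2; lra.
have xN x : x < 2^-1 -> x != complex.Re q by move=> x2; rewrite lt_eqF// (lt_trans x2).
have df z : complex.Re z < 2^-1 -> cdiff (fun w => (w - q)^-1) z.
  by move=> z2; apply: cdiff_pole; apply: contraTneq z2 => ->; rewrite -leNgt ltW.
split => //.
  move=> x x2.
  rewrite sqL2norm_line_pole ?xN// lee_fin ler_pM2l ?pi_gt0//.
  by rewrite lef_pV2 ?posrE ?xq// (lt_le_trans d0)// xq.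
apply/boundaryP => e e0; have [A A0 HA] := L2_bound Lq.
have [d1 d10 D] := @sqr_lt_near e (d^-1 ^+ 2 * A) e0 (mulr_ge0 (sqr_ge0 _) A0).
exists d1 => // x x1 x2.
have t0 : 0 < 2^-1 - x by rewrite subr_gt0.
apply: (@le_trans _ _ ((((2^-1 - x) * d^-1) ^+ 2)%:E * sqL2norm (ck q))%E).
  apply: sqL2norm_le1.
  - by apply: mulr_ge0; [exact: ltW|rewrite invr_ge0 ltW].
  - by apply: cmeasB; [apply: (@cmeas_line _ (fun w => (w - q)^-1)) => y; exact: df|case: Lq].
  - by case: Lq.
  move=> y; have z0 := line_neq y (xN x x2).
  have s0 : critical_point y - q != 0 by apply: ck_neq0; rewrite gt_eqF.
  have -> : (x +i* y - q)^-1 - ck q y = (2^-1 - x)%:C * (x +i* y - q)^-1 * ck q y.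
    rewrite /ck (_ : (2^-1 - x)%:C = (critical_point y - q) - (x +i* y - q)); last first.
      by apply: complexP; case: (q) => qa qb /=; ring.
    by move: (critical_point y - q) (x +i* y - q) s0 z0 => s z s0 z0; field; rewrite s0.
  rewrite !cabsM cabs_real gtr0_norm// cabsV ler_wpM2r ?cabs_ge0//.
  rewrite ler_pM2l// lef_pV2 ?posrE ?cabs_gt0//.
  exact: le_trans (xq x x2) (cabs_line_ge _ _ _).
apply: (@le_trans _ _ ((((2^-1 - x) * d^-1) ^+ 2)%:E * A%:E)%E).
  by rewrite lee_wpmul2l// lee_fin sqr_ge0.
rewrite -EFinM lee_fin exprMn -mulrA; apply: D => //.
by clear -x1; lra.
Qed.

Lemma H2_ck q : 2^-1 < complex.Re q -> H2 (ck q).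
Proof.
move=> q2; have [df bf bv] := pole_hardy q2.
split; first by apply: L2_ck; rewrite gt_eqF.
by exists (fun w => (w - q)^-1) => //; apply/hardyP; split => //; eexists; exact: bf.
Qed.

Lemma cauchy_ck q z : 2^-1 < complex.Re q -> complex.Re z < 2^-1 ->
  cauchy (ck q) z = (z - q)^-1.
Proof.
move=> q2 z2; have [df bf bv] := pole_hardy q2.
rewrite (boundary_cauchy df _ _ bv z2)//; first by eexists; exact: bf.
by apply: L2_ck; rewrite gt_eqF.
Qed.

Lemma cauchyE h z : cintegral (fun y => h y * ck z y) = (2 * pi)%:C * cauchy h z.
Proof.
rewrite /cauchy mulrA -rmorphM mulfV ?rmorph1 ?mul1r//.
by rewrite mulf_neq0 ?pi_neq0.
Qed.

(** Conjugation turns both kernels into kernels with pole on the right, one of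
    which belongs to H^2 and is annihilated by the other. *)
Lemma cintegral_ck_left p z : complex.Re p < 2^-1 -> complex.Re z < 2^-1 ->
  cintegral (fun y => ck p y * ck z y) = 0.
Proof.
move=> p2 z2.
have r2 (w : R[i]) : complex.Re w < 2^-1 -> 2^-1 < complex.Re (1 - w^*).
  by rewrite ReD ReN ReJ /=; clear; lra.
have rK (w : R[i]) : 1 - (1 - w^*)^* = w by case: w => a b; apply: complexP => /=; ring.
have Hp := H2_ck (r2 p p2); have Lz : L2 (ck (1 - z^* )) by apply: L2_ck; rewrite gt_eqF ?r2.
have I : cintegrable (fun y => ck (1 - p^* ) y * ck (1 - z^* ) y).
  by apply: cintegrable_mul => //; exact: H2_L2.
have := cintegralJ I; rewrite (H2_orth Hp (r2 z z2)) rmorph0 => <-.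
congr cintegral; apply/funext => y.
by rewrite rmorphM /= !ckJ mulrNN !rK.
Qed.

(** The difference quotient at [p] of the holomorphic extension of [h], on the
    boundary. *)
Definition quotient h p y : R[i] := (h y - cauchy h p) * ck p y.

Lemma L2_quotient h p : L2 h -> complex.Re p < 2^-1 -> L2 (quotient h p).
Proof.
move=> Lh p2; have Lp : L2 (ck p) by apply: L2_ck; rewrite lt_eqF.
rewrite (_ : quotient h p = fun y => ck p y * h y - cauchy h p * ck p y); last first.
  by apply/funext => y; rewrite /quotient mulrBl (mulrC (h y)).
apply: L2B; last exact: L2Z.
apply: (@L2_mul_bounded _ h (ck p) (2^-1 - complex.Re p)^-1) => //; first by case: Lp.
by move=> y; apply: cabs_ck_le; rewrite ?subr_gt0// ler_norm.
Qed.

Lemma cintegral_quotient h p z : L2 h -> complex.Re p < 2^-1 -> complex.Re z != 2^-1 ->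
  z != p -> cintegral (fun y => quotient h p y * ck z y) =
    (z - p)^-1 * (cintegral (fun y => h y * ck z y) - (2 * pi)%:C * cauchy h p)
    - cauchy h p * cintegral (fun y => ck p y * ck z y).
Proof.
move=> Lh p2 z2 zp; have pN : complex.Re p != 2^-1 by rewrite lt_eqF.
have Lp := L2_ck pN; have Lz := L2_ck z2.
have Ihp := cintegrable_mul Lh Lp; have Ihz := cintegrable_mul Lh Lz.
have Ipz := cintegrable_mul Lp Lz.
rewrite -cauchyE -!cintegralB// -!cintegralZ//; last exact: cintegrableB.
rewrite -cintegralB; [|by apply: cintegrableZ; exact: cintegrableB|exact: cintegrableZ].
congr cintegral; apply/funext => y; rewrite /quotient.
have -> : (h y - cauchy h p) * ck p y * ck z y = h y * (ck z y * ck p y) - cauchy h p * (ck p y * ck z y).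
  by ring.
by rewrite ck_mul//; ring.
Qed.

(** Splitting a product of two Cauchy kernels shows that the Cauchy integral of
    the quotient is the difference quotient of that of [h]; the denominator
    stays away from 0 near the line, so that the boundary behaviour of [h] is
    inherited. *)
Lemma H2_quotient h p : H2 h -> complex.Re p < 2^-1 -> H2 (quotient h p).
Proof.
move=> Hh p2; have [Lh vh bh] := (H2P h).1 Hh; have LQ := L2_quotient Lh p2.
have vQ : orth_ck (quotient h p).
  move=> q q2; have qp : q != p by apply: contraTneq q2 => ->; rewrite -leNgt ltW.
  rewrite (cintegral_quotient Lh p2 _ qp); last by rewrite gt_eqF.
  rewrite (vh q q2) sub0r.
  have -> : cintegral (fun y => ck p y * ck q y) = (2 * pi)%:C * (p - q)^-1.
    rewrite -(cauchy_ck q2 p2) -cauchyE; congr cintegral; apply/funext => y.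
    by rewrite mulrC.
  by rewrite -(opprB p q) invrN; ring.
apply/H2P; split => //.
have cQ z : complex.Re z < 2^-1 -> z != p -> cauchy (quotient h p) z = (z - p)^-1 * (cauchy h z - cauchy h p).
  move=> z2 zp; rewrite {1}/cauchy (cintegral_quotient Lh p2 _ zp); last by rewrite lt_eqF.
  rewrite (cintegral_ck_left p2 z2).
  rewrite mulr0 subr0 cauchyE -mulrBr mulrCA; congr (_ * _).
  by rewrite mulrA -rmorphM mulVf ?rmorph1 ?mul1r// mulf_neq0 ?pi_neq0.
pose d := (2^-1 - complex.Re p) / 2; have d0 : 0 < d by rewrite divr_gt0// subr_gt0.
apply/boundaryP => e e0; have [A A0 HA] := L2_bound LQ.
have e1 : 0 < e / (4 * d^-1 ^+ 2) by rewrite divr_gt0// mulr_gt0// exprn_gt0// invr_gt0.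
have e2 : 0 < e / 4 by rewrite divr_gt0.
have [d1 d10 D1] := (boundaryP _ _).1 bh _ e1.
have [d2 d20 D2] := @sqr_lt_near (e / 4) (d^-1 ^+ 2 * A) e2 (mulr_ge0 (sqr_ge0 _) A0).
exists (Num.min d (Num.min d1 d2)); first by rewrite !lt_min d0 d10.
move=> x x1 x2.
have [x3 x4 x5] : [/\ 2^-1 - x < d, 2^-1 - x < d1 & 2^-1 - x < d2].
  have : 2^-1 - x < Num.min d (Num.min d1 d2) by clear -x1; lra.
  by rewrite !lt_min => /andP[-> /andP[-> ->]].
have t0 : 0 < 2^-1 - x by rewrite subr_gt0.
have xd : d <= `|x - complex.Re p| by rewrite ler_normr /d in x3 *; apply/orP; left; clear -x3; lra.
have xN : x != complex.Re p by rewrite -subr_eq0 -normr_gt0 (lt_le_trans d0).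
have dc y : cabs (x +i* y - p)^-1 <= d^-1.
  rewrite cabsV lef_pV2 ?posrE//; first exact: le_trans (cabs_line_ge _ _ _).
  exact: lt_le_trans d0 (le_trans xd (cabs_line_ge _ _ _)).
have E y : cauchy (quotient h p) (x +i* y) - quotient h p y =
    (x +i* y - p)^-1 * (cauchy h (x +i* y) - h y)
    + (2^-1 - x)%:C * (x +i* y - p)^-1 * quotient h p y.
  rewrite cQ//; last by rewrite -subr_eq0 line_neq.
  rewrite (_ : (2^-1 - x)%:C = (critical_point y - p) - (x +i* y - p)); last first.
    by apply: complexP; case: (p) => pa pb /=; ring.
  have s0 : critical_point y - p != 0 by apply: ck_neq0; rewrite lt_eqF.
  have z0 := line_neq y xN.
  rewrite /quotient /ck; move: (critical_point y - p) (x +i* y - p) s0 z0 => s z s0 z0.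
  by field; rewrite s0.
have m1 : cmeasurable (fun y => cauchy h (x +i* y) - h y).
  by apply: cmeasB; [exact: cauchy_line_cmeas|case: Lh].
have m2 : cmeasurable (fun y => cauchy (quotient h p) (x +i* y) - quotient h p y).
  by apply: cmeasB; [exact: cauchy_line_cmeas|case: LQ].
apply: (@le_trans _ _ ((2 * d^-1 ^+ 2)%:E * sqL2norm (fun y => cauchy h (x +i* y) - h y)%R
   + (2 * ((2^-1 - x) * d^-1) ^+ 2)%:E * sqL2norm (quotient h p))%E).
  apply: sqL2norm_le => //; try by rewrite mulr_ge0 ?sqr_ge0.
    by case: LQ.
  move=> y; rewrite E; apply: (le_trans (sqr_cabsD _ _)).
  rewrite !(cabsM (_ * _) (quotient h p y)) !cabsM cabs_real gtr0_norm//.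
  set Q := _ * cabs (ck p y); rewrite !exprMn.
  have dd : cabs (x +i* y - p)^-1 ^+ 2 <= d^-1 ^+ 2.
    by apply: lerXn2r; rewrite ?nnegrE ?cabs_ge0// invr_ge0 ltW.
  apply: lerD; rewrite -[leRHS]mulrA ler_pM2l//.
    by rewrite ler_wpM2r ?sqr_ge0.
  apply: ler_wpM2r; first by apply: mulr_ge0; exact: sqr_ge0.
  by apply: ler_wpM2l => //; exact: sqr_ge0.
have -> : e = 2 * d^-1 ^+ 2 * (e / (4 * d^-1 ^+ 2)) + 2 * (e / 4).
  by field; rewrite gt_eqF.
rewrite [leRHS]EFinD [((2 * d^-1 ^+ 2) * _)%:E]EFinM; apply: leeD.
  by apply: lee_wpmul2l; [rewrite lee_fin mulr_ge0 ?sqr_ge0|apply: D1 => //; clear -x4; lra].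
apply: (@le_trans _ _ ((2 * ((2^-1 - x) * d^-1) ^+ 2)%:E * A%:E)%E).
  by apply: lee_wpmul2l => //; rewrite lee_fin mulr_ge0 ?sqr_ge0.
by rewrite -EFinM lee_fin -mulrA ler_pM2l// exprMn -mulrA; exact: D2.
Qed.

(** The exponential is an inner function: it has modulus 1 on the critical line
    and at most 1 to its left. *)
Lemma H2_exp (l : R) h : 0 <= l -> H2 h ->
  H2 (fun y => cexp (l%:C * (critical_point y - 2^-1%:C)) * h y) /\
  forall z, complex.Re z < 2^-1 ->
    cauchy (fun y => cexp (l%:C * (critical_point y - 2^-1%:C)) * h y) z =
    cexp (l%:C * (z - 2^-1%:C)) * cauchy h z.
Proof.
move=> l0 Hh; have [Lh vh bh] := (H2P h).1 Hh.
pose E z : R[i] := cexp (l%:C * (z - 2^-1%:C)).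
have cE z : cabs (E z) = expR (l * (complex.Re z - 2^-1)).
  by rewrite /E cabs_cexp ReM ReD ReN /= mul0r subr0.
have dE z : cdiff E z by exact: cdiff_cexp_affine.
have Es y : cabs (E (critical_point y)) = 1 by rewrite cE /= subrr mulr0 expR0.
have mE : cmeasurable (fun y => E (critical_point y)) by apply: (@cmeas_line _ E 2^-1) => y.
have LE : L2 (fun y => E (critical_point y) * h y).
  by apply: (@L2_mul_bounded _ h _ 1) => // y; rewrite Es.
have df : left_cdiff (fun z => E z * cauchy h z).
  by move=> z z2; apply: cdiffM => //; exact: cdiff_cauchy.
have E1 z : complex.Re z <= 2^-1 -> cabs (E z) <= 1.
  by move=> z2; rewrite cE -[leRHS]expR0 ler_expR mulr_ge0_le0// subr_le0.
have bf : exists M, left_bounded (fun z => E z * cauchy h z) M.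
  have [A A0 HA] := L2_bound Lh; exists A => x x2.
  apply: le_trans HA; apply: le_trans (cauchy_contraction Lh vh x2).
  have := @sqL2norm_le1 R (fun y => E (x +i* y) * cauchy h (x +i* y)) (fun y => cauchy h (x +i* y)) 1 ler01.
  rewrite expr1n mul1e; apply.
  - by apply: cmeasM; [apply: cmeas_line => y|exact: cauchy_line_cmeas].
  - exact: cauchy_line_cmeas.
  - by move=> y; rewrite mul1r cabsM ler_piMl ?cabs_ge0// E1//= ltW.
have bv : boundary_value (fun z => E z * cauchy h z) (fun y => E (critical_point y) * h y).
  apply/boundaryP => e e0; have [A A0 HA] := L2_bound Lh.
  have e4 : 0 < e / 4 by rewrite divr_gt0.
  have [d1 d10 D1] := (boundaryP _ _).1 bh _ e4.
  have [d2 d20 D2] := @sqr_lt_near (e / 4) (l ^+ 2 * A) e4 (mulr_ge0 (sqr_ge0 _) A0).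
  exists (Num.min d1 d2); first by rewrite lt_min d10.
  move=> x x1 x2.
  have [x4 x5] : 2^-1 - x < d1 /\ 2^-1 - x < d2.
    have : 2^-1 - x < Num.min d1 d2 by clear -x1; lra.
    by rewrite lt_min => /andP[-> ->].
  have t0 : 0 < 2^-1 - x by rewrite subr_gt0.
  have EE y : E (x +i* y) = (expR (l * (x - 2^-1)))%:C * E (critical_point y).
    rewrite /E -cexp_real -cexpD; congr cexp.
    by apply: complexP => /=; ring.
  set r := expR _ in EE.
  have r1 : r <= 1 by rewrite /r -[leRHS]expR0 ler_expR mulr_ge0_le0// subr_le0 ltW.
  have r2 : `|r - 1| <= (2^-1 - x) * l.
    rewrite distrC ger0_norm ?subr_ge0// /r.
    have := expR_ge1Dx (l * (x - 2^-1)); clear; lra.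
  have m1 : cmeasurable (fun y => cauchy h (x +i* y) - h y).
    by apply: cmeasB; [exact: cauchy_line_cmeas|case: Lh].
  apply: (@le_trans _ _ (2%:E * sqL2norm (fun y => cauchy h (x +i* y) - h y)%R
     + (2 * ((2^-1 - x) * l) ^+ 2)%:E * sqL2norm h)%E).
    apply: sqL2norm_le => //.
    - by rewrite mulr_ge0 ?sqr_ge0.
    - apply: cmeasB; last by case: LE.
      by apply: cmeasM; [apply: cmeas_line => y|exact: cauchy_line_cmeas].
    - by case: Lh.
    move=> y; rewrite EE.
    rewrite (_ : _ - _ = E (critical_point y) * (r%:C * (cauchy h (x +i* y) - h y) + (r - 1)%:C * h y)); last first.
      by rewrite rmorphB rmorph1; ring.
    rewrite cabsM Es mul1r; apply: (le_trans (sqr_cabsD _ _)).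
    rewrite !cabsM !cabs_real !exprMn; apply: lerD.
      rewrite ler_pM2l//; apply: ler_piMl; first exact: sqr_ge0.
      by rewrite real_normK ?num_real// expr_le1// /r expR_ge0.
    rewrite -[leRHS]mulrA ler_pM2l//; apply: ler_wpM2r; first exact: sqr_ge0.
    rewrite -exprMn; apply: lerXn2r => //; rewrite nnegrE ?normr_ge0//.
    by apply: mulr_ge0 => //; exact: ltW.
  have -> : e = 2 * (e / 4) + 2 * (e / 4) by clear; lra.
  rewrite [leRHS]EFinD; apply: leeD.
    rewrite [leRHS]EFinM; apply: lee_wpmul2l => //; apply: D1 => //; clear -x4; lra.
  apply: (@le_trans _ _ ((2 * ((2^-1 - x) * l) ^+ 2)%:E * A%:E)%E).
    by apply: lee_wpmul2l => //; rewrite lee_fin mulr_ge0 ?sqr_ge0.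
  by rewrite -EFinM lee_fin -mulrA ler_pM2l// exprMn -mulrA; exact: D2.
split; last by move=> z z2; rewrite (boundary_cauchy df bf LE bv z2).
by split => //; exists (fun z => E z * cauchy h z) => //; apply/hardyP.
Qed.

End Algebra.

(** * Euler's product for the Gamma function *)

Section ComplexSequences.
Variable R : realType.
Implicit Types (a b : nat -> R[i]) (l z w : R[i]) (x y : R).

Definition ccvg a l := cabs (a n - l) @[n --> \oo] --> (0 : R).

Lemma ccvg_epsP a l : ccvg a l <->
  forall e : R, 0 < e -> exists N, forall n, (N <= n)%N -> cabs (a n - l) <= e.
Proof.
split=> [/cvgrPdist_le H e e0|H].
  have [N _ HN] := H e e0; exists N => n Nn.
  by have := HN n Nn; rewrite /= sub0r normrN ger0_norm ?cabs_ge0.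
apply/cvgrPdist_le => e e0; have [N HN] := H e e0; exists N => // n /= Nn.
by rewrite sub0r normrN ger0_norm ?cabs_ge0// HN.
Qed.

Lemma ccvg_ReIm a (x y : R) : (fun n => complex.Re (a n)) @ \oo --> x ->
  (fun n => complex.Im (a n)) @ \oo --> y -> ccvg a (x +i* y).
Proof.
move=> /cvgrPdist_le cx /cvgrPdist_le cy; apply/ccvg_epsP => e e0.
have e2 : 0 < e / 2 by rewrite divr_gt0.
have [N1 _ H1] := cx _ e2; have [N2 _ H2] := cy _ e2.
exists (maxn N1 N2) => n; rewrite geq_max => /andP[n1 n2].
rewrite (le_trans (cabs_le _))// [leRHS]splitr; apply: lerD.
  by have := H1 n n1; rewrite /= distrC; case: (a n).
by have := H2 n n2; rewrite /= distrC; case: (a n).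
Qed.

Lemma ccvgP a l : ccvg a l <-> (a : nat -> R[i]^o) @ \oo --> (l : R[i]^o).
Proof.
split.
  move=> /cvgrPdist_lt H; apply/cvgrPdist_lt => /= e.
  rewrite ltcE /= => /andP[/eqP eI e0]; have := H _ e0; apply: filterS => n.
  rewrite sub0r normrN ger0_norm ?cabs_ge0// cabs_dist => an.
  by rewrite -(ltcR (cabs _)) -cabsE in an; apply: (lt_le_trans an); rewrite lecE /= eI eqxx lexx.
move=> /cvgrPdist_lt H; apply/cvgrPdist_lt => /= e e0.
have eC : 0 < e%:C :> R[i] by rewrite ltcR.
have := H _ eC; apply: filterS => n; rewrite cabsE ltcR.
by rewrite sub0r normrN ger0_norm ?cabs_ge0// cabs_dist.
Qed.

Lemma ccvg_lim a l : ccvg a l -> lim ((a : nat -> R[i]^o) @ \oo) = l.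
Proof. by move=> /ccvgP; apply: cvg_lim; exact: norm_hausdorff. Qed.

Lemma ccvg_unique a l l' : ccvg a l -> ccvg a l' -> l = l'.
Proof. by move=> /ccvg_lim <- /ccvg_lim <-. Qed.

Lemma ccvg_cst l : ccvg (fun=> l) l.
Proof. by apply/ccvgP; exact: cvg_cst. Qed.

Lemma ccvgM a b l l' : ccvg a l -> ccvg b l' -> ccvg (fun n => a n * b n) (l * l').
Proof.
move=> /ccvgP ca /ccvgP cb; apply/ccvgP.
exact: (@cvgM R[i] nat \oo _ a b l l' ca cb).
Qed.

Lemma ccvgV a l : l != 0 -> ccvg a l -> ccvg (fun n => (a n)^-1) l^-1.
Proof.
move=> l0 /ccvgP ca; apply/ccvgP.
exact: (@cvgV R[i] nat \oo _ a l l0 ca).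
Qed.

Lemma ccvg_prod (m : nat) (a : nat -> nat -> R[i]) (l : nat -> R[i]) :
  (forall k, (k < m)%N -> ccvg (a k) (l k)) ->
  ccvg (fun n => \prod_(k < m) a k n) (\prod_(k < m) l k).
Proof.
elim: m => [|m IH] H.
  by under eq_fun do rewrite big_ord0; rewrite big_ord0; exact: ccvg_cst.
under eq_fun do rewrite big_ord_recr; rewrite big_ord_recr /=; apply: ccvgM; last exact: H.
by apply: IH => k km; apply: H; exact: ltnW.
Qed.

Lemma ccvg_subseq a l (f : nat -> nat) : (forall n, (n <= f n)%N) -> ccvg a l ->
  ccvg (fun n => a (f n)) l.
Proof.
move=> fn /cvgrPdist_lt H; apply/cvgrPdist_lt => e e0.
have [N _ HN] := H e e0; exists N => // n /= Nn; apply: HN => /=.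
exact: leq_trans (fn n).
Qed.

Lemma ccvg_near a b l : (\forall n \near \oo, a n = b n) -> ccvg a l -> ccvg b l.
Proof.
move=> ab; apply: cvg_trans; apply: near_eq_cvg.
by apply: filterS ab => n ->.
Qed.

(** The sequence [u n + K / (n + 1)] is nonincreasing and bounded. *)
Lemma telescoping_cvg (u : nat -> R) (K B : R) N :
  (forall n, (N <= n)%N -> `|u n.+1 - u n| <= K * (n.+1%:R^-1 - n.+2%:R^-1)) ->
  (forall n, (N <= n)%N -> `|u n| <= B) -> cvgn u.
Proof.
move=> uK uB.
have K0 : 0 <= K.
  have := uK N (leqnn N) => /(le_trans (normr_ge0 _)); rewrite pmulr_lge0//.
  by rewrite subr_gt0 ltf_pV2 ?posrE// ltr_nat.
pose v n := u (n + N)%N + K / (n + N).+1%:R.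
have cv : cvgn v.
  apply: nonincreasing_is_cvgn.
    apply/nonincreasing_seqP => n; rewrite /v addSn.
    have := uK _ (leq_addl n N); rewrite ler_norml mulrBr => /andP[_ h].
    rewrite -subr_ge0 (_ : _ - _ = (K / (n + N).+1%:R - K / (n + N).+2%:R)
      - (u (n + N).+1 - u (n + N)%N)); last by ring.
    by rewrite subr_ge0.
  exists (- B) => _ [n _ <-]; rewrite /v.
  have := uB _ (leq_addl n N); rewrite ler_norml => /andP[+ _].
  have q0 : 0 <= K / (n + N).+1%:R by rewrite divr_ge0.
  by move=> h; rewrite (le_trans h)// lerDl.
have cK : (fun n => K / (n + N).+1%:R) @ \oo --> K * 0.
  apply: cvgM; first exact: cvg_cst.
  rewrite (cvg_shiftn N (fun n => n.+1%:R^-1 : R)); exact: cvg_harmonic.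
have : (fun n => u (n + N)%N) @ \oo --> limn v - K * 0.
  apply: cvg_trans (cvgB cv cK); apply: near_eq_cvg; near=> n.
  by rewrite /v addrK.
by rewrite (cvg_shiftn N u) => cu; apply/cvg_ex; eexists; exact: cu.
Unshelve. all: by end_near. Qed.

(** An infinite product whose factors are within a telescoping bound of 1. *)
Lemma product_cvg a (C : R) N : 0 <= C ->
  (forall n, (N <= n)%N ->
     cabs (a n.+1 - a n) <= C * (n.+1%:R^-1 - n.+2%:R^-1) * cabs (a n)) ->
  exists l, ccvg a l.
Proof.
move=> C0 H.
pose B := cabs (a N) * expR (C * N.+1%:R^-1).
have bd n : cabs (a (n + N)%N) * expR (C * (n + N).+1%:R^-1) <= B.
  elim: n => [//|n IH]; apply: le_trans IH; rewrite addSn.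
  set c := n + N.
  have := H c (leq_addl n N) => Hc.
  set t := C * (_ - _) in Hc.
  have -> : C * c.+1%:R^-1 = t + C * c.+2%:R^-1 by rewrite /t; ring.
  rewrite expRD mulrA ler_pM2r ?expR_gt0//.
  apply: (@le_trans _ _ (cabs (a c) * (1 + t))); last by rewrite ler_wpM2l ?cabs_ge0// expR_ge1Dx.
  have -> : a c.+1 = a c + (a c.+1 - a c) by ring.
  by apply: (le_trans (cabsD _ _)); rewrite mulrDr mulr1 lerD2l mulrC.
have aB n : (N <= n)%N -> cabs (a n) <= B.
  move=> Nn; have := bd (n - N)%N; rewrite subnK//; apply: le_trans.
  rewrite ler_peMr ?cabs_ge0// -[leLHS]expR0 ler_expR mulr_ge0// invr_ge0//.
have dB n : (N <= n)%N -> cabs (a n.+1 - a n) <= C * B * (n.+1%:R^-1 - n.+2%:R^-1).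
  move=> Nn; apply: (le_trans (H n Nn)); rewrite mulrAC ler_wpM2r//.
    by rewrite subr_ge0 lef_pV2 ?posrE// ler_nat.
  by rewrite ler_wpM2l// aB.
have cR : cvgn (fun n => complex.Re (a n)).
  apply: (@telescoping_cvg _ (C * B) B N) => n Nn.
    by apply: le_trans (dB n Nn); rewrite -ReN -ReD Re_le_cabs.
  by apply: le_trans (aB n Nn); exact: Re_le_cabs.
have cI : cvgn (fun n => complex.Im (a n)).
  apply: (@telescoping_cvg _ (C * B) B N) => n Nn.
    by apply: le_trans (dB n Nn); rewrite -ImN -ImD Im_le_cabs.
  by apply: le_trans (aB n Nn); exact: Im_le_cabs.
by eexists; exact: ccvg_ReIm cR cI.
Qed.

(** The inverses satisfy a bound of the same kind, hence converge too. *)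
Lemma product_cvg_neq0 a (C : R) N : 0 <= C -> (forall n, (N <= n)%N -> a n != 0) ->
  (forall n, (N <= n)%N ->
     cabs (a n.+1 - a n) <= C * (n.+1%:R^-1 - n.+2%:R^-1) * cabs (a n)) ->
  exists2 l, ccvg a l & l != 0.
Proof.
move=> C0 a0 H; have [l cl] := product_cvg C0 H.
pose M := maxn N (Num.bound (2 * C)).
have half n : (M <= n)%N -> cabs (a n) <= 2 * cabs (a n.+1).
  rewrite geq_max => /andP[Nn Cn].
  have Cn2 : 2 * C <= n.+1%:R.
    rewrite ltW// (lt_le_trans (archi_boundP _))//; first by rewrite mulr_ge0.
    by rewrite ler_nat (leq_trans Cn).
  have t1 : C * (n.+1%:R^-1 - n.+2%:R^-1) <= 2^-1.
    apply: (@le_trans _ _ (C * n.+1%:R^-1)).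
      by rewrite ler_wpM2l// lerBlDr lerDl invr_ge0.
    by rewrite ler_pdivrMr//; clear -Cn2; lra.
  have h := H n Nn.
  have h2 : C * (n.+1%:R^-1 - n.+2%:R^-1) * cabs (a n) <= 2^-1 * cabs (a n).
    by rewrite ler_wpM2r ?cabs_ge0.
  have h3 : cabs (a n) <= cabs (a n.+1) + cabs (a n.+1 - a n).
    by rewrite -[X in cabs X <= _](subKr (a n.+1)); exact: cabsB.
  have h4 := le_trans h h2; by clear -h4 h3; lra.
have [l' cl'] : exists l', ccvg (fun n => (a n)^-1) l'.
  apply: (@product_cvg _ (2 * C) M); first by rewrite mulr_ge0.
  move=> n Mn; have Nn : (N <= n)%N by rewrite (leq_trans _ Mn)// leq_maxl.
  have [n0 n1] := (a0 n Nn, a0 n.+1 (leq_trans Nn (leqnSn n))).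
  have -> : (a n.+1)^-1 - (a n)^-1 = - (a n.+1 - a n) * ((a n)^-1 * (a n.+1)^-1).
    by field; rewrite n0 n1.
  rewrite cabsM cabsN cabsM !cabsV.
  have p0 : 0 < cabs (a n) by rewrite cabs_gt0.
  have p1 : 0 < cabs (a n.+1) by rewrite cabs_gt0.
  rewrite mulrCA mulrC; apply: ler_pM; rewrite ?mulr_ge0 ?invr_ge0 ?cabs_ge0//.
  rewrite ler_pdivrMr//; apply: (le_trans (H n Nn)).
  have t0 : 0 <= C * (n.+1%:R^-1 - n.+2%:R^-1).
    by rewrite mulr_ge0// subr_ge0 lef_pV2 ?posrE// ler_nat.
  rewrite (_ : 2 * C * _ * _ = C * (n.+1%:R^-1 - n.+2%:R^-1) * (2 * cabs (a n.+1))); last by ring.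
  by apply: ler_wpM2l => //; exact: half.
exists l => //; apply: contraTneq isT => l0; exfalso.
have : ccvg (fun=> 1 : R[i]) (l * l').
  apply: ccvg_near (ccvgM cl cl'); exists N => // n /= Nn.
  by rewrite mulfV// a0.
move/(ccvg_unique (ccvg_cst 1)); rewrite l0 mul0r => /eqP; by rewrite oner_eq0.
Qed.

End ComplexSequences.

Section GammaFunction.
Variable R : realType.
Implicit Types (z w s : R[i]) (x y t : R).

(** The terms of the limit that defines [Gamma]. *)
Definition euler n z : R[i] :=
  (n`!)%:R * cpow n%:R z / \prod_(j < n.+1) (z + j%:R).

Definition nonpole z := forall j : nat, z + j%:R != 0.

Lemma GammaE z l : ccvg (euler^~ z) l -> Gamma z = l.
Proof. by move=> /ccvg_lim. Qed.

Lemma Gamma_pole z (j : nat) : z + j%:R = 0 -> Gamma z = 0.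
Proof.
move=> zj; apply: GammaE; apply: ccvg_near (ccvg_cst 0); exists j => // n /= jn.
rewrite /euler (bigD1 (Ordinal (jn : (j < n.+1)%N)))//= zj mul0r invr0 mulr0//.
Qed.

Lemma prod_nonpole z n : nonpole z -> \prod_(j < n) (z + j%:R) != 0.
Proof. by move=> nz; rewrite prodf_seq_neq0; apply/allP => j _; exact: nz. Qed.

Lemma cpow_neq0 x z : cpow x z != 0.
Proof. exact: cexp_neq0. Qed.

Lemma fact_neq0 n : (n`!%:R : R[i]) != 0.
Proof. by rewrite pnatr_eq0 -lt0n fact_gt0. Qed.

Lemma euler_neq0 z n : nonpole z -> euler n z != 0.
Proof.
move=> nz; apply: mulf_neq0; last by rewrite invr_neq0// prod_nonpole.
by apply: mulf_neq0; [exact: fact_neq0|exact: cpow_neq0].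
Qed.

Lemma eulerS z n : nonpole z -> let t := ln n.+1%:R - ln n%:R in
  euler n.+1 z = euler n z * (cexp (t%:C * z) / (1 + z / n.+1%:R)).
Proof.
move=> nz t; rewrite /euler big_ord_recr /= factS natrM.
have -> : cpow n.+1%:R z = cpow n%:R z * cexp (t%:C * z) :> R[i].
  by rewrite /cpow -cexpD -mulrDl -rmorphD /= /t subrKC.
have n0 : n.+1%:R != 0 :> R[i] by rewrite pnatr_eq0.
have p0 := prod_nonpole n.+1 nz.
move: (nz n.+1) p0; set p := \prod_(i < n.+1) _; set N := n.+1%:R in n0 *; move=> zn p0; clearbody p N.
have E : 1 + z / N = (z + N) / N by field.
rewrite E; field.
by rewrite ?n0 ?zn ?p0.
Qed.

Lemma ln_step (n : nat) : (0 < n)%N ->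
  n.+1%:R^-1 <= ln (n.+1%:R : R) - ln n%:R <= n%:R^-1.
Proof.
move=> n0; have n0' : 0 < n%:R :> R by rewrite ltr0n.
have N0 : 0 < n.+1%:R :> R by [].
have NE : n.+1%:R = n%:R + 1 :> R by rewrite -natr1.
rewrite -ln_div ?posrE//; apply/andP; split.
  rewrite -lerN2 -lnV ?posrE ?divr_gt0// invf_div.
  have -> : n%:R / n.+1%:R = 1 + (- n.+1%:R^-1) :> R.
    by rewrite NE; field; rewrite -NE gt_eqF.
  by apply: le_ln1Dx; rewrite ltrN2 invf_lt1// ltr1n ltnS.
have -> : n.+1%:R / n%:R = 1 + n%:R^-1 :> R by rewrite NE; field; rewrite gt_eqF.
by apply: le_ln1Dx; rewrite (lt_trans (_ : -1 < 0))// invr_gt0.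
Qed.

(** The quotient of two successive terms is [exp (t z) / (1 + z / (n + 1))]
    with [t = ln (1 + 1 / n)], that is [1 + O (1 / n^2)]. *)
Lemma euler_step z : nonpole z -> exists C N, 0 <= C /\ forall n, (N <= n)%N ->
  cabs (euler n.+1 z - euler n z) <= C * (n.+1%:R^-1 - n.+2%:R^-1) * cabs (euler n z).
Proof.
move=> nz; pose c := cabs z; have c0 : 0 <= c by exact: cabs_ge0.
pose C := 2 * (48 * c ^+ 2 + 6 * c).
exists C, (maxn 1 (Num.bound (2 * c))); split.
  by rewrite mulr_ge0// addr_ge0// mulr_ge0// sqr_ge0.
move=> n; rewrite geq_max => /andP[n1 cn].
have n0 : 0 < n%:R :> R by rewrite ltr0n.
have N1 : 1 <= n%:R :> R by rewrite ler1n.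
have cn2 : 2 * c <= n%:R.
  rewrite ltW// (lt_le_trans (archi_boundP _))//; first by rewrite mulr_ge0.
  by rewrite ler_nat.
have /andP[t1 t2] := ln_step n1.
rewrite (eulerS n nz); set t := ln _ - ln _ in t1 t2 *.
have NE : n.+1%:R = n%:R + 1 :> R by rewrite -natr1.
have NE2 : n.+2%:R = n%:R + 2 :> R by rewrite -addn2 natrD.
rewrite NE2 NE in t1 *; set nn := n%:R in n0 N1 cn2 t1 t2 *.
have nn1 : 0 < nn + 1 by clear -n0; lra.
have nn2 : 0 < nn + 2 by clear -n0; lra.
have nC : (n.+1%:R : R[i]) = (nn + 1)%:C by rewrite -(rmorph_nat (real_complex R)) NE.
rewrite nC; set D := 1 + z / _; clearbody nn.
have cn1 : c / nn <= 2^-1 by rewrite ler_pdivrMr// mulrC; clear -cn2; lra.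
have zn : cabs (z / (nn + 1)%:C) <= 2^-1.
  rewrite cabsM cabsV cabs_real gtr0_norm// ler_pdivrMr//; clear -cn2; rewrite -/c; lra.
have D2 : 2^-1 <= cabs D.
  have : cabs 1 <= cabs D + cabs (z / (nn + 1)%:C).
    by rewrite -[X in cabs X <= _](addrK (z / (nn + 1)%:C)); exact: cabsB.
  by rewrite cabs1; clear -zn; lra.
have D0 : D != 0 by rewrite -cabs_gt0 (lt_le_trans _ D2).
have t0 : 0 <= t by rewrite (le_trans _ t1)// invr_ge0 ltW.
have wE : cabs (t%:C * z) = t * c by rewrite cabsM cabs_real ger0_norm.
have wn : t * c <= c / nn by rewrite mulrC ler_wpM2l.
have wq := @cexp_quad R (t%:C * z); rewrite wE in wq.
have {}wq := wq (le_trans wn cn1).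
pose d := (nn + 1)^-1 - (nn + 2)^-1.
have q1 : nn^-1 ^+ 2 <= 6 * d.
  rewrite /d -subr_ge0 (_ : _ - _ = (5 * nn ^+ 2 - 3 * nn - 2) / (nn ^+ 2 * (nn + 1) * (nn + 2))).
    apply: divr_ge0; last by rewrite !mulr_ge0 ?sqr_ge0// ltW.
    have : nn * 1 <= nn * nn by rewrite ler_wpM2l// ltW.
    by rewrite mulr1 -expr2; clear -N1; lra.
  by field; rewrite !gt_eqF.
have q2 : nn^-1 - (nn + 1)^-1 <= 6 * d.
  rewrite /d -subr_ge0 (_ : _ - _ = (5 * nn - 2) / (nn * (nn + 1) * (nn + 2))).
    by apply: divr_ge0; [clear -N1; lra|rewrite !mulr_ge0// ltW].
  by field; rewrite !gt_eqF.
have num : cabs (cexp (t%:C * z) - D) <= (48 * c ^+ 2 + 6 * c) * d.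
  have -> : cexp (t%:C * z) - D = (cexp (t%:C * z) - 1 - t%:C * z) + (t - (nn + 1)^-1)%:C * z.
    have iC : ((nn + 1)^-1)%:C = ((nn + 1)%:C)^-1 by rewrite fmorphV.
    have -> : (t - (nn + 1)^-1)%:C = t%:C - ((nn + 1)%:C)^-1.
      by rewrite -iC; apply: complexP => /=; ring.
    by rewrite /D; ring.
  apply: (le_trans (cabsD _ _)); rewrite mulrDl; apply: lerD.
    apply: (le_trans wq); apply: (@le_trans _ _ (8 * (c * nn^-1) ^+ 2)).
      by rewrite ler_pM2l//; apply: lerXn2r => //; rewrite nnegrE mulr_ge0// invr_ge0 ltW.
    have -> : 8 * (c / nn) ^+ 2 = 8 * c ^+ 2 * nn^-1 ^+ 2 by ring.
    have -> : 48 * c ^+ 2 * d = 8 * c ^+ 2 * (6 * d) by ring.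
    by rewrite ler_wpM2l// mulr_ge0// sqr_ge0.
  rewrite cabsM cabs_real ger0_norm ?subr_ge0// -/c mulrC -mulrA mulrCA ler_wpM2l//.
  by apply: le_trans q2; rewrite lerD2r.
have -> : euler n z * (cexp (t%:C * z) / D) - euler n z = (cexp (t%:C * z) - D) / D * euler n z.
  by field.
rewrite cabsM ler_wpM2r ?cabs_ge0// cabsM cabsV ler_pdivrMr ?cabs_gt0//.
apply: (le_trans num); rewrite /C -/d.
have X0 : 0 <= (48 * c ^+ 2 + 6 * c) * d by apply: le_trans num; exact: cabs_ge0.
rewrite (_ : 2 * _ * d * _ = ((48 * c ^+ 2 + 6 * c) * d) * (2 * cabs D)); last by ring.
by rewrite ler_peMr//; clear -D2; lra.
Qed.

Lemma Gamma_cvg z : nonpole z -> ccvg (euler^~ z) (Gamma z) /\ Gamma z != 0.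
Proof.
move=> nz; have [C [N [C0 H]]] := euler_step nz.
have [l cl l0] := product_cvg_neq0 C0 (fun n _ => euler_neq0 n nz) H.
by rewrite (GammaE cl).
Qed.

Lemma euler_quotient n w w' : nonpole w' ->
  euler n w / euler n w' = cpow n%:R (w - w') *
    \prod_(j < n.+1) ((w' + j%:R) / (w + j%:R)).
Proof.
move=> nw'; rewrite /euler prodf_div.
have -> : cpow n%:R (w - w') = cpow n%:R w / cpow n%:R w' :> R[i].
  by rewrite /cpow -cexpN -cexpD mulrBr.
have [->|w0] := eqVneq (\prod_(j < n.+1) (w + j%:R)) 0.
  by rewrite invr0 !mulr0 !mul0r.
have p0 := prod_nonpole n.+1 nw'; have f0 := fact_neq0 n; have c0 := cpow_neq0 n%:R w'.
by field; rewrite w0 p0 f0 c0.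
Qed.

Lemma prod_blocks (m n : nat) (f : nat -> R[i]) :
  \prod_(l < m * n) f l = \prod_(k < m) \prod_(j < n) f (m * j + k)%N.
Proof.
rewrite exchange_big /=; elim: n => [|n IH]; first by rewrite muln0 !big_ord0.
rewrite big_ord_recr -IH mulnS addnC big_split_ord /=; congr (_ * _).
Qed.

(** Gauss's multiplication formula, for a quotient of two Gamma values: the
    powers of [2 pi] cancel, and Euler's products suffice, those of the
    left-hand side for [n] being together the one of the right-hand side for [m
    (n + 1) - 1]. *)
Lemma Gamma_multiplication (m : nat) w w' : (0 < m)%N ->
  nonpole (m%:R * w) -> nonpole (m%:R * w') ->
  \prod_(k < m) (Gamma (w + k%:R / m%:R) / Gamma (w' + k%:R / m%:R)) =
  cpow m%:R (m%:R * (w' - w)) * (Gamma (m%:R * w) / Gamma (m%:R * w')).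
Proof.
move=> m0 nw nw'; have m0' : (m%:R : R[i]) != 0 by rewrite pnatr_eq0 -lt0n.
have shiftE (v : R[i]) (k j : nat) : m%:R * (v + k%:R / m%:R + j%:R) = m%:R * v + (m * j + k)%:R.
  by rewrite natrD natrM; field.
have np (v : R[i]) (k : nat) : nonpole (m%:R * v) -> nonpole (v + k%:R / m%:R).
  move=> nv j; have := nv (m * j + k)%N; rewrite -shiftE.
  by apply: contraNneq => ->; rewrite mulr0.
(* [m n + m - 1], the last index of [m] blocks of [n + 1] factors. *)
pose s := m%:R * (w - w'); pose N n := (m * n.+1).-1.
have NS n : (N n).+1 = (m * n.+1)%N by rewrite prednK// muln_gt0 m0.
have nN n : (n <= N n)%N by rewrite -ltnS NS leq_pmull.
have cX : ccvg (fun n => \prod_(k < m) (euler n (w + k%:R / m%:R) / euler n (w' + k%:R / m%:R)))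
    (\prod_(k < m) (Gamma (w + k%:R / m%:R) / Gamma (w' + k%:R / m%:R))).
  apply: (@ccvg_prod _ m (fun k n => euler n (w + k%:R / m%:R) / euler n (w' + k%:R / m%:R))
    (fun k => Gamma (w + k%:R / m%:R) / Gamma (w' + k%:R / m%:R))) => k _.
  have [c1 _] := Gamma_cvg (np _ k nw); have [c2 g2] := Gamma_cvg (np _ k nw').
  by apply: ccvgM => //; exact: ccvgV.
have cY : ccvg (fun n => euler (N n) (m%:R * w) / euler (N n) (m%:R * w'))
    (Gamma (m%:R * w) / Gamma (m%:R * w')).
  have [c1 _] := Gamma_cvg nw; have [c2 g2] := Gamma_cvg nw'.
  apply: (@ccvg_subseq _ (fun n => euler n (m%:R * w) / euler n (m%:R * w'))) => //.
  by apply: ccvgM => //; exact: ccvgV.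
have XY n : \prod_(k < m) (euler n (w + k%:R / m%:R) / euler n (w' + k%:R / m%:R)) =
    cexp ((ln n%:R - ln (N n)%:R)%:C * s) * (euler (N n) (m%:R * w) / euler (N n) (m%:R * w')).
  rewrite (euler_quotient _ _ nw') NS.
  rewrite (prod_blocks m n.+1 (fun l => (m%:R * w' + l%:R) / (m%:R * w + l%:R))).
  have E (k : 'I_m) : euler n (w + k%:R / m%:R) / euler n (w' + k%:R / m%:R) = cpow n%:R (w - w') *
      \prod_(j < n.+1) ((w' + k%:R / m%:R + j%:R) / (w + k%:R / m%:R + j%:R)).
    rewrite (euler_quotient _ _ (np _ _ nw')); congr (cpow _ _ * _).
    by rewrite opprD addrACA subrr addr0.
  under eq_bigr do rewrite E.
  rewrite big_split /= prodr_const card_ord mulrA; congr (_ * _).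
    rewrite /cpow -cexpMn -cexpD; congr cexp.
    by rewrite /s rmorphB /=; ring.
  apply: eq_bigr => k _; apply: eq_bigr => j _.
  by rewrite -!shiftE -mulf_div divff// mul1r.
have cE : ccvg (fun n => cexp ((ln n%:R - ln (N n)%:R)%:C * s)) (cpow m%:R (m%:R * (w' - w))).
  have cln : (fun n => ln n%:R - ln (N n)%:R : R) @ \oo --> - ln m%:R.
    rewrite -cvg_shiftS /=.
    have cq : (fun n => (N n.+1)%:R / n.+1%:R : R) @ \oo --> (m%:R + (m%:R - 1) * 0 : R).
      rewrite (_ : (fun n => _) = fun n => m%:R + (m%:R - 1) * n.+1%:R^-1); last first.
        apply/funext => n; have -> : (N n.+1)%:R = m%:R * n.+1%:R + (m%:R - 1) :> R.
          rewrite -[LHS](addrK 1) natr1 NS natrM -natr1; ring.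
        have n0 : (n.+1%:R : R) != 0 by rewrite pnatr_eq0.
        by move: n0; set q := n.+1%:R => n0; field.
      by apply: cvgD; [exact: cvg_cst|apply: cvgM; [exact: cvg_cst|exact: cvg_harmonic]].
    rewrite mulr0 addr0 in cq.
    have mR : 0 < m%:R :> R by rewrite ltr0n.
    have cl : (fun n => - ln ((N n.+1)%:R / n.+1%:R) : R) @ \oo --> - ln m%:R.
      by apply: cvgN; exact: (cvg_comp _ _ cq (continuous_ln mR)).
    apply: cvg_trans cl; apply: near_eq_cvg; near=> n => /=.
    have N0 : 0 < (N n.+1)%:R :> R by rewrite ltr0n (leq_trans _ (nN _)).
    by rewrite ln_div ?posrE// opprB.
  have lE : cpow m%:R (m%:R * (w' - w)) = cexp ((- ln m%:R)%:C * s).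
    by rewrite /cpow /s rmorphN /=; congr cexp; ring.
  rewrite lE; apply/cvgrPdist_le => e e0.
  have [d d0 D] := cdiff_cont (cdiff_cexp ((- ln m%:R)%:C * s)) e0.
  have s1 : 0 < cabs s + 1 by rewrite ltr_wpDl// cabs_ge0.
  have ds : 0 < d / (cabs s + 1) by rewrite divr_gt0.
  move/cvgrPdist_lt : cln => /(_ _ ds); apply: filterS => n.
  rewrite ltr_pdivlMr// => h; rewrite sub0r normrN ger0_norm ?cabs_ge0//.
  apply: D; rewrite -mulrBl -rmorphB cabsM cabs_real distrC; apply: le_lt_trans h.
  by rewrite ler_wpM2l// lerDl.
apply: (ccvg_unique cX).
by under eq_fun do rewrite XY; exact: ccvgM.
Unshelve. all: by end_near. Qed.

End GammaFunction.

Section ProductFormula.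
Variable R : realType.
Implicit Types z : R[i].

Lemma cpow_div (a b : R) z : 0 < a -> 0 < b -> cpow (a / b) z = cpow a z / cpow b z.
Proof.
move=> a0 b0; rewrite /cpow ln_div ?posrE// rmorphB /= -cexpN -cexpD.
by congr cexp; ring.
Qed.

Lemma cpowX (a : R) z n : cpow a z ^+ n = cpow a (n%:R * z).
Proof. by rewrite /cpow -cexpMn mulrCA. Qed.

Lemma cpow_quotient (a : R) z w : cpow a z / cpow a w = cpow a (z - w).
Proof. by rewrite /cpow -cexpN -cexpD mulrBr. Qed.

Lemma Gamma_block_pole (m j : nat) z : (0 < m)%N -> m%:R * z + j%:R = 0 ->
  Gamma (z + (j %% m)%:R / m%:R) = 0.
Proof.
move=> m0 zj; apply: (@Gamma_pole _ _ (j %/ m)).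
have m0' : (m%:R : R[i]) != 0 by rewrite pnatr_eq0 -lt0n.
have := zj; rewrite {1}(divn_eq j m) natrD natrM => E.
apply: (mulfI m0'); rewrite mulr0 -E; by field.
Qed.

(** Off the poles this is Gauss's multiplication formula.  When [z / 2] or [(1
    - z) / 2] is a pole [- j] of [Gamma], both sides are 0, for on the left the
    factor whose index is the residue of [j] modulo [m] has a pole too. *)
Lemma prod_rho (m : nat) z : (0 < m)%N -> \prod_(k < m) rho_mk m k z = rho_infty z.
Proof.
move=> m0; have m0' : (m%:R : R[i]) != 0 by rewrite pnatr_eq0 -lt0n.
have mE (v : R[i]) : m%:R * (v / (2%:R * m%:R)) = v / 2%:R by field.
have npE (v : R[i]) : nonpole v \/ exists j : nat, v + j%:R = 0.
  have [[j vj]|H] := pselect (exists j : nat, v + j%:R = 0); first by right; exists j.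
  by left => j; apply/eqP => vj; apply: H; exists j.
rewrite /rho_mk /phi_mk /gamma_mk /rho_infty.
case: (npE (z / 2%:R)) => [nz|[j zj]]; last first.
  rewrite (Gamma_pole zj) mulr0 mul0r.
  rewrite (bigD1 (Ordinal (ltn_pmod j m0)))//=.
  by rewrite Gamma_block_pole ?mE// mul0r mulr0 mul0r.
case: (npE ((1 - z) / 2%:R)) => [nz'|[j zj]]; last first.
  rewrite (Gamma_pole zj) mulr0 invr0 mulr0.
  rewrite (bigD1 (Ordinal (ltn_pmod j m0)))//=.
  by rewrite (Gamma_block_pole (z := (1 - z) / _)) ?mE// invr0 !mulr0 mul0r.
rewrite big_split /= Gamma_multiplication ?mE// prodr_const card_ord cpowX.
rewrite cpow_div ?pi_gt0 ?ltr0n//.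
set G := Gamma (z / 2%:R); set G' := Gamma ((1 - z) / 2%:R).
rewrite [X in _ = _ * X]invfM [RHS]mulrACA [X in _ = X * _]cpow_quotient.
have -> : m%:R * (1 / (2%:R * m%:R) - z / m%:R) = (1 - z) / 2 - z / 2 :> R[i] by field.
have -> : - z / 2 - - (1 - z) / 2 = (1 - z) / 2 - z / 2 :> R[i] by field.
have -> : m%:R * ((1 - z) / (2%:R * m%:R) - z / (2%:R * m%:R)) = (1 - z) / 2 - z / 2.
  by rewrite mulrBr !mE.
by rewrite [LHS]mulrA divfK// cpow_neq0.
Qed.

End ProductFormula.

(** * Dominated convergence and extraction of subsequences *)

Section DominatedConvergence.
Variable R : realType.
Local Notation mu := (@lebesgue_measure R).
Implicit Types (a b : nat -> R[i]) (l z : R[i]) (B : nat -> R).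

Lemma ccvg_le a l (C : R) : ccvg a l -> (forall n, cabs (a n) <= C) -> cabs l <= C.
Proof.
move=> /ccvg_epsP H aC; apply/ler_addgt0Pr => e e0.
have [N HN] := H e e0; have := HN N (leqnn N); rewrite cabs_dist => h.
rewrite -[X in cabs X](subrK (a N)) addrC.
by rewrite (le_trans (cabsD _ _))// lerD.
Qed.

Lemma ccvgD a b l l' : ccvg a l -> ccvg b l' -> ccvg (fun n => a n + b n) (l + l').
Proof. by move=> /ccvgP ca /ccvgP cb; apply/ccvgP; exact: (@cvgD R[i] R[i]^o nat \oo _ a b l l' ca cb). Qed.

Lemma ccvgN a l : ccvg a l -> ccvg (fun n => - a n) (- l).
Proof. by move=> /ccvgP ca; apply/ccvgP; exact: (@cvgN R[i] R[i]^o nat \oo _ a l ca). Qed.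

Lemma ccvgB a b l l' : ccvg a l -> ccvg b l' -> ccvg (fun n => a n - b n) (l - l').
Proof. by move=> ca cb; apply: ccvgD => //; exact: ccvgN. Qed.

Definition csum a : R[i] := lim ((fun n : nat => \sum_(j < n) a j : R[i]^o) @ \oo).

Lemma csum_finite a (n : nat) : (forall j, (n <= j)%N -> a j = 0) -> csum a = \sum_(j < n) a j.
Proof.
move=> a0; apply: ccvg_lim; apply: ccvg_near (ccvg_cst _); exists n => // N /= nN.
rewrite -!(big_mkord xpredT a) (big_cat_nat (leq0n n) nN) //=.
rewrite [X in _ = _ + X](_ : _ = 0) ?addr0// big_nat_cond big1// => j /andP[/andP[nj _] _].
exact: a0.
Qed.

Lemma cvg_series_abs (u : nat -> R) B : cvgn (series B) -> (forall j, `|u j| <= B j) ->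
  cvgn (series u).
Proof.
move=> cB uB; apply: normed_cvg.
apply: (@series_le_cvg _ _ B) => // [j|j]; first exact: normr_ge0.
exact: le_trans (normr_ge0 _) (uB j).
Qed.

Lemma csum_cvg a B : cvgn (series B) -> (forall j, cabs (a j) <= B j) ->
  ccvg (fun n => \sum_(j < n) a j) (csum a).
Proof.
move=> cB aB.
have [x cx] : exists x : R, series (fun j => complex.Re (a j)) @ \oo --> x.
  by apply/cvg_ex; apply: (cvg_series_abs cB) => j; rewrite (le_trans (Re_le_cabs _)).
have [y cy] : exists y : R, series (fun j => complex.Im (a j)) @ \oo --> y.
  by apply/cvg_ex; apply: (cvg_series_abs cB) => j; rewrite (le_trans (Im_le_cabs _)).
suff H : ccvg (fun n => \sum_(j < n) a j) (x +i* y) by rewrite /csum (ccvg_lim H).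
apply: ccvg_ReIm.
  apply: cvg_trans cx; apply: near_eq_cvg; apply: nearW => n.
  by rewrite /series /= big_mkord; elim/big_ind2: _ => //= z1 r1 z2 r2 -> ->; rewrite ReD.
apply: cvg_trans cy; apply: near_eq_cvg; apply: nearW => n.
by rewrite /series /= big_mkord; elim/big_ind2: _ => //= z1 r1 z2 r2 -> ->; rewrite ImD.
Qed.

Lemma csum_tail a B N : cvgn (series B) -> (forall j, cabs (a j) <= B j) ->
  cabs (csum a - \sum_(j < N) a j) <= limn (series B) - series B N.
Proof.
move=> cB aB.
have B0 j : 0 <= B j := le_trans (cabs_ge0 _) (aB j).
have c1 := ccvgB (csum_cvg cB aB) (ccvg_cst (\sum_(j < N) a j)).
have c2 := @ccvg_subseq _ _ _ (addn N) (fun n => leq_addl N n) c1.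
apply: (ccvg_le c2) => n /=.
rewrite -!(big_mkord xpredT a) (big_cat_nat (leq0n N) (leq_addr n N)) //= addrAC subrr add0r.
apply: (le_trans (cabs_sum _ _ _)).
apply: (@le_trans _ _ (\sum_(N <= j < N + n) B j)); first by apply: ler_sum => j _.
rewrite lerBrDl [X in X + _]/series /= -big_cat_nat//= ?leq_addr//.
apply: (nondecreasing_cvgn_le _ cB); exact: nondecreasing_series.
Qed.

(** Dominated convergence for series (Tannery). *)
Lemma csum_dominated (a : nat -> nat -> R[i]) b B : cvgn (series B) ->
  (forall n j, cabs (a n j) <= B j) -> (forall j, ccvg (a^~ j) (b j)) ->
  ccvg (fun n => csum (a n)) (csum b).
Proof.
move=> cB aB ab; have bB j : cabs (b j) <= B j by apply: (ccvg_le (ab j)) => n; exact: aB.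
apply/ccvg_epsP => e e0; have e3 : 0 < e / 3 by rewrite divr_gt0.
have /cvgrPdist_le/(_ _ e3)[N _ HN] := cB.
have tail (d : nat -> R[i]) : (forall j, cabs (d j) <= B j) ->
    cabs (csum d - \sum_(j < N) d j) <= e / 3.
  move=> dB; apply: (le_trans (csum_tail N cB dB)).
  by apply: le_trans (HN N (leqnn N)); exact: ler_norm.
have : ccvg (fun n => \sum_(j < N) a n j) (\sum_(j < N) b j).
  elim: (N) => [|M IH].
    by under eq_fun do rewrite big_ord0; rewrite big_ord0; exact: ccvg_cst.
  by under eq_fun do rewrite big_ord_recr; rewrite big_ord_recr; exact: ccvgD.
move=> /ccvg_epsP/(_ _ e3)[N' H']; exists N' => n Nn.
have -> : csum (a n) - csum b = (csum (a n) - \sum_(j < N) a n j) +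
    (\sum_(j < N) a n j - \sum_(j < N) b j) - (csum b - \sum_(j < N) b j) by ring.
rewrite (le_trans (cabsB _ _))// (_ : e = e / 3 + e / 3 + e / 3); last by field.
by apply: lerD; [rewrite (le_trans (cabsD _ _))// lerD ?tail ?H'|exact: tail].
Qed.

Lemma L2cvg_dominated (f : nat -> R -> R[i]) g h : L2 h ->
  (forall n, cmeasurable (f n)) ->
  (forall y, ccvg (f^~ y) (g y)) -> (forall n y, cabs (f n y) <= cabs (h y)) ->
  L2 g /\ L2cvg f g.
Proof.
move=> [mh h2] mf fg fh.
have mg : cmeasurable g := cmeas_cvg mf fg.
have gh y : cabs (g y) <= cabs (h y) by apply: (ccvg_le (fg y)) => n; exact: fh.
have L2g : L2 g.
  split => //; apply: le_lt_trans h2.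
  have := @sqL2norm_le1 _ g h 1 ler01 mg mh; rewrite expr1n mul1e; apply => y.
  by rewrite mul1r.
split => //; rewrite /L2cvg /sqL2norm.
pose F n y := ((complex.Re `|f n y - g y|) ^+ 2)%:E : \bar R.
pose G y := (4 * cabs (h y) ^+ 2)%:E : \bar R.
have mF n : measurable_fun setT (F n).
  by apply/measurable_EFinP; exact: measurable_cabs2 (cmeasB (mf n) mg).
have cF : {ae mu, forall y, setT y -> F^~ y @ \oo --> cst (0 : \bar R) y}.
  apply: aeW => y _; rewrite /F /=.
  apply: cvg_EFin; first by apply: nearW.
  have := fg y; rewrite /ccvg => c; rewrite -[0](expr0n R 2).
  exact: (cvg_comp _ _ c (@exprn_continuous _ 2 0)).
have iG : mu.-integrable setT G.
  apply/integrableP; split.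
    by apply/measurable_EFinP; apply: measurable_funM => //; exact: measurable_cabs2.
  have -> : (\int[mu]_y `|G y| = 4%:E * sqL2norm h)%E.
    rewrite -(@integral_scale_cabs2 _ h 4)//; apply: eq_integral => y _.
    by rewrite /G gee0_abs// lee_fin mulr_ge0// sqr_ge0.
  by rewrite lte_mul_pinfty// lee_fin.
have FG : {ae mu, forall y n, setT y -> (`|F n y| <= G y)%E}.
  apply: aeW => y n _; rewrite /F /G gee0_abs ?lee_fin ?sqr_ge0//.
  have -> : 4 * cabs (h y) ^+ 2 = (2 * cabs (h y)) ^+ 2 by ring.
  apply: lerXn2r; rewrite ?nnegrE ?mulr_ge0 ?cabs_ge0//.
  apply: (le_trans (cabsB _ _)); rewrite mulr_natl mulr2n.
  exact: lerD (fh n y) (gh y).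
have [_ _] := @dominated_convergence _ _ R mu setT measurableT F (cst 0%E) G mF (measurable_cst _) cF iG FG.
by rewrite integral0.
Qed.

End DominatedConvergence.

Section DiagonalSubsequence.
Variable R : realType.

Lemma ultra_bounded_lim (U : set_system nat) (UU : UltraFilter U) (x : nat -> R) (M : R) :
  (forall n, `|x n| <= M) -> exists p, forall e, 0 < e -> U [set n | `|x n - p| <= e].
Proof.
move=> xM; have PU : ProperFilter (x @ U) by apply: fmap_proper_filter; exact: ultra_proper.
have Ix : (x @ U) [set` `[- M, M]].
  by apply: (@filterS _ U _ setT); [move=> n _ /=; rewrite in_itv /= -ler_norml|exact: filterT].
have [p [_ clp]] := @segment_compact R (- M) M (x @ U) PU Ix.
exists p => e e0; have [//|nU] := in_ultra_setVsetC [set n | `|x n - p| <= e] UU.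
have /= Bp : nbhs p (ball p e) by exact: nbhsx_ballx.
have [q [/= h pq]] := clp (~` [set r : R | `|r - p| <= e]) (ball p e) nU Bp.
by exfalso; apply: h; move: pq; rewrite /ball /= distrC => /ltW.
Qed.

(** Bounded sequences indexed by [j] have limits along one common ultrafilter;
    picking [e n] in the set of this ultrafilter on which the first [n] of them
    are close to their limits spares an iterated extraction of subsequences. *)
Lemma diagonal_subsequence (v : nat -> nat -> R[i]) (M : R) :
  (forall n j, cabs (v n j) <= M) ->
  exists e : nat -> nat, {homo e : i j / (i < j)%N} /\
    exists l : nat -> R[i], forall j, ccvg (fun n => v (e n) j) (l j).
Proof.
move=> vM.
have [U [UU oU]] := @ultraFilterLemma _ \oo _.
have /choice[r hr] : forall j, exists p, forall e, 0 < e ->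
    U [set n | `|complex.Re (v n j) - p| <= e].
  by move=> j; apply: (ultra_bounded_lim UU (M := M)) => n; rewrite (le_trans (Re_le_cabs _)).
have /choice[s hs] : forall j, exists p, forall e, 0 < e ->
    U [set n | `|complex.Im (v n j) - p| <= e].
  by move=> j; apply: (ultra_bounded_lim UU (M := M)) => n; rewrite (le_trans (Im_le_cabs _)).
pose l j := r j +i* s j.
have near_l (i : nat) : U [set n | forall j, (j < i)%N -> cabs (v n j - l j) <= i.+1%:R^-1].
  have e0 : 0 < i.+1%:R^-1 / 2 :> R by rewrite divr_gt0// invr_gt0.
  have step j : U [set n | cabs (v n j - l j) <= i.+1%:R^-1].
    apply: filterS (filterI (hr j _ e0) (hs j _ e0)) => n /= [h1 h2].
    rewrite (le_trans (cabs_le _))// [leRHS]splitr; apply: lerD.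
      by move: h1; rewrite /l; case: (v n j).
    by move: h2; rewrite /l; case: (v n j).
  suff H : forall k, U [set n | forall j, (j < k)%N -> cabs (v n j - l j) <= i.+1%:R^-1] by exact: H.
  elim=> [|k IH]; first by apply: (@filterS _ U _ setT); [move=> n _ j|exact: filterT].
  apply: filterS (filterI IH (step k)) => n /= [h1 h2] j.
  by rewrite ltnS leq_eqVlt => /orP[/eqP->|/h1].
have pick (p : nat * nat) : exists n, (p.2 < n)%N /\
    forall j, (j < p.1)%N -> cabs (v n j - l j) <= p.1.+1%:R^-1.
  have Uo : U [set n | (p.2 < n)%N] by apply: oU; exists p.2.+1.
  by have [n [/= h1 h2]] := filter_ex (filterI Uo (near_l p.1)); exists n.
have [f hf] := choice pick.
pose e := fix e n := if n is n'.+1 then f (n'.+1, e n') else f (0%N, 0%N).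
exists e; split.
  apply: (homo_ltn ltn_trans) => n.
  by have [] := hf (n.+1, e n).
exists l => j; apply/ccvg_epsP => t t0.
exists (maxn j.+1 (Num.bound t^-1)) => -[|n]; rewrite geq_max => /andP[// jn tn].
have [_ /(_ j jn) h] := hf (n.+1, e n); apply: (le_trans h).
rewrite -[leRHS]invrK lef_pV2 ?posrE ?invr_gt0// ltW//.
apply: (lt_le_trans (archi_boundP _)); first by rewrite invr_ge0 ltW.
by rewrite ler_nat (leq_trans tn)// leqnSn.
Qed.

End DiagonalSubsequence.

(** * Hankel operators that factor through point evaluations *)

Section Projection.
Variable R : realType.
Local Notation mu := (@lebesgue_measure R).
Implicit Types (f g h b : R -> R[i]).

Lemma L2dot_self g : L2 g -> sqL2norm g = (complex.Re (L2dot g g))%:E.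
Proof.
move=> Lg; rewrite /L2dot cintegral_Re /Rintegral.
have -> : (\int[mu]_y (complex.Re (g y * (g y)^*))%:E = sqL2norm g)%E.
  by apply: eq_integral => y _; rewrite -/(cabs (g y)) sqr_cabs; case: (g y) => r s /=; congr EFin; ring.
rewrite fineK// ge0_fin_numE ?sqL2norm_ge0//; exact: Lg.2.
Qed.

Lemma L2dotB f g h : L2 f -> L2 g -> L2 h ->
  L2dot (fun y => f y - g y) h = L2dot f h - L2dot g h.
Proof.
move=> Lf Lg Lh; rewrite /L2dot; under eq_fun do rewrite mulrBl.
by rewrite cintegralB//; apply: cintegrable_mul => //; exact: L2J.
Qed.

Definition orth_H2 b := forall g, H2 g -> L2dot b g = 0.

(** This includes the case where [f] has no projection, the default value 0
    belonging to H^2. *)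
Lemma projH2_H2 f : H2 (projH2 f).
Proof.
rewrite /projH2; case: xgetP => [h -> [Hh _]//|_].
exact: H2_0.
Qed.

Lemma projH2_orth f : (exists2 h, H2 h & orth_H2 (fun y => f y - h y)) ->
  orth_H2 (fun y => f y - projH2 f y).
Proof.
move=> [h Hh oh]; rewrite /projH2; case: xgetP => [h' -> [_ h2]//|N].
by exfalso; apply: (N h); split.
Qed.

(** Two candidates for the projection differ by an element of H^2 orthogonal to
    itself. *)
Lemma projH2_unique f h : L2 f -> H2 h -> orth_H2 (fun y => f y - h y) ->
  sqL2norm (fun y => h y - projH2 f y) = 0%E.
Proof.
move=> Lf Hh oh; have o := projH2_orth (ex_intro2 _ _ h Hh oh).
have [Lh Lp] := (H2_L2 Hh, H2_L2 (projH2_H2 f)).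
have Hg : H2 (fun y => h y - projH2 f y) by apply: H2B => //; exact: projH2_H2.
rewrite L2dot_self; last exact: H2_L2.
have := L2dotB (L2B Lf Lp) (L2B Lf Lh) (H2_L2 Hg).
rewrite o// oh// subrr => E; rewrite -[X in complex.Re (L2dot X _)](_ : (fun y => f y - projH2 f y - (f y - h y)) = _).
  by rewrite E.
by apply/funext => y; ring.
Qed.

(** [q] being orthogonal to [f - q], its square norm is the product of [f] and
    [q], to which the inequality between means applies.  The argument gives
    some constant, here 16, which is all that compactness requires. *)
Lemma projH2_bounded f (A : R) : L2 f -> (sqL2norm f <= A%:E)%E ->
  (sqL2norm (projH2 f) <= (16 * A)%:E)%E.
Proof.
move=> Lf fA.
have A0 : 0 <= A by rewrite -lee_fin (le_trans _ fA)// sqL2norm_ge0.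
have [[h [Hh oh]]|N] := pselect (exists h, H2 h /\ orth_H2 (fun y => f y - h y)); last first.
  rewrite /projH2; case: xgetP => [h _ hh|_]; first by exfalso; apply: N; exists h.
  by rewrite sqL2norm0 lee_fin mulr_ge0.
have o := projH2_orth (ex_intro2 _ _ h Hh oh).
have Hp := projH2_H2 f; have Lp := H2_L2 Hp; set q := projH2 f in o Hp Lp *.
have E : L2dot q q = L2dot f q by have := L2dotB Lf Lp Lp; rewrite o// => /eqP; rewrite eq_sym subr_eq0 => /eqP.
have qE := L2dot_self Lp; set N := complex.Re _ in qE.
have qJ : (sqL2norm (fun y => (q y)^*) <= N%:E)%E.
  rewrite -qE; have := @sqL2norm_le1 _ (fun y => (q y)^*) q 1 ler01 (L2J Lp).1 Lp.1.
  by rewrite expr1n mul1e; apply => y; rewrite cabsJ mul1r.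
(* The weight 4 leaves on the right only half of the square norm [N] of [q]. *)
have := @cabs_cintegral_mul _ f (fun y => (q y)^*) A N 4 Lf.1 (L2J Lp).1 _ fA qJ.
rewrite -[cintegral _]/(L2dot f q) -E qE lee_fin => /(_ (ltr0n R 4)) h1.
have := Re_le_cabs (L2dot q q); rewrite -/N => /(le_trans (ler_norm _)) h2.
by have := le_trans h2 h1; clear; lra.
Qed.

End Projection.

Section HankelOperator.
Variable R : realType.
Local Notation mu := (@lebesgue_measure R).
Implicit Types (f g h u : R -> R[i]) (c l : nat -> R[i]) (B : nat -> R).
Variable p : nat -> R.
Hypothesis p_le0 : forall j, p j <= 0.

Let p_left j : complex.Re (p j)%:C < 2^-1.
Proof. by rewrite /=; apply: le_lt_trans (p_le0 j) _; rewrite invr_gt0. Qed.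

Let p_neq j : complex.Re (p j)%:C != 2^-1.
Proof. by rewrite lt_eqF. Qed.

Lemma cabs_ck_le0 j y : cabs (ck (p j)%:C y) <= cabs (ck 0 y).
Proof.
rewrite -(@ler_pXn2r _ 2)// ?nnegrE ?cabs_ge0// !sqr_cabs_ck /= !subr0.
have h2 : 0 < 2^-1 :> R by rewrite invr_gt0.
rewrite lef_pV2 ?posrE; first last.
- by rewrite ltr_wpDr ?sqr_ge0// exprn_gt0.
- by rewrite ltr_wpDr ?sqr_ge0// exprn_gt0// subr_gt0; exact: p_left j.
rewrite lerD2r; apply: lerXn2r; rewrite ?nnegrE; first exact: ltW.
  by rewrite subr_ge0; exact: ltW (p_left j).
by rewrite lerDl oppr_ge0.
Qed.

Lemma L2_ck0 : L2 (ck (0 : R[i])).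
Proof. by apply: L2_ck; rewrite /= eq_sym gt_eqF// invr_gt0. Qed.

(** The kernels at the points [p j] are dominated by the kernel at 0, whence a
    bound uniform in [j]. *)
Lemma cauchy_bounded : exists2 B0 : R, 0 <= B0 & forall h (A : R) j, L2 h ->
  (sqL2norm h <= A%:E)%E -> cabs (cauchy h (p j)%:C) <= A + B0.
Proof.
have [B0 B00 bB0] := L2_bound L2_ck0; exists B0 => // h A j Lh hA.
have cj : (sqL2norm (ck (p j)%:C) <= B0%:E)%E.
  apply: le_trans bB0; have := @sqL2norm_le1 _ (ck (p j)%:C) (ck 0) 1 ler01 (cmeas_ck (p_neq j)) L2_ck0.1.
  by rewrite expr1n mul1e; apply => y; rewrite mul1r cabs_ck_le0.
have := cabs_cintegral_mul Lh.1 (cmeas_ck (p_neq j)) ltr01 hA cj.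
rewrite invr1 !mul1r /cauchy cabsM cabs_real => h1.
have A0 : 0 <= A by rewrite -lee_fin (le_trans _ hA)// sqL2norm_ge0.
have p2 := pi_ge2 R.
rewrite ger0_norm; last by rewrite invr_ge0 mulr_ge0// pi_ge0.
rewrite ler_pdivrMl; last by rewrite mulr_gt0// pi_gt0.
apply: (le_trans h1); rewrite -mulrA ler_pM2l//.
by apply: ler_peMl; [exact: addr_ge0|exact: le_trans (ler1n _ 2) p2].
Qed.

(** The series of Cauchy kernels through which the Hankel operator factors; [l
    j] stands for the value at [p j] of its argument. *)
Definition kernel_sum c l y := csum (fun j => c j * l j * ck (p j)%:C y).

Variable B : nat -> R.
Hypothesis cvgB : cvgn (series B).
Hypothesis B_ge0 : forall j, 0 <= B j.

Lemma kernel_term c l (A : R) y j : (forall j, cabs (c j) <= B j) ->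
  (forall j, cabs (l j) <= A) ->
  cabs (c j * l j * ck (p j)%:C y) <= (A * cabs (ck 0 y)) * B j.
Proof.
move=> cB lA; rewrite !cabsM (_ : A * _ * _ = B j * A * cabs (ck 0 y)); last by ring.
by rewrite ler_pM ?mulr_ge0 ?cabs_ge0 ?cabs_ck_le0// ler_pM ?cabs_ge0.
Qed.

Lemma cvg_kernel_bound (A : R) : cvgn (series (fun j => A * B j)).
Proof. by apply: is_cvg_seriesZ. Qed.

Lemma kernel_sum_bound c l (A : R) y n : (forall j, cabs (c j) <= B j) ->
  (forall j, cabs (l j) <= A) ->
  cabs (\sum_(j < n) c j * l j * ck (p j)%:C y) <=
    cabs ((A * limn (series B))%:C * ck 0 y).
Proof.
move=> cB lA; apply: (le_trans (cabs_sum _ _ _)).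
have A0 : 0 <= A := le_trans (cabs_ge0 _) (lA 0%N).
have S0 : series B n <= limn (series B).
  by apply: (nondecreasing_cvgn_le _ cvgB); exact: nondecreasing_series.
have S1 : 0 <= series B n by exact: sumr_ge0.
rewrite cabsM cabs_real ger0_norm ?mulr_ge0//; last exact: le_trans S0.
apply: (@le_trans _ _ (A * cabs (ck 0 y) * series B n)).
  by rewrite /series /= mulr_sumr big_mkord; apply: ler_sum => j _; exact: kernel_term.
by rewrite mulrAC ler_wpM2r ?cabs_ge0// ler_wpM2l.
Qed.

Lemma kernel_sum_L2 c l (A : R) : (forall j, cabs (c j) <= B j) ->
  (forall j, cabs (l j) <= A) -> L2 (kernel_sum c l) /\
  L2cvg (fun n y => \sum_(j < n) c j * l j * ck (p j)%:C y) (kernel_sum c l).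
Proof.
move=> cB lA; apply: (L2cvg_dominated (L2Z (A * limn (series B))%:C L2_ck0)).
- move=> n; apply: cmeas_sum => j; apply: cmeasM; first exact: cmeas_cst.
  exact: cmeas_ck.
- move=> y; apply: (@csum_cvg _ (fun j => c j * l j * ck (p j)%:C y) _
    (@cvg_kernel_bound (A * cabs (ck 0 y)))) => j; exact: kernel_term.
- by move=> n y; exact: kernel_sum_bound.
Qed.

Lemma kernel_sum_cvg (c : nat -> nat -> R[i]) c0 (l : nat -> nat -> R[i]) l0 (A : R) :
  (forall n j, cabs (c n j) <= B j) -> (forall n j, cabs (l n j) <= A) ->
  (forall j, ccvg (c^~ j) (c0 j)) -> (forall j, ccvg (l^~ j) (l0 j)) ->
  L2 (kernel_sum c0 l0) /\ L2cvg (fun n => kernel_sum (c n) (l n)) (kernel_sum c0 l0).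
Proof.
move=> cB lA cc cl.
apply: (L2cvg_dominated (L2Z (A * limn (series B))%:C L2_ck0)).
- by move=> n; have [[]] := kernel_sum_L2 (cB n) (lA n).
- move=> y; apply: (@csum_dominated _ (fun n j => c n j * l n j * ck (p j)%:C y) _ _
    (@cvg_kernel_bound (A * cabs (ck 0 y)))).
    by move=> n j; exact: kernel_term.
  by move=> j; apply: ccvgM; [exact: ccvgM|exact: ccvg_cst].
- move=> n y; apply: (@ccvg_le _ (fun N => \sum_(j < N) c n j * l n j * ck (p j)%:C y)).
    apply: (@csum_cvg _ (fun j => c n j * l n j * ck (p j)%:C y) _
      (@cvg_kernel_bound (A * cabs (ck 0 y)))) => j; exact: kernel_term.
  by move=> N; exact: kernel_sum_bound.
Qed.

(** On the line the conjugate of a Cauchy kernel at [p j] is minus the kernel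
    at the mirror point [1 - p j], to which boundary values are orthogonal. *)
Lemma kernel_sum_orth c l (A : R) : (forall j, cabs (c j) <= B j) ->
  (forall j, cabs (l j) <= A) -> orth_H2 (kernel_sum c l).
Proof.
move=> cB lA g Hg; have Lg := H2_L2 Hg; have LJ := L2J Lg.
have [LK cK] := kernel_sum_L2 cB lA.
have Lc j : L2 (ck (p j)%:C) by exact: L2_ck.
have o1 j : L2dot (ck (p j)%:C) g = 0.
  rewrite /L2dot.
  have E y : ck (p j)%:C y * (g y)^* = (- 1 * (g y * ck (1 - (p j)%:C^*) y))^*.
    by rewrite mulN1r -mulrN -ckJ rmorphM /= conjCK mulrC.
  have q2 : 2^-1 < complex.Re (1 - (p j)%:C^*).
    by rewrite /= (@lt_le_trans _ _ 1)// ?invf_lt1 ?ltr1n// lerDl oppr_ge0.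
  have q3 : L2 (ck (1 - (p j)%:C^*)) by apply: L2_ck; rewrite gt_eqF.
  under eq_fun do rewrite E.
  rewrite cintegralJ; last by apply: cintegrableZ; exact: cintegrable_mul.
  by rewrite cintegralZ ?(H2_orth Hg)// ?mulr0 ?conjC0//; exact: cintegrable_mul.
have Ls n : L2 (fun y => \sum_(j < n) c j * l j * ck (p j)%:C y).
  elim: n => [|n IH]; first by under eq_fun do rewrite big_ord0; exact: L2_0.
  by under eq_fun do rewrite big_ord_recr; apply: L2D => //; exact: L2Z.
have os n : L2dot (fun y => \sum_(j < n) c j * l j * ck (p j)%:C y) g = 0.
  elim: n => [|n IH].
    have := L2dotB Lg Lg Lg; rewrite subrr => Z; rewrite -[RHS]Z; congr L2dot.
    by apply/funext => y; rewrite big_ord0 subrr.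
  rewrite /L2dot; under eq_fun do rewrite big_ord_recr /= mulrDl -[X in _ + X]mulrA.
  rewrite cintegralD; first last.
  - by apply: cintegrableZ; exact: cintegrable_mul.
  - exact: (cintegrable_mul (Ls n) LJ).
  rewrite -[X in X + _]/(L2dot _ g) IH cintegralZ ?add0r; last exact: cintegrable_mul.
  by rewrite -[cintegral _]/(L2dot _ g) o1 mulr0.
apply: cintegral_mul_closed => // e e0.
have /(cvge0P _ (fun n => sqL2norm_ge0 _))/(_ e e0)[N _ /(_ N (leqnn N)) h] := cK.
exists (fun y => \sum_(j < N) c j * l j * ck (p j)%:C y), 0; split => //.
- by rewrite sqL2norm_swap.
- exact: os.
- by rewrite subrr cabs0 ltW.
Qed.

End HankelOperator.

Section CompactHankel.
Variable R : realType.
Local Notation mu := (@lebesgue_measure R).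
Implicit Types (f g h u : R -> R[i]) (c l : nat -> R[i]).
Variable p : nat -> R.
Hypothesis p_le0 : forall j, p j <= 0.
Variable B : nat -> R.
Hypothesis cvgB : cvgn (series B).
Hypothesis B_ge0 : forall j, 0 <= B j.

Let values h j := cauchy h (p j)%:C.

Lemma values_bounded h : L2 h -> exists A : R, forall j, cabs (values h j) <= A.
Proof.
move=> Lh; have [A _ hA] := L2_bound Lh; have [B0 _ H] := cauchy_bounded p_le0.
by exists (A + B0) => j; exact: H.
Qed.

(** If [u h] differs from an element of H^2 by a kernel sum, for every [h] in
    H^2, then this kernel sum is the value of the Hankel operator, as it is
    orthogonal to H^2; and it depends only on the numbers [cauchy h (p j)], of
    which bounded sequences have convergent subsequences. *)
Lemma compact_hankel u c : cmeasurable u -> (forall y, cabs (u y) <= 1) ->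
  (forall j, cabs (c j) <= B j) ->
  (forall h, H2 h -> H2 (fun y => u y * h y - kernel_sum p c (values h) y)) ->
  compact_on_L2 (hankel u).
Proof.
move=> mu u1 cB D.
have LK h : L2 h -> L2 (kernel_sum p c (values h)).
  by move=> Lh; have [A hA] := values_bounded Lh; have [] := kernel_sum_L2 p_le0 cvgB B_ge0 cB hA.
have oK h : L2 h -> orth_H2 (kernel_sum p c (values h)).
  by move=> Lh; have [A hA] := values_bounded Lh; exact: (kernel_sum_orth p_le0 cvgB B_ge0 cB hA).
have Lv f : L2 (fun y => u y * projH2 f y).
  by apply: (L2_mul_bounded mu u1); exact/H2_L2/projH2_H2.
have LH f : L2 (hankel u f).
  by apply: L2B => //; exact/H2_L2/projH2_H2.
have HK f : sqL2norm (fun y => hankel u f y - kernel_sum p c (values (projH2 f)) y) = 0%E.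
  have Hp := projH2_H2 f; have Lp := H2_L2 Hp.
  rewrite -(@projH2_unique _ _ (fun y => u y * projH2 f y - kernel_sum p c (values (projH2 f)) y) (Lv f)).
  - by congr sqL2norm; apply/funext => y; rewrite /hankel; ring.
  - exact: D.
  - rewrite (_ : (fun y => _) = kernel_sum p c (values (projH2 f))); first exact: oK.
    by apply/funext => y; ring.
split => [f _|s Ls [M sM]]; first exact: LH.
have [B0 _ HB] := cauchy_bounded p_le0.
pose q n := projH2 (s n).
have Lq n : L2 (q n) by exact/H2_L2/projH2_H2.
have qM n j : cabs (values (q n) j) <= 16 * M + B0.
  by apply: HB; [exact: Lq|exact: projH2_bounded].
have [e [e_inc [l cl]]] := diagonal_subsequence qM.
exists e; split => //.
have [LG cG] := kernel_sum_cvg p_le0 cvgB B_ge0 (fun n => cB) (fun n => qM (e n))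
  (fun j => ccvg_cst (c j)) cl.
exists (kernel_sum p c l) => //.
apply/(cvge0P _ (fun n => sqL2norm_ge0 _)) => t t0.
have t2 : 0 < t / 2 by rewrite divr_gt0.
have /(cvge0P _ (fun n => sqL2norm_ge0 _))/(_ _ t2) := cG.
apply: filterS => n hn.
have m1 : cmeasurable (fun y => hankel u (s (e n)) y - kernel_sum p c (values (q (e n))) y).
  by apply: cmeasB; [exact: (LH _).1|exact: (LK _ (Lq _)).1].
have m2 : cmeasurable (fun y => kernel_sum p c (values (q (e n))) y - kernel_sum p c l y).
  by apply: cmeasB; [exact: (LK _ (Lq _)).1|exact: LG.1].
rewrite (_ : (fun y => _) = fun y => (hankel u (s (e n)) y - kernel_sum p c (values (q (e n))) y)
   + (kernel_sum p c (values (q (e n))) y - kernel_sum p c l y)); last by apply/funext => y; ring.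
apply: (le_trans (sqL2normD m1 m2)); rewrite HK mule0 add0e.
rewrite (_ : t = 2 * (t / 2)); last by field.
by rewrite EFinM lee_pmul2l ?lte_fin.
Qed.

(** The decomposition supposed in [compact_hankel] passes to limits of symbols,
    H^2 being closed. *)
Lemma kernel_sum_limit (un : nat -> R -> R[i]) u (cn : nat -> nat -> R[i]) c h N :
  (forall n, cmeasurable (un n)) -> (forall n y, cabs (un n y) <= 1) ->
  (forall y, ccvg (un^~ y) (u y)) ->
  (forall n j, cabs (cn n j) <= B j) -> (forall j, ccvg (cn^~ j) (c j)) ->
  (forall n, (N <= n)%N -> H2 (fun y => un n y * h y - kernel_sum p (cn n) (values h) y)) ->
  H2 h -> H2 (fun y => u y * h y - kernel_sum p c (values h) y).
Proof.
move=> mun un1 cu cnB cc Hn Hh; have Lh := H2_L2 Hh.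
have [A hA] := values_bounded Lh.
have [LK cK] := kernel_sum_cvg p_le0 cvgB B_ge0 cnB (fun=> hA) cc (fun j => ccvg_cst (values h j)).
have LKn n : L2 (kernel_sum p (cn n) (values h)).
  by have [] := kernel_sum_L2 p_le0 cvgB B_ge0 (cnB n) hA.
have Lun n : L2 (fun y => un n y * h y) by exact: (L2_mul_bounded (mun n) (un1 n)).
have [Lu cuh] : L2 (fun y => u y * h y) /\ L2cvg (fun n y => un n y * h y) (fun y => u y * h y).
  apply: (L2cvg_dominated Lh) => [n|y|n y]; first exact: (Lun n).1.
  - by apply: ccvgM; [exact: cu|exact: ccvg_cst].
  - by rewrite cabsM ler_piMl ?cabs_ge0.
apply: H2_closed; first exact: L2B.
move=> e e0; have e4 : 0 < e / 4 by rewrite divr_gt0.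
have /(cvge0P _ (fun n => sqL2norm_ge0 _))/(_ _ e4)[N1 _ H1] := cuh.
have /(cvge0P _ (fun n => sqL2norm_ge0 _))/(_ _ e4)[N2 _ H2'] := cK.
pose n := maxn N (maxn N1 N2).
exists (fun y => un n y * h y - kernel_sum p (cn n) (values h) y).
  by apply: Hn; rewrite leq_maxl.
have h1 := H1 n; have h2 := H2' n.
rewrite /= !leq_max !leqnn ?orbT in h1 h2.
have {}h1 := h1 isT; have {}h2 := h2 isT.
rewrite sqL2norm_swap in h1.
have m1 : cmeasurable (fun y => u y * h y - un n y * h y) by apply: cmeasB; [exact: Lu.1|exact: (Lun n).1].
have m2 : cmeasurable (fun y => kernel_sum p (cn n) (values h) y - kernel_sum p c (values h) y).
  by apply: cmeasB; [exact: (LKn n).1|exact: LK.1].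
rewrite (_ : (fun y => _) = fun y => (u y * h y - un n y * h y)
   + (kernel_sum p (cn n) (values h) y - kernel_sum p c (values h) y)); last by apply/funext => y; ring.
apply: (le_trans (sqL2normD m1 m2)).
rewrite (_ : e = 2 * (e / 4) + 2 * (e / 4)); last by field.
by rewrite [leRHS]EFinD !EFinM; apply: leeD; rewrite lee_pmul2l ?lte_fin.
Qed.

End CompactHankel.

(** * Partial fractions and estimates for Euler's products *)

Section PartialFractions.
Variable F : fieldType.
Variables (p d : nat -> F).
Hypothesis p_inj : injective p.

Let f j z := - 1 + d j / (z - p j).

(** The residue at [p j] of the product over [i < n] of the [f i]. *)
Definition residue n j := d j * \prod_(i < n | i != j :> nat) f i (p j).

(** One more factor multiplies the old residues by its values at the old poles,
    and the new residue is [d n] times the value at the new pole of the old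
    product. *)
Lemma partial_fractions n z : (forall j, (j < n)%N -> z != p j) ->
  \prod_(j < n) f j z = (- 1) ^+ n + \sum_(j < n) residue n j / (z - p j).
Proof.
elim: n z => [|n IH] z zp; first by rewrite !big_ord0 expr0 addr0.
have zn : z - p n != 0 by rewrite subr_eq0 zp.
have res_old (j : 'I_n) : residue n.+1 j = residue n j * f n (p j).
  by rewrite /residue big_mkcond big_ord_recr /= -big_mkcond gtn_eqF//= mulrA.
have res_new : residue n.+1 n = d n * ((- 1) ^+ n + \sum_(j < n) residue n j / (p n - p j)).
  rewrite -IH; last by move=> j jn; rewrite (inj_eq p_inj) gtn_eqF.
  rewrite /residue big_mkcond big_ord_recr /= eqxx mulr1; congr (_ * _).
  by apply: eq_bigr => i _; rewrite ltn_eqF.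
rewrite big_ord_recr /= IH; last by move=> j jn; apply: zp; rewrite ltnS ltnW.
rewrite [in RHS]big_ord_recr /= res_new exprSr.
set X := \sum_(j < n) _; set W := \sum_(i < n) _; set Y := \sum_(j < n) _.
have -> : W = X * f n z - Y * (d n / (z - p n)).
  rewrite !mulr_suml -sumrB; apply: eq_bigr => j _.
  rewrite res_old /f; have zj : z - p j != 0 by rewrite subr_eq0 zp// ltnS ltnW.
  have nj : p n - p j != 0 by rewrite subr_eq0 (inj_eq p_inj) gtn_eqF.
  have jn : p j - p n != 0 by rewrite subr_eq0 (inj_eq p_inj) ltn_eqF.
  by field; rewrite zn zj nj jn.
by rewrite /f; field.
Qed.

End PartialFractions.

Section EulerEstimates.
Variable R : realType.
Implicit Types (z w : R[i]) (x : R).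

Lemma nonpole_right z : 0 < complex.Re z -> nonpole z.
Proof.
move=> z0 j; apply/eqP => /(congr1 (@complex.Re R)); rewrite ReD.
have -> : complex.Re (j%:R : R[i]) = j%:R by rewrite -(rmorph_nat (real_complex R)).
by move/eqP; rewrite gt_eqF// ltr_wpDr.
Qed.

Lemma cabs_cpow (a x : R) : cabs (cpow a x%:C) = expR (ln a * x).
Proof. by rewrite /cpow -rmorphM /= cexp_real cabs_real ger0_norm ?expR_ge0. Qed.

(** On the positive axis Euler's products increase from the first one on. *)
Lemma euler_inv_le n x : 0 < x -> (cabs (euler n x%:C))^-1 <= x * (1 + x).
Proof.
move=> x0; have nx : nonpole x%:C by exact: nonpole_right.
have E0 : cabs (euler 0 x%:C) = x^-1.
  rewrite /euler fact0 mul1r cabsM cabs_cpow ln0// mul0r expR0 mul1r big_ord1 addr0.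
  by rewrite cabsV cabs_real gtr0_norm.
have ES k : (cabs (euler k.+1 x%:C))^-1 =
    (cabs (euler k x%:C))^-1 * ((1 + x / k.+1%:R) / expR ((ln k.+1%:R - ln k%:R) * x)).
  rewrite eulerS// cabsM [X in _ * X]cabsM cabsV invfM invfM invrK; congr (_ * _).
  rewrite cabs_cexp ReM /= mulr0 subr0 mulrC; congr (_ / _).
  rewrite -(rmorph_nat (real_complex R)) -fmorphV -rmorphM -(rmorph1 (real_complex R)) -rmorphD.
  by rewrite cabs_real ger0_norm// addr_ge0// divr_ge0// ltW.
have i0 k : 0 <= (cabs (euler k x%:C))^-1 by rewrite invr_ge0 cabs_ge0.
case: n => [|n].
  by rewrite E0 invrK ler_peMr ?lerDl// ltW.
elim: n => [|n IH].
  by rewrite ES E0 invrK ln1 ln0// subr0 mul0r expR0 !divr1.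
apply: le_trans IH; rewrite ES ler_piMr//.
rewrite ler_pdivrMr ?expR_gt0// mul1r (le_trans (expR_ge1Dx _))// ler_expR mulrC.
by apply: ler_wpM2r; [exact: ltW|have /andP[] := @ln_step R n.+1 isT].
Qed.

Lemma ccvg_invn : ccvg (fun n => n%:R^-1 : R[i]) 0.
Proof.
apply/ccvg_epsP => e e0; exists (Num.bound e^-1) => n en.
rewrite subr0 cabsV cabs_nat.
have e1 : 0 < e^-1 by rewrite invr_gt0.
have ne : e^-1 < n%:R by rewrite (lt_le_trans (archi_boundP (ltW e1)))// ler_nat.
by rewrite -[leRHS]invrK lef_pV2 ?posrE// ?(lt_trans e1)// ltW.
Qed.

Lemma ccvg_ffact j : ccvg (fun n => (n ^_ j)%:R / n%:R ^+ j : R[i]) 1.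
Proof.
elim: j => [|j IH].
  by under eq_fun do rewrite ffactn0 expr0 divr1; exact: ccvg_cst.
have := ccvgM IH (ccvgB (ccvg_cst 1) (ccvgM (ccvg_cst j%:R) ccvg_invn)).
rewrite mulr0 subr0 mulr1; apply: ccvg_near; exists j.+1 => // n /= jn.
have n0 : (n%:R : R[i]) != 0 by rewrite pnatr_eq0 -lt0n (leq_trans _ jn).
rewrite ffactnSr exprSr natrM natrB; last exact: ltnW.
have nj : n%:R ^+ j != 0 :> R[i] by rewrite expf_neq0.
by field; rewrite n0 nj.
Qed.

Lemma ffact_le n j : cabs ((n ^_ j)%:R / n%:R ^+ j) <= 1 :> R.
Proof.
rewrite cabsM cabsV cabsX !cabs_nat.
have [->|n0] := posnP n; first by case: j => [|j]; rewrite ?expr0 ?divr1// ffact0n mul0r.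
rewrite ler_pdivrMr ?exprn_gt0 ?ltr0n// mul1r -natrX ler_nat.
elim: j => [|j IH]; first by rewrite ffactn0 expn0.
by rewrite ffactnSr expnSr leq_mul// leq_subr.
Qed.

Lemma prod_differences j k :
  \prod_(i < (j + k).+1 | i != j :> nat) (i%:R - j%:R) = (- 1) ^+ j * j`!%:R * k`!%:R :> R[i].
Proof.
elim: k => [|k IH].
  rewrite addn0 big_mkcond big_ord_recr /= eqxx mulr1 fact0 mulr1.
  have -> : j`! = (\prod_(i < j) (j - i))%N by rewrite -ffactnn ffact_prod.
  rewrite natr_prod -[X in _ ^+ X]card_ord -prodr_const -big_split /=; apply: eq_bigr => i _.
  by rewrite ltn_eqF// mulN1r natrB 1?ltnW// opprB.
rewrite addnS big_mkcond big_ord_recr /= -big_mkcond IH gtn_eqF; last by rewrite ltnS leq_addr.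
by rewrite factS natrM -addnS natrD addrAC subrr add0r; ring.
Qed.

End EulerEstimates.

(** * The symbol as a limit of exponentials times rational functions *)

Section Symbol.
Variable R : realType.
Variables m k : nat.
Hypothesis m_gt0 : (0 < m)%N.
Implicit Types (z w : R[i]) (h : R -> R[i]).

Local Notation M := (m%:R : R).
Let M0 : 0 < M. Proof. by rewrite ltr0n. Qed.
Let mC : (m%:R : R[i]) != 0. Proof. by rewrite pnatr_eq0 -lt0n. Qed.
Let mE : (m%:R : R[i]) = M%:C. Proof. by rewrite -(rmorph_nat (real_complex R)). Qed.

(** The poles of [rho_mk m k] in the left half plane, all from the numerator.
    *)
Definition pole j : R := - (2 * k + 2 * m * j)%:R.
Definition arg z : R[i] := z / (2%:R * m%:R) + k%:R / m%:R.
(** [rho_mk] with the terms of Euler's limit in place of the Gamma values. *)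
Definition approx n z : R[i] := cpow (pi / M) (1 / (2%:R * m%:R) - z / m%:R) *
  (euler n (arg z) / euler n (arg (1 - z))).
(** The exponential rate of the approximants; it is eventually nonnegative,
    which makes their exponential factor inner. *)
Definition rate n : R := (ln n%:R - ln (pi / M)) / M.
(** [offset + j] is the point at which the denominator of [rho_mk] evaluates
    [Gamma] when [z] is [pole j]. *)
Definition offset : R := (1 + 4 * k%:R) / (2 * M).

Let poleC j : (pole j)%:C = - (2 * k + 2 * m * j)%:R :> R[i].
Proof. by rewrite /pole rmorphN rmorph_nat. Qed.

Lemma pole_le0 j : pole j <= 0.
Proof. by rewrite oppr_le0. Qed.

Lemma pole_inj : injective (fun j => (pole j)%:C : R[i]).
Proof.
move=> i j; rewrite !poleC => /oppr_inj/eqP; rewrite eqr_nat eqn_add2l.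
by rewrite eqn_pmul2l ?muln_gt0// => /eqP.
Qed.

Lemma arg_pole j z : arg z + j%:R = (z - (pole j)%:C) / (2%:R * m%:R).
Proof. by rewrite poleC opprK /arg !natrD !natrM; field. Qed.

Lemma nonpole_arg z : 0 < complex.Re z -> nonpole (arg z).
Proof.
move=> z0; apply: nonpole_right.
have -> : arg z = ((2 * M)^-1)%:C * z + (k%:R / M)%:C.
  rewrite /arg mulrC; congr (_ * _ + _).
    by rewrite [RHS]fmorphV [in RHS]rmorphM /= !rmorph_nat.
  by rewrite [RHS]rmorphM /= fmorphV !rmorph_nat.
rewrite ReD ReM /= mul0r subr0; apply: ltr_wpDr; first by rewrite divr_ge0// ltW.
by rewrite mulr_gt0// invr_gt0 mulr_gt0.
Qed.

(** The poles of the approximant are simple, and each pole [p] comes with the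
    zero [1 - p]: on the critical line every factor has modulus 1. *)
Lemma approx_product n z : nonpole (arg (1 - z)) ->
  approx n z = cexp ((rate n)%:C * (z - 2^-1%:C)) *
    \prod_(j < n.+1) ((1 - z - (pole j)%:C) / (z - (pole j)%:C)).
Proof.
move=> nz; rewrite /approx euler_quotient// mulrA; congr (_ * _).
  rewrite /cpow -cexpD; congr cexp.
  rewrite /rate /arg rmorphM rmorphB /= !fmorphV !rmorph_nat.
  by set a := (ln _)%:C; set b := (ln _)%:C; field.
apply: eq_bigr => j _; rewrite !arg_pole -mulf_div divff ?mulr1// invr_eq0.
by rewrite mulf_neq0.
Qed.

Let line_right y : 0 < complex.Re (critical_point y : R[i]).
Proof. by rewrite /= invr_gt0. Qed.

Let line_mirror (y : R) : 1 - critical_point y = (critical_point y)^* :> R[i].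
Proof. by apply: complexP => /=; [field|ring]. Qed.

Let line_right' y : 0 < complex.Re (1 - critical_point y : R[i]).
Proof. by rewrite line_mirror ReJ. Qed.

Lemma cabs_approx n y : cabs (approx n (critical_point y)) = 1.
Proof.
rewrite approx_product; last exact: nonpole_arg.
rewrite cabsM cabs_cexp ReM /= subrr mulr0 mul0r subr0 expR0 mul1r cabs_prod.
apply: big1 => j _; rewrite line_mirror cabsM cabsV.
have -> : (critical_point y)^* - (pole j)%:C = (critical_point y - (pole j)%:C)^*.
  by apply: complexP => /=; ring.
rewrite cabsJ divff// cabs_eq0; apply/eqP => /(congr1 (@complex.Re R)).
rewrite /= => /eqP; rewrite gt_eqF// ltr_wpDr ?invr_gt0//.
by rewrite oppr_ge0 pole_le0.
Qed.

Lemma approx_cvg y : ccvg (fun n => approx n (critical_point y)) (rho_mk m k (critical_point y)).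
Proof.
apply: ccvgM; first exact: ccvg_cst.
have [c1 _] := Gamma_cvg (nonpole_arg (line_right y)).
have [c2 g2] := Gamma_cvg (nonpole_arg (line_right' y)).
by apply: ccvgM => //; exact: ccvgV.
Qed.

Lemma cabs_rho (y : R) : cabs (rho_mk m k (critical_point y)) = 1.
Proof.
have [c1 g1] := Gamma_cvg (nonpole_arg (line_right y)).
have [c2 g2] := Gamma_cvg (nonpole_arg (line_right' y)).
have r0 : rho_mk m k (critical_point y) != 0.
  rewrite /rho_mk mulf_neq0 ?cpow_neq0// /phi_mk mulf_neq0 ?invr_eq0//.
have le1 : cabs (rho_mk m k (critical_point y)) <= 1.
  by apply: (ccvg_le (approx_cvg y)) => n; rewrite cabs_approx.
have ge1 : cabs (rho_mk m k (critical_point y))^-1 <= 1.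
  by apply: (ccvg_le (ccvgV r0 (approx_cvg y))) => n; rewrite cabsV cabs_approx invr1.
apply/eqP; rewrite eq_le le1 /=.
by move: ge1; rewrite cabsV invf_le1// cabs_gt0.
Qed.

Lemma cmeas_approx n : cmeasurable (fun y : R => approx n (critical_point y)).
Proof.
rewrite (_ : (fun y => _) = fun y => cexp ((rate n)%:C * (critical_point y - 2^-1%:C)) *
    \prod_(j < n.+1) ((1 - critical_point y - (pole j)%:C) * ck (pole j)%:C y)); last first.
  by apply/funext => y; rewrite approx_product//; exact: nonpole_arg.
apply: cmeasM; first by apply: (@cmeas_line _
  (fun z => cexp ((rate n)%:C * (z - 2^-1%:C))) 2^-1) => y; exact: cdiff_cexp_affine.
elim: (n.+1) => [|N IH]; first by under eq_fun do rewrite big_ord0; exact: cmeas_cst.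
under eq_fun do rewrite big_ord_recr; apply: cmeasM => //; apply: cmeasM.
  apply: cmeasB; last exact: cmeas_cst.
  apply: cmeasB; first exact: cmeas_cst.
  by apply: (@cmeas_line _ id 2^-1) => y; exact: cdiff_id.
by apply: cmeas_ck; rewrite lt_eqF//= (le_lt_trans (pole_le0 N))// invr_gt0.
Qed.

Lemma cmeas_rho : cmeasurable (fun y : R => rho_mk m k (critical_point y)).
Proof. exact: (cmeas_cvg cmeas_approx approx_cvg). Qed.

(** The residues of the approximant multiplied by the values at the poles of
    its exponential factor, in a form that exhibits the limit in [n]: the
    falling factorial is equivalent to [n ^+ j].  It also makes them 0 for [j >
    n], so that the finite sums of the approximants are kernel sums. *)
Definition coef n j : R[i] :=
  (2 * M)%:C * (- 1) ^+ j * cpow (pi / M) (offset + 2 * j%:R)%:C / j`!%:R *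
  ((n ^_ j)%:R / n%:R ^+ j) / euler n (offset + j%:R)%:C.

Definition coef_lim j : R[i] :=
  (2 * M)%:C * (- 1) ^+ j * cpow (pi / M) (offset + 2 * j%:R)%:C / j`!%:R /
  Gamma (offset + j%:R)%:C.

Lemma offset_gt0 : 0 < offset.
Proof. by rewrite divr_gt0 ?mulr_gt0// ltr_wpDr// mulr_ge0. Qed.

Let offset_pos j : 0 < offset + j%:R.
Proof. by rewrite ltr_wpDr// offset_gt0. Qed.

Lemma coef_cvg j : ccvg (coef^~ j) (coef_lim j).
Proof.
have [c1 g1] := Gamma_cvg (nonpole_right (offset_pos j : 0 < complex.Re (offset + j%:R)%:C)).
apply: ccvgM; last exact: ccvgV.
rewrite -[X in ccvg _ X]mulr1; apply: ccvgM; [exact: ccvg_cst|exact: ccvg_ffact].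
Qed.

(** These bounds are summable because of the factorial in the denominator,
    which comes from the differences between the poles. *)
Definition coef_bound j : R :=
  2 * M * expR ((ln (pi / M) + 2) * offset) *
  (expR (2 * (ln (pi / M) + 1)) ^+ j / j`!%:R).

Lemma coef_bound_ge0 j : 0 <= coef_bound j.
Proof. by rewrite !mulr_ge0 ?invr_ge0 ?exprn_ge0 ?expR_ge0// ltW. Qed.

Lemma coef_bound_cvg : cvgn (series coef_bound).
Proof. by apply: is_cvg_seriesZ; exact: is_cvg_series_exp_coeff. Qed.

Lemma coef_le n j : cabs (coef n j) <= coef_bound j.
Proof.
set x := offset + j%:R; have x0 : 0 < x := offset_pos j.
have xx : x * (1 + x) <= expR (2 * x).
  have e1 := expR_ge1Dx x.
  have x1 : x <= expR x by apply: le_trans e1; rewrite lerDr.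
  have x2 : 0 <= 1 + x by rewrite addr_ge0// ltW.
  by rewrite mulr_natl mulr2n expRD ler_pM// ltW.
have b1 : cabs ((n ^_ j)%:R / n%:R ^+ j : R[i]) * (cabs (euler n x%:C))^-1 <= 1 * expR (2 * x).
  apply: ler_pM; rewrite ?cabs_ge0 ?invr_ge0 ?cabs_ge0 ?ffact_le//.
  exact: le_trans (euler_inv_le n x0) xx.
rewrite /coef -/x cabsM cabsV cabsM -mulrA.
have A : cabs ((2 * M)%:C * (- 1) ^+ j * cpow (pi / M) (offset + 2 * j%:R)%:C / j`!%:R) =
    2 * M * expR (ln (pi / M) * (offset + 2 * j%:R)) / j`!%:R.
  rewrite cabsM [X in X * _]cabsM [X in X * _ * _]cabsM cabs_cpow.
  rewrite cabsV cabs_nat cabsX cabsN cabs1 expr1n mulr1 cabs_real.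
  by rewrite ger0_norm// mulr_ge0// ltW.
rewrite A; apply: (@le_trans _ _ (2 * M * expR (ln (pi / M) * (offset + 2 * j%:R)) / j`!%:R * (1 * expR (2 * x)))).
  by apply: ler_wpM2l => //; rewrite !mulr_ge0 ?invr_ge0 ?expR_ge0// ltW.
rewrite /coef_bound mul1r -expRM_natl le_eqVlt; apply/orP; left; apply/eqP.
rewrite mulrAC -!mulrA; congr (_ * (_ * _)).
rewrite [RHS]mulrA -expRD [LHS]mulrA -expRD.
by congr (expR _ / _); rewrite /x; ring.
Qed.

End Symbol.

Section SymbolResidues.
Variable R : realType.
Variables m k : nat.
Hypothesis m_gt0 : (0 < m)%N.
Implicit Types (z w : R[i]) (h : R -> R[i]).

Local Notation M := (m%:R : R).
Let M0 : 0 < M. Proof. by rewrite ltr0n. Qed.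
Let M2 : (2 * M)%:C != 0 :> R[i]. Proof. by rewrite fmorph_eq0 mulf_neq0// gt_eqF. Qed.
Let P j : R[i] := (pole R m k j)%:C.
Let D j : R[i] := 1 - 2 * P j.
Let X j : R[i] := (offset R m k + j%:R)%:C.

Let natC n : (n%:R : R[i]) = (n%:R : R)%:C. Proof. by rewrite rmorph_nat. Qed.

Let poleB i j : P j - P i = (2 * M)%:C * (i%:R - j%:R).
Proof.
by rewrite !natC -!rmorphB -rmorphM; congr (_%:C); rewrite /pole !natrD !natrM; ring.
Qed.

Let poleN i j : 1 - P j - P i = (2 * M)%:C * (X j + i%:R).
Proof.
rewrite natC -[1](rmorph1 (real_complex R)) -!rmorphB -rmorphD -rmorphM; congr (_%:C).
rewrite /pole /offset !natrD !natrM; field.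
by rewrite gt_eqF.
Qed.

Lemma residueE n j : (j <= n)%N -> residue P D n.+1 j =
  (2 * M)%:C * \prod_(i < n.+1) (X j + i%:R) / ((- 1) ^+ j * j`!%:R * (n - j)`!%:R).
Proof.
move=> jn; rewrite /residue -prod_differences subnKC//.
have jo : (j < n.+1)%N by [].
rewrite [X in _ * X / _](bigD1 (Ordinal jo))//= mulrA -[RHS]mulrA; congr (_ * _).
  by rewrite /D -poleN; ring.
rewrite -prodf_div; apply: eq_big => [i|i ij]; first by rewrite -val_eqE.
have nij : (i%:R - j%:R : R[i]) != 0 by rewrite subr_eq0 eqr_nat.
have -> : -1 + D i / (P j - P i) = (1 - P j - P i) / (P j - P i).
  have : P j - P i != 0 by rewrite poleB mulf_neq0.
  by rewrite /D; move: (P j) (P i) => a b ab; field.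
by rewrite poleN poleB -mulf_div divff// mul1r.
Qed.

(** The product of all [X j + i] in the residue is the denominator of Euler's
    term at [X j]; its powers of [n] are absorbed by the exponential factor. *)
Lemma coefE n j : (0 < n)%N -> (j <= n)%N ->
  residue P D n.+1 j * cexp ((rate R m n)%:C * (P j - 2^-1%:C)) = coef R m k n j.
Proof.
move=> n0 jn; rewrite residueE// /coef -/(X j).
have xj : nonpole (X j).
  by apply: nonpole_right => /=; rewrite ltr_wpDr// offset_gt0.
have n0' : 0 < n%:R :> R by rewrite ltr0n.
have E1 : \prod_(i < n.+1) (X j + i%:R) = n`!%:R * cpow n%:R (X j) / euler n (X j).
  have e0 := euler_neq0 n xj; apply: (mulIf e0); rewrite divfK// /euler mulrC divfK//.
  exact: prod_nonpole.
have E2 : cexp ((rate R m n)%:C * (P j - 2^-1%:C)) * cpow n%:R (X j) =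
    cpow (pi / M) (offset R m k + 2 * j%:R)%:C / n%:R ^+ j.
  have -> : (n%:R : R[i]) ^+ j = cexp (j%:R * (ln n%:R)%:C).
    by rewrite cexpMn cexp_real lnK// ?posrE// -natC.
  rewrite /cpow -cexpN -!cexpD; congr cexp.
  rewrite natC /P /X -!rmorphB -!rmorphM -!rmorphN -!rmorphD; congr (_%:C).
  rewrite /rate /pole /offset !natrD !natrM; field.
  by rewrite gt_eqF.
rewrite E1 -(ffact_fact jn) natrM.
have f0 := fact_neq0 R (n - j); have f1 := fact_neq0 R j.
have nn : (n%:R : R[i]) ^+ j != 0 by rewrite expf_neq0// pnatr_eq0 -lt0n.
have s0 : (-1 : R[i]) ^+ j != 0 by rewrite expf_neq0// oppr_eq0 oner_eq0.
have -> : cpow (pi / M) (offset R m k + 2 * j%:R)%:C =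
  cexp ((rate R m n)%:C * (P j - 2^-1%:C)) * cpow n%:R (X j) * n%:R ^+ j by rewrite E2 divfK.
have sV : ((-1 : R[i]) ^+ j)^-1 = (-1) ^+ j.
  by apply: (mulfI s0); rewrite mulfV// -expr2 sqrr_sign.
set c := (euler _ _)^-1; rewrite !invfM sV; move: f0 f1 nn.
set a := cexp _; set b := cpow _ _; set q := n%:R ^+ j.
set F := (n - j)`!%:R; set G := j`!%:R; move=> f0 f1 nn.
by field; rewrite f0 f1 nn.
Qed.

Lemma coef_small n j : (n < j)%N -> coef R m k n j = 0.
Proof. by move=> nj; rewrite /coef ffact_small// mul0r mulr0 mul0r. Qed.

(** Each approximant is an exponential, which preserves H^2 once its rate is
    nonnegative, times a rational function with simple poles: what it does to
    [h] outside H^2 is the principal part at these poles. *)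
Lemma approx_H2 n h : (0 < n)%N -> 0 <= rate R m n -> H2 h ->
  H2 (fun y => approx m k n (critical_point y) * h y -
    kernel_sum (pole R m k) (coef R m k n) (fun j => cauchy h (P j)) y).
Proof.
move=> n0 r0 Hh.
have p_left j : complex.Re (P j) < 2^-1.
  by rewrite /= (le_lt_trans (pole_le0 _ _ _ _))// invr_gt0.
have [HE cE] := H2_exp r0 Hh.
pose E y := cexp ((rate R m n)%:C * (critical_point y - 2^-1%:C)) * h y.
rewrite (_ : (fun y => _) = fun y => (-1) ^+ n.+1 * E y +
    \sum_(j < n.+1) residue P D n.+1 j * quotient E (P j) y).
  apply: (H2D (H2Z _ HE)).
  apply: (@H2_sum _ n.+1 (fun j y => residue P D n.+1 j * quotient E (P j) y)) => j _.
  by apply: H2Z; exact: H2_quotient.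
apply/funext => y; rewrite approx_product//; last first.
  apply: nonpole_arg => //; rewrite (_ : 1 - _ = (critical_point y)^*) ?ReJ/= ?invr_gt0//.
  by apply: complexP => /=; [field|ring].
have neq j : critical_point y - P j != 0 by apply: ck_neq0; rewrite lt_eqF.
have -> : \prod_(j < n.+1) ((1 - critical_point y - (pole R m k j)%:C) / (critical_point y - (pole R m k j)%:C)) =
    \prod_(j < n.+1) (- 1 + D j / (critical_point y - P j)).
  apply: eq_bigr => j _; rewrite /D -/(P j); move: (neq j); move: (P j) (critical_point y) => a b ab.
  by field.
rewrite partial_fractions; last first.
- by move=> j _; rewrite -subr_eq0.
- exact: pole_inj.
rewrite /kernel_sum (@csum_finite _ _ n.+1); last first.
  by move=> j nj; rewrite coef_small// !mul0r.
rewrite mulrAC -/(E y) mulrDr mulrC -addrA; congr (_ + _).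
rewrite mulr_sumr -sumrB; apply: eq_bigr => j _.
have cEj : cauchy E (P j) = _ := cE _ (p_left j).
by rewrite -coefE// -1?ltnS// /quotient cEj /ck; ring.
Qed.

End SymbolResidues.

Section QuasiInnerRho.
Variable R : realType.
Variables m k : nat.
Hypothesis m_gt0 : (0 < m)%N.

Lemma rate_ge0 : exists2 N, (0 < N)%N & forall n, (N <= n)%N -> 0 <= rate R m n.
Proof.
have M0 : 0 < m%:R :> R by rewrite ltr0n.
have pm : 0 < pi / m%:R :> R by rewrite divr_gt0// pi_gt0.
exists (Num.bound (pi / m%:R : R)).+1 => // n Nn.
have n0 : 0 < n%:R :> R by rewrite ltr0n (leq_trans _ Nn).
rewrite divr_ge0 ?(ltW M0)// subr_ge0 ler_ln ?posrE// ltW//.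
by rewrite (lt_le_trans (archi_boundP (ltW pm)))// ler_nat (leq_trans _ Nn).
Qed.

Theorem quasi_inner_rho : quasi_inner (fun y : R => rho_mk m k (critical_point y)).
Proof.
have r1 y := cabs_rho k m_gt0 y.
split; first exact: cmeas_rho.
  by apply: aeW => y; rewrite cabsE r1.
apply: (compact_hankel (pole_le0 R m k) (@coef_bound_cvg R m k) (@coef_bound_ge0 R m k)
  (u := fun y => rho_mk m k (critical_point y)) (c := coef_lim R m k)).
- exact: cmeas_rho.
- by move=> y; rewrite r1.
- move=> j; have cj : ccvg ((coef R m k)^~ j) (coef_lim R m k j) by exact: coef_cvg.
  by apply: (ccvg_le cj) => n; exact: coef_le.
move=> h Hh; have [N N0 HN] := rate_ge0.
apply: (kernel_sum_limit (pole_le0 R m k) (@coef_bound_cvg R m k) (@coef_bound_ge0 R m k)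
  (un := fun n y => approx m k n (critical_point y)) (cn := coef R m k) (N := N)) => //.
- by move=> n; exact: cmeas_approx.
- by move=> n y; rewrite cabs_approx.
- by move=> y; exact: approx_cvg.
- by move=> n j; exact: coef_le.
- by move=> j; exact: coef_cvg.
by move=> n Nn; apply: approx_H2 => //; [exact: leq_trans N0 Nn|exact: HN].
Qed.

End QuasiInnerRho.

Theorem lemma4p7 (R : realType) (m : nat) (m_ge1 : (1 <= m)%N) :
  (forall k : 'I_m, quasi_inner (fun y : R => rho_mk m k (critical_point y))) /\
  (forall z : R[i], \prod_(k < m) rho_mk m k z = rho_infty z).
Proof.
split=> [k|z]; first exact: quasi_inner_rho.
exact: prod_rho.
Qed.
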